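(* Let $D$ be a weakly locally finite division ring with infinite center $F$, let $n\ge 1$, and let $N$ be an almost subnormal subgroup of $\mathrm{GL}_n(D)$. If $n\ge 2$, assume in addition that $D$ is not a locally finite field. If $N$ satisfies a non-trivial generalized power central group identity, then $N$ is central, i.e. $N\subseteq F$.
   Context: A division ring is centrally finite if it is finite-dimensional over its center. A division ring $D$ is weakly locally finite if every finite subset of $D$ generates a centrally finite division subring. A field is locally finite if every finite subset of it generates, over the prime subfield, a finite subfield. A subgroup $H$ of a group $G$ is almost subnormal in $G$ if there are subgroups $H=H_r\le H_{r-1}\le\cdots\le H_1=G$ such that for each $1<i\le r$, $H_i$ is normal in $H_{i-1}$ or $H_i$ has finite index in $H_{i-1}$. Let $D$ be a division ring with center $F$ and $A=\mathrm{M}_n(D)$, so $A^*=\mathrm{GL}_n(D)$; $F$ is identified with the scalar matrices with entries in $F$, the center of $A$. For a finite set $X=\{x_1,\dots,x_m\}$ of non-commuting indeterminates, $F[X,X^{-1}]$ denotes the group algebra over $F$ of the free group on $X$, and $A_F[X,X^{-1}]=A*_F F[X,X^{-1}]$ is the free product (coproduct) over $F$. A generalized group monomial over $\mathrm{GL}_n(D)$ is an element $w\in A_F[X,X^{-1}]\setminus A$ of the form $w(x_1,\dots,x_m)=a_1x_{i_1}^{n_1}a_2x_{i_2}^{n_2}\cdots a_tx_{i_t}^{n_t}a_{t+1}$ with $a_j\in A^*$, $n_j\in\mathbb{Z}$, $x_{i_j}\in X$. For a subgroup $H$ of $\mathrm{GL}_n(D)$, such a $w$ is a generalized power central group identity (GPCGI)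 of $H$ (and $H$ satisfies the GPCGI $w$) if for every $(c_1,\dots,c_m)\in H^m$ there is a positive integer $p$, depending on $(c_1,\dots,c_m)$, with $w(c_1,\dots,c_m)^p\in F$. A GPCGI $w$ is non-trivial if $w^p\in A_F[X,X^{-1}]\setminus A$ for every positive integer $p$. *)

(* Defs.v *)
From HB Require Import structures.
From mathcomp Require Import all_boot all_order all_algebra finmap.
From mathcomp Require Import generic_quotient.
From mathcomp Require Import boolp classical_sets cardinality.
From mathcomp Require Import monalg.

Set Implicit Arguments.
Unset Strict Implicit.
Unset Printing Implicit Defensive.

Import GRing.Theory.

Local Open Scope quotient_scope.
Local Open Scope classical_set_scope.
Local Open Scope ring_scope.

Definition division_ring (D : unitRingType) : Prop :=
  forall x : D, x != 0 -> x \is a GRing.unit.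

Section DivisionSubrings.
Variable D : unitRingType.
Implicit Types (S X : set D).

(* When [D] is a division ring these are its division subrings: recall that
   [0^-1 = 0], so that closure under [x / y] needs no side condition. *)
Definition division_subring S : Prop := GRing.divring_closed (mem S).

Definition generated_division_subring X : set D := smallest division_subring X.

Definition center_of S : set D :=
  [set x | S x /\ forall y, S y -> x * y = y * x].

Definition centrally_finite S : Prop :=
  exists b : seq D, {subset b <= S} /\
    forall x, S x -> exists2 c : 'I_(size b) -> D,
      forall k, center_of S (c k) & x = \sum_(k < size b) c k * b`_k.

Definition weakly_locally_finite : Prop :=
  forall X, finite_set X -> centrally_finite (generated_division_subring X).

(* Every division subring contains the prime subfield, so in a field
   [generated_division_subring X] is the subfield generated by [X] over the
   prime subfield. *)
Definition locally_finite_field : Prop :=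
  (forall x y : D, x * y = y * x) /\
  forall X, finite_set X -> finite_set (generated_division_subring X).

End DivisionSubrings.

Section Center.
Variable R : nzRingType.

Definition central : {pred R} := fun x => `[< forall y, x * y = y * x >].

Lemma centralP x : reflect (forall y, x * y = y * x) (x \in central).
Proof. exact: asboolP. Qed.

Fact central_subring : subring_closed central.
Proof.
split=> [|x y /centralP cx /centralP cy|x y /centralP cx /centralP cy].
- by apply/centralP => y; rewrite mul1r mulr1.
- by apply/centralP => z; rewrite mulrBl mulrBr cx cy.
- by apply/centralP => z; rewrite -mulrA cy mulrA cx mulrA.
Qed.

HB.instance Definition _ :=
  GRing.isSubringClosed.Build R central central_subring.

Record center := Center { center_val : R; _ : center_val \in central }.

HB.instance Definition _ := [isSub for center_val].
HB.instance Definition _ := [Choice of center by <:].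
HB.instance Definition _ := [SubChoice_isSubNzRing of center by <:].

Fact center_mulC : commutative (@GRing.mul center).
Proof. by move=> x y; apply/val_inj/(centralP _ (valP x)). Qed.

HB.instance Definition _ :=
  GRing.PzRing_hasCommutativeMul.Build center center_mulC.

End Center.

Section ScalarCenter.
Variables (D : nzRingType) (n : nat).

(* The identification of the center of [D] with the center of [M_n(D)]. *)
Definition scalar_center (z : center D) : 'M[D]_n := (val z)%:M.

Fact scalar_center_zmod : zmod_morphism scalar_center.
Proof. by move=> x y; rewrite /scalar_center !raddfB. Qed.

Fact scalar_center_monoid : monoid_morphism scalar_center.
Proof. by split=> // x y; rewrite /scalar_center -[RHS]scalar_mxM. Qed.

HB.instance Definition _ :=
  GRing.isZmodMorphism.Build (center D) 'M[D]_n scalar_center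
    scalar_center_zmod.
HB.instance Definition _ :=
  GRing.isMonoidMorphism.Build (center D) 'M[D]_n scalar_center
    scalar_center_monoid.

Lemma scalar_center_comm z (a : 'M[D]_n) :
  scalar_center z * a = a * scalar_center z.
Proof.
rewrite [LHS]mul_scalar_mx; apply/matrixP=> i j; rewrite !mxE.
rewrite (bigD1 j) //= !mxE eqxx mulr1n big1 => [|k kj]; last first.
  by rewrite !mxE (negbTE kj) mulr0n mulr0.
by rewrite addr0; apply: (centralP _ (valP z)).
Qed.

End ScalarCenter.

Section UnitGroup.
Variable R : pzRingType.

(* A unit is stored with its (unique) inverse. *)
Record unit_group := UnitGroup {
  unit_pair : R * R;
  _ : (unit_pair.1 * unit_pair.2 == 1) && (unit_pair.2 * unit_pair.1 == 1)
}.

HB.instance Definition _ := [isSub for unit_pair].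
HB.instance Definition _ := [Choice of unit_group by <:].

Definition unit_val (u : unit_group) : R := (val u).1.
Definition unit_inv (u : unit_group) : R := (val u).2.

Lemma unit_valK u : unit_val u * unit_inv u = 1.
Proof. by have /andP[/eqP] := valP u. Qed.

Lemma unit_invK u : unit_inv u * unit_val u = 1.
Proof. by have /andP[_ /eqP] := valP u. Qed.

Lemma unit_val_inj : injective unit_val.
Proof.
move=> u v uv; apply/val_inj/eqP; rewrite -pair_eqE /=; apply/andP; split.
  exact/eqP.
apply/eqP; change (unit_inv u = unit_inv v).
by rewrite -[LHS]mulr1 -(unit_valK v) -uv mulrA unit_invK mul1r.
Qed.

Fact unit_one_subproof (p := (1, 1) : R * R) :
  (p.1 * p.2 == 1) && (p.2 * p.1 == 1).
Proof. by rewrite /= mulr1 eqxx. Qed.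

Fact unit_mul_subproof u v (p := (unit_val u * unit_val v,
    unit_inv v * unit_inv u)) : (p.1 * p.2 == 1) && (p.2 * p.1 == 1).
Proof.
rewrite /= -!mulrA [unit_val v * _]mulrA [unit_inv u * _]mulrA.
by rewrite unit_valK unit_invK !mul1r unit_valK unit_invK eqxx.
Qed.

Fact unit_inv_subproof u (p := (unit_inv u, unit_val u)) :
  (p.1 * p.2 == 1) && (p.2 * p.1 == 1).
Proof. by rewrite /= unit_valK unit_invK eqxx. Qed.

Definition ug_one := UnitGroup unit_one_subproof.
Definition ug_mul u v := UnitGroup (unit_mul_subproof u v).
Definition ug_inv u := UnitGroup (unit_inv_subproof u).

Fact ug_mulA : associative ug_mul.
Proof. by move=> u v w; apply: unit_val_inj; apply: mulrA. Qed.
Fact ug_mul1 : left_id ug_one ug_mul.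
Proof. by move=> u; apply: unit_val_inj; apply: mul1r. Qed.
Fact ug_1mul : right_id ug_one ug_mul.
Proof. by move=> u; apply: unit_val_inj; apply: mulr1. Qed.
Fact ug_mulV : left_inverse ug_one ug_inv ug_mul.
Proof. by move=> u; apply: unit_val_inj; apply: unit_invK. Qed.
Fact ug_Vmul : right_inverse ug_one ug_inv ug_mul.
Proof. by move=> u; apply: unit_val_inj; apply: unit_valK. Qed.

HB.instance Definition _ :=
  isGroup.Build unit_group ug_mulA ug_mul1 ug_1mul ug_mulV ug_Vmul.

Lemma unit_val1 : unit_val 1%g = 1. Proof. by []. Qed.
Lemma unit_valM u v : unit_val (u * v)%g = unit_val u * unit_val v.
Proof. by []. Qed.

End UnitGroup.

Definition GL (D : nzRingType) (n : nat) : groupType := unit_group 'M[D]_n.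

Section AlmostSubnormal.
Variable G : groupType.
Implicit Types (H K N : set G).

Definition is_subgroup H : Prop := group_closed (mem H).

Definition normal_in H K : Prop :=
  forall h k, H h -> K k -> H (h ^ k)%g.

(* The set of left cosets [k H] with [k \in K] is finite. *)
Definition finite_index_in H K : Prop :=
  finite_set [set [set (k * h)%g | h in H] | k in K].

Definition almost_subnormal N : Prop :=
  exists (r : nat) (H : nat -> set G),
    [/\ H 0%N = setT, H r = N,
        forall i, (i <= r)%N -> is_subgroup (H i) &
        forall i, (i < r)%N -> H i.+1 `<=` H i /\
          (normal_in (H i.+1) (H i) \/ finite_index_in (H i.+1) (H i))].

End AlmostSubnormal.

Definition expgz (G : groupType) (g : G) (k : int) : G :=
  match k with Posz p => (g ^+ p)%g | Negz p => (g ^- p.+1)%g end.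

Section FreeGroup.
Variable I : choiceType.

(* The letter [(x, false)] is the generator [x], the letter [(x, true)] its
   inverse. *)
Definition letter : Type := (I * bool)%type.
HB.instance Definition _ := Choice.on letter.

Definition flip (a : letter) : letter := (a.1, ~~ a.2).

Definition reduced (s : seq letter) : bool :=
  sorted (fun a b => b != flip a) s.

Definition reduced_cons (a : letter) (s : seq letter) : seq letter :=
  if s is b :: s' then if b == flip a then s' else a :: s else [:: a].

Record free_group := FreeGroup { word : seq letter; _ : reduced word }.

HB.instance Definition _ := [isSub for word].
HB.instance Definition _ := [Choice of free_group by <:].

Lemma flipK : involutive flip. Proof. by case=> x b; rewrite /flip negbK. Qed.

Lemma reduced_consP a s : reduced s -> reduced (reduced_cons a s).
Proof.
case: s => //= b s; case: eqP => [_|/eqP ba] /=; last by rewrite ba.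
exact: path_sorted.
Qed.

Lemma reduced_consK a s :
  reduced s -> reduced_cons (flip a) (reduced_cons a s) = s.
Proof.
case: s => [|b s] /=; first by rewrite flipK eqxx.
case: eqP => [->|_] /=; last by rewrite flipK eqxx.
by case: s => //= c s /andP[/negbTE->].
Qed.

Definition fg_cat (s t : seq letter) := foldr reduced_cons t s.

Lemma fg_catP s t : reduced t -> reduced (fg_cat s t).
Proof. by move=> rt; elim: s => //= a s; apply: reduced_consP. Qed.

Lemma fg_cat_cons a s t :
  reduced s -> reduced t ->
  fg_cat (reduced_cons a s) t = reduced_cons a (fg_cat s t).
Proof.
case: s => //= b s rs rt; case: eqP => //= ->.
have := reduced_consK (flip a) (fg_catP s rt); rewrite flipK => -> //.
Qed.

Lemma fg_catA s t u : reduced t -> reduced u ->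
  fg_cat s (fg_cat t u) = fg_cat (fg_cat s t) u.
Proof.
move=> rt ru; elim: s => //= a s ->.
by rewrite fg_cat_cons // fg_catP.
Qed.

Lemma fg_cats0 s : reduced s -> fg_cat s [::] = s.
Proof.
elim: s => //= a s IHs rs; rewrite IHs; last exact: path_sorted rs.
by case: s rs {IHs} => //= b s /andP[/negbTE->].
Qed.

Definition fg_rev (s : seq letter) := rev (map flip s).

Lemma fg_revP s : reduced s -> reduced (fg_rev s).
Proof.
rewrite /reduced /fg_rev rev_sorted sorted_map.
by apply: sub_sorted => a b /=; rewrite flipK eq_sym (can2_eq flipK flipK).
Qed.

Lemma fg_revK s : reduced s -> fg_cat (fg_rev s) s = [::].
Proof.
elim: s => //= a s IHs rs; have rs' : reduced s := path_sorted rs.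
rewrite /fg_rev /= rev_cons -cats1 /fg_cat foldr_cat /= flipK eqxx.
exact: IHs.
Qed.

Lemma fg_revKr s : reduced s -> fg_cat s (fg_rev s) = [::].
Proof.
move=> rs; have := fg_revK (fg_revP rs); rewrite /fg_rev map_rev revK.
by rewrite -map_comp (eq_map flipK) map_id.
Qed.

Definition fg_one : free_group := @FreeGroup [::] isT.
Definition fg_mul (s t : free_group) : free_group :=
  FreeGroup (fg_catP (val s) (valP t)).
Definition fg_inv (s : free_group) : free_group :=
  FreeGroup (fg_revP (valP s)).

Fact fg_mulA : associative fg_mul.
Proof.
by move=> s t u; apply: val_inj; apply: fg_catA; apply: valP.
Qed.
Fact fg_mul1 : left_id fg_one fg_mul.
Proof. by move=> s; apply: val_inj. Qed.
Fact fg_1mul : right_id fg_one fg_mul.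
Proof. by move=> s; apply/val_inj/fg_cats0/valP. Qed.
Fact fg_mulV : left_inverse fg_one fg_inv fg_mul.
Proof. by move=> s; apply/val_inj/fg_revK/valP. Qed.
Fact fg_Vmul : right_inverse fg_one fg_inv fg_mul.
Proof. by move=> s; apply/val_inj/fg_revKr/valP. Qed.

HB.instance Definition _ :=
  isGroup.Build free_group fg_mulA fg_mul1 fg_1mul fg_mulV fg_Vmul.

Definition fg_gen (x : I) : free_group := @FreeGroup [:: (x, false)] isT.

Section Lift.
Variables (G : groupType) (c : I -> G).

Definition letter_lift (a : letter) : G := if a.2 then (c a.1)^-1%g else c a.1.

Definition fg_lift (s : free_group) : G :=
  (\prod_(a <- word s) letter_lift a)%g.

Lemma fg_lift_gen x : fg_lift (fg_gen x) = c x.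
Proof. by rewrite /fg_lift big_seq1. Qed.

Lemma fg_liftM s t : fg_lift (s * t)%g = (fg_lift s * fg_lift t)%g.
Proof.
case: s t => s rs [t rt]; rewrite /fg_lift /=.
elim: s {rs} => [|a s IHs] /=; first by rewrite big_nil mul1g.
rewrite big_cons -mulgA -IHs; case: (fg_cat s t) => [|b u] /=.
  by rewrite big_seq1 big_nil mulg1.
case: eqP => [->|_]; last by rewrite !big_cons.
rewrite big_cons mulgA; case: a => x [] /=; rewrite /letter_lift /=.
  by rewrite mulVg mul1g.
by rewrite mulgV mul1g.
Qed.

End Lift.
End FreeGroup.

Section GroupAlgebra.
Variables (F : nzRingType) (G : groupType).

Definition grpalg : Type := {malg F[G]}.
HB.instance Definition _ := GRing.Zmodule.on grpalg.

Implicit Types x y z : grpalg.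

Definition ga_one : grpalg := << (1 : F) *g (1%g : G) >>.
Definition ga_mul x y : grpalg :=
  \sum_(g <- msupp x) \sum_(h <- msupp y) << x@_g * y@_h *g (g * h)%g >>.

Lemma ga_mulw (d1 d2 : {fset G}) x y :
  (msupp x `<=` d1)%fset -> (msupp y `<=` d2)%fset ->
  ga_mul x y =
    \sum_(g <- d1) \sum_(h <- d2) << x@_g * y@_h *g (g * h)%g >>.
Proof.
move=> le_d1 le_d2; rewrite /ga_mul (big_fset_incl _ le_d1) /=.
  apply/eq_bigr=> k1 _; apply/big_fset_incl => // k _ /mcoeff_outdom ->.
  by rewrite mulr0 monalgU0.
move=> k _ /mcoeff_outdom g1k.
by rewrite big1 // => k' _; rewrite g1k mul0r monalgU0.
Qed.

Lemma ga_mulUU (a b : F) (g h : G) :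
  ga_mul << a *g g >> << b *g h >> = << a * b *g (g * h)%g >>.
Proof.
by rewrite (ga_mulw msuppU_le msuppU_le) !big_seq_fset1 !mcoeffUU.
Qed.

Fact ga_mulDl : left_distributive ga_mul +%R.
Proof.
move=> x y z.
rewrite (ga_mulw (msuppD_le x y) (fsubset_refl _)).
rewrite [X in _ = X + _](ga_mulw (fsubsetUl _ (msupp y)) (fsubset_refl _)).
rewrite [X in _ = _ + X](ga_mulw (fsubsetUr (msupp x) _) (fsubset_refl _)).
rewrite -big_split /=; apply/eq_bigr=> k1 _.
rewrite -big_split /=; apply/eq_bigr=> k2 _.
by rewrite mcoeffD mulrDl monalgUD.
Qed.

Fact ga_mulDr : right_distributive ga_mul +%R.
Proof.
move=> x y z.
rewrite (ga_mulw (fsubset_refl _) (msuppD_le y z)).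
rewrite [X in _ = X + _](ga_mulw (fsubset_refl _) (fsubsetUl _ (msupp z))).
rewrite [X in _ = _ + X](ga_mulw (fsubset_refl _) (fsubsetUr (msupp y) _)).
rewrite -big_split /=; apply/eq_bigr=> k1 _.
rewrite -big_split /=; apply/eq_bigr=> k2 _.
by rewrite mcoeffD mulrDr monalgUD.
Qed.

Lemma ga_mul0l : left_zero (0 : grpalg) ga_mul.
Proof. by move=> x; rewrite /ga_mul msupp0 big_seq_fset0. Qed.

Lemma ga_mul0r : right_zero (0 : grpalg) ga_mul.
Proof.
by move=> x; rewrite /ga_mul msupp0 big1 // => g _; rewrite big_seq_fset0.
Qed.

Lemma ga_ind (P : grpalg -> Prop) :
  P 0 -> (forall x y, P x -> P y -> P (x + y)) ->
  (forall (a : F) (g : G), P << a *g g >>) -> forall x, P x.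
Proof.
by move=> P0 PD PU x; rewrite [x]monalgE; elim/big_ind: _.
Qed.

Fact ga_mulA : associative ga_mul.
Proof.
move=> x y z; elim/ga_ind: x => [|x x' hx hx'|a g].
- by rewrite !ga_mul0l.
- by rewrite !ga_mulDl hx hx'.
elim/ga_ind: y => [|y y' hy hy'|b h].
- by rewrite !(ga_mul0l, ga_mul0r).
- by rewrite !(ga_mulDl, ga_mulDr) hy hy'.
elim/ga_ind: z => [|z z' hz hz'|c k].
- by rewrite !ga_mul0r.
- by rewrite !ga_mulDr hz hz'.
by rewrite !ga_mulUU mulrA mulgA.
Qed.

Fact ga_mul1l : left_id ga_one ga_mul.
Proof.
move=> x; elim/ga_ind: x => [|x y hx hy|a g].
- by rewrite ga_mul0r.
- by rewrite ga_mulDr hx hy.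
by rewrite ga_mulUU mul1r mul1g.
Qed.

Fact ga_mul1r : right_id ga_one ga_mul.
Proof.
move=> x; elim/ga_ind: x => [|x y hx hy|a g].
- by rewrite ga_mul0l.
- by rewrite ga_mulDl hx hy.
by rewrite ga_mulUU mulr1 mulg1.
Qed.

Fact ga_one_neq0 : ga_one != 0.
Proof. by rewrite monalgU_eq0 oner_eq0. Qed.

HB.instance Definition _ := GRing.Zmodule_isNzRing.Build grpalg
  ga_mulA ga_mul1l ga_mul1r ga_mulDl ga_mulDr ga_one_neq0.

Definition ga_const (a : F) : grpalg := << a *g (1%g : G) >>.
Definition ga_elt (g : G) : grpalg := << (1 : F) *g g >>.

Fact ga_const_zmod : zmod_morphism ga_const.
Proof. by move=> a b; rewrite /ga_const monalgUB. Qed.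

Fact ga_const_monoid : monoid_morphism ga_const.
Proof. by split=> // a b; rewrite [RHS]ga_mulUU mulg1. Qed.

HB.instance Definition _ :=
  GRing.isZmodMorphism.Build F grpalg ga_const ga_const_zmod.
HB.instance Definition _ :=
  GRing.isMonoidMorphism.Build F grpalg ga_const ga_const_monoid.

Section Lift.
Variables (C : pzRingType) (f : F -> C) (phi : G -> C).

Definition ga_lift (x : grpalg) : C := \sum_(g <- msupp x) f x@_g * phi g.
End Lift.

Section LiftTheory.
Variables (C : pzRingType) (f : {rmorphism F -> C}) (phi : G -> C).
Hypothesis phi1 : phi 1%g = 1.
Hypothesis phiM : forall g h, phi (g * h)%g = phi g * phi h.
Hypothesis fphiC : forall a g, f a * phi g = phi g * f a.

Lemma ga_liftw (d : {fset G}) x : (msupp x `<=` d)%fset ->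
  ga_lift f phi x = \sum_(g <- d) f x@_g * phi g.
Proof.
move=> le_d; rewrite /ga_lift; apply/big_fset_incl => // k _.
by move=> /mcoeff_outdom ->; rewrite rmorph0 mul0r.
Qed.

Lemma ga_liftU a g : ga_lift f phi << a *g g >> = f a * phi g.
Proof. by rewrite (ga_liftw msuppU_le) big_seq_fset1 mcoeffUU. Qed.

Lemma ga_lift_const a : ga_lift f phi (ga_const a) = f a.
Proof. by rewrite ga_liftU phi1 mulr1. Qed.

Lemma ga_lift_elt g : ga_lift f phi (ga_elt g) = phi g.
Proof. by rewrite ga_liftU rmorph1 mul1r. Qed.

Lemma ga_liftD x y :
  ga_lift f phi (x + y) = ga_lift f phi x + ga_lift f phi y.
Proof.
rewrite (ga_liftw (msuppD_le x y)) (ga_liftw (fsubsetUl _ (msupp y))).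
rewrite (ga_liftw (fsubsetUr (msupp x) _)) -big_split /=.
by apply: eq_bigr => g _; rewrite mcoeffD rmorphD mulrDl.
Qed.

Lemma ga_lift0 : ga_lift f phi 0 = 0.
Proof. by rewrite /ga_lift msupp0 big_seq_fset0. Qed.

Lemma ga_liftM x y :
  ga_lift f phi (x * y) = ga_lift f phi x * ga_lift f phi y.
Proof.
elim/ga_ind: x => [|x x' hx hx'|a g].
- by rewrite mul0r ga_lift0 mul0r.
- by rewrite mulrDl !ga_liftD mulrDl hx hx'.
elim/ga_ind: y => [|y y' hy hy'|b h].
- by rewrite mulr0 ga_lift0 mulr0.
- by rewrite mulrDr !ga_liftD mulrDr hy hy'.
rewrite [_ * _](ga_mulUU a b g h) !ga_liftU rmorphM phiM.
by rewrite -!mulrA; congr (_ * _); rewrite !mulrA fphiC.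
Qed.

Lemma ga_lift1 : ga_lift f phi 1 = 1.
Proof. by rewrite ga_liftU rmorph1 phi1 mulr1. Qed.

Lemma ga_lift_unique (psi : {rmorphism grpalg -> C}) :
  (forall a, psi (ga_const a) = f a) -> (forall g, psi (ga_elt g) = phi g) ->
  psi =1 ga_lift f phi.
Proof.
move=> psif psiphi x; elim/ga_ind: x => [|x y hx hy|a g].
- by rewrite rmorph0 ga_lift0.
- by rewrite rmorphD ga_liftD hx hy.
rewrite ga_liftU -psif -psiphi -rmorphM; congr (psi _).
by rewrite [RHS]ga_mulUU mulr1 mul1g.
Qed.

End LiftTheory.
End GroupAlgebra.

Section Coproduct.
Variables (F A B : pzRingType).
Variables (i : {rmorphism F -> A}) (j : {rmorphism F -> B}).

Inductive coprod_term : Type :=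
| CInl of A
| CInr of B
| CAdd of coprod_term & coprod_term
| COpp of coprod_term
| CMul of coprod_term & coprod_term.

HB.instance Definition _ := gen_eqMixin coprod_term.
HB.instance Definition _ := gen_choiceMixin coprod_term.

(* The least congruence for which the terms form a ring, both inclusions are
   ring morphisms, and the two images of [F] agree. *)
Inductive coprod_eq : coprod_term -> coprod_term -> Prop :=
| CE_refl s : coprod_eq s s
| CE_sym s t : coprod_eq s t -> coprod_eq t s
| CE_trans s t u : coprod_eq s t -> coprod_eq t u -> coprod_eq s u
| CE_add s s' t t' : coprod_eq s s' -> coprod_eq t t' ->
    coprod_eq (CAdd s t) (CAdd s' t')
| CE_opp s s' : coprod_eq s s' -> coprod_eq (COpp s) (COpp s')
| CE_mul s s' t t' : coprod_eq s s' -> coprod_eq t t' ->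
    coprod_eq (CMul s t) (CMul s' t')
| CE_addA s t u : coprod_eq (CAdd s (CAdd t u)) (CAdd (CAdd s t) u)
| CE_addC s t : coprod_eq (CAdd s t) (CAdd t s)
| CE_add0 s : coprod_eq (CAdd (CInl 0) s) s
| CE_addN s : coprod_eq (CAdd (COpp s) s) (CInl 0)
| CE_mulA s t u : coprod_eq (CMul s (CMul t u)) (CMul (CMul s t) u)
| CE_mul1l s : coprod_eq (CMul (CInl 1) s) s
| CE_mul1r s : coprod_eq (CMul s (CInl 1)) s
| CE_mulDl s t u : coprod_eq (CMul (CAdd s t) u) (CAdd (CMul s u) (CMul t u))
| CE_mulDr s t u : coprod_eq (CMul s (CAdd t u)) (CAdd (CMul s t) (CMul s u))
| CE_inlD a a' : coprod_eq (CInl (a + a')) (CAdd (CInl a) (CInl a'))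
| CE_inlM a a' : coprod_eq (CInl (a * a')) (CMul (CInl a) (CInl a'))
| CE_inrD b b' : coprod_eq (CInr (b + b')) (CAdd (CInr b) (CInr b'))
| CE_inrM b b' : coprod_eq (CInr (b * b')) (CMul (CInr b) (CInr b'))
| CE_glue z : coprod_eq (CInl (i z)) (CInr (j z)).

Definition coprod_eqb : rel coprod_term := fun s t => `[< coprod_eq s t >].

Fact coprod_eqb_refl : reflexive coprod_eqb.
Proof. by move=> s; apply/asboolP/CE_refl. Qed.
Fact coprod_eqb_sym : symmetric coprod_eqb.
Proof. by move=> s t; apply/asboolP/asboolP; apply: CE_sym. Qed.
Fact coprod_eqb_trans : transitive coprod_eqb.
Proof.
by move=> t s u /asboolP st /asboolP tu; apply/asboolP/(CE_trans st tu).
Qed.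

Canonical coprod_equiv :=
  EquivRel coprod_eqb coprod_eqb_refl coprod_eqb_sym coprod_eqb_trans.

Definition coprod : Type := {eq_quot coprod_equiv}.
HB.instance Definition _ := Choice.on coprod.
HB.instance Definition _ := EqQuotient.on coprod.

Implicit Types x y z : coprod.

Definition coprod_class (s : coprod_term) : coprod := \pi_coprod s.

Lemma coprod_classP s t : coprod_class s = coprod_class t <-> coprod_eq s t.
Proof.
split=> [/eqmodP/asboolP //|st]; exact/eqmodP/asboolP.
Qed.

Lemma coprod_reprK s : coprod_eq (repr (coprod_class s)) s.
Proof. by apply/coprod_classP; rewrite /coprod_class reprK. Qed.

Definition coprod_add x y : coprod := coprod_class (CAdd (repr x) (repr y)).
Definition coprod_opp x : coprod := coprod_class (COpp (repr x)).
Definition coprod_mul x y : coprod := coprod_class (CMul (repr x) (repr y)).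

Lemma coprod_addE s t :
  coprod_add (coprod_class s) (coprod_class t) = coprod_class (CAdd s t).
Proof. by apply/coprod_classP; apply: CE_add; apply: coprod_reprK. Qed.

Lemma coprod_oppE s : coprod_opp (coprod_class s) = coprod_class (COpp s).
Proof. by apply/coprod_classP; apply: CE_opp; apply: coprod_reprK. Qed.

Lemma coprod_mulE s t :
  coprod_mul (coprod_class s) (coprod_class t) = coprod_class (CMul s t).
Proof. by apply/coprod_classP; apply: CE_mul; apply: coprod_reprK. Qed.

Lemma coprodW (P : coprod -> Prop) :
  (forall s, P (coprod_class s)) -> forall x, P x.
Proof. by move=> Ps x; rewrite -[x]reprK; apply: Ps. Qed.

Ltac by_class CE :=
  repeat (elim/coprodW => ?);
  rewrite ?(coprod_addE, coprod_oppE, coprod_mulE); apply/coprod_classP;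
  exact: CE.

Fact coprod_addA : associative coprod_add. Proof. by_class CE_addA. Qed.
Fact coprod_addC : commutative coprod_add. Proof. by_class CE_addC. Qed.
Fact coprod_add0 : left_id (coprod_class (CInl 0)) coprod_add.
Proof. by_class CE_add0. Qed.
Fact coprod_addN : left_inverse (coprod_class (CInl 0)) coprod_opp coprod_add.
Proof. by_class CE_addN. Qed.
Fact coprod_mulA : associative coprod_mul. Proof. by_class CE_mulA. Qed.
Fact coprod_mul1l : left_id (coprod_class (CInl 1)) coprod_mul.
Proof. by_class CE_mul1l. Qed.
Fact coprod_mul1r : right_id (coprod_class (CInl 1)) coprod_mul.
Proof. by_class CE_mul1r. Qed.
Fact coprod_mulDl : left_distributive coprod_mul coprod_add.
Proof. by_class CE_mulDl. Qed.
Fact coprod_mulDr : right_distributive coprod_mul coprod_add.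
Proof. by_class CE_mulDr. Qed.

HB.instance Definition _ := GRing.isZmodule.Build coprod
  coprod_addA coprod_addC coprod_add0 coprod_addN.
HB.instance Definition _ := GRing.Zmodule_isPzRing.Build coprod
  coprod_mulA coprod_mul1l coprod_mul1r coprod_mulDl coprod_mulDr.

Definition coprod_inl (a : A) : coprod := coprod_class (CInl a).
Definition coprod_inr (b : B) : coprod := coprod_class (CInr b).

Lemma coprod_glue (z : F) : coprod_inl (i z) = coprod_inr (j z).
Proof. exact/coprod_classP/CE_glue. Qed.

Fact coprod_inlD : {morph coprod_inl : a b / a + b}.
Proof.
by move=> a b; rewrite [RHS]coprod_addE; apply/coprod_classP/CE_inlD.
Qed.

Fact coprod_inrD : {morph coprod_inr : a b / a + b}.
Proof.
by move=> a b; rewrite [RHS]coprod_addE; apply/coprod_classP/CE_inrD.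
Qed.

Fact coprod_inl_zmod : zmod_morphism coprod_inl.
Proof.
by move=> a b; apply: (addIr (coprod_inl b)); rewrite -coprod_inlD !subrK.
Qed.

Fact coprod_inr_zmod : zmod_morphism coprod_inr.
Proof.
by move=> a b; apply: (addIr (coprod_inr b)); rewrite -coprod_inrD !subrK.
Qed.

Fact coprod_inl_monoid : monoid_morphism coprod_inl.
Proof.
by split=> // a b; rewrite [RHS]coprod_mulE; apply/coprod_classP/CE_inlM.
Qed.

Fact coprod_inr_monoid : monoid_morphism coprod_inr.
Proof.
split=> [|a b]; first by rewrite -(rmorph1 j) -coprod_glue rmorph1.
by rewrite [RHS]coprod_mulE; apply/coprod_classP/CE_inrM.
Qed.

HB.instance Definition _ :=
  GRing.isZmodMorphism.Build A coprod coprod_inl coprod_inl_zmod.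
HB.instance Definition _ :=
  GRing.isMonoidMorphism.Build A coprod coprod_inl coprod_inl_monoid.
HB.instance Definition _ :=
  GRing.isZmodMorphism.Build B coprod coprod_inr coprod_inr_zmod.
HB.instance Definition _ :=
  GRing.isMonoidMorphism.Build B coprod coprod_inr coprod_inr_monoid.

Section Lift.
Variables (C : pzRingType) (f : A -> C) (g : B -> C).

Fixpoint term_lift (s : coprod_term) : C :=
  match s with
  | CInl a => f a
  | CInr b => g b
  | CAdd s t => term_lift s + term_lift t
  | COpp s => - term_lift s
  | CMul s t => term_lift s * term_lift t
  end.

Definition coprod_lift (x : coprod) : C := term_lift (repr x).
End Lift.

Section LiftTheory.
Variables (C : pzRingType) (f : {rmorphism A -> C}) (g : {rmorphism B -> C}).
Hypothesis fg : forall z : F, f (i z) = g (j z).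

Lemma term_lift_eq s t : coprod_eq s t -> term_lift f g s = term_lift f g t.
Proof.
elim=> //= *; rewrite ?(rmorph0, rmorph1, rmorphD, rmorphM) //; try congruence.
- exact: addrA.
- exact: addrC.
- exact: add0r.
- exact: addNr.
- exact: mulrA.
- exact: mul1r.
- exact: mulr1.
- exact: mulrDl.
- exact: mulrDr.
Qed.

Lemma coprod_lift_class s :
  coprod_lift f g (coprod_class s) = term_lift f g s.
Proof. exact/term_lift_eq/coprod_reprK. Qed.

Lemma coprod_lift_inl a : coprod_lift f g (coprod_inl a) = f a.
Proof. exact: coprod_lift_class. Qed.

Lemma coprod_lift_inr b : coprod_lift f g (coprod_inr b) = g b.
Proof. exact: coprod_lift_class. Qed.

Lemma coprod_liftB x y :
  coprod_lift f g (x - y) = coprod_lift f g x - coprod_lift f g y.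
Proof.
elim/coprodW: x => s; elim/coprodW: y => t.
have -> : coprod_class s - coprod_class t = coprod_class (CAdd s (COpp t)).
  by rewrite -coprod_addE -coprod_oppE.
by rewrite !coprod_lift_class.
Qed.

Lemma coprod_liftM x y :
  coprod_lift f g (x * y) = coprod_lift f g x * coprod_lift f g y.
Proof.
elim/coprodW: x => s; elim/coprodW: y => t.
by rewrite [_ * _]coprod_mulE !coprod_lift_class.
Qed.

Lemma coprod_lift1 : coprod_lift f g 1 = 1.
Proof. by rewrite coprod_lift_class /= rmorph1. Qed.

Lemma coprod_lift_unique (psi : {rmorphism coprod -> C}) :
  (forall a, psi (coprod_inl a) = f a) ->
  (forall b, psi (coprod_inr b) = g b) -> psi =1 coprod_lift f g.
Proof.
move=> psif psig; elim/coprodW => s; rewrite coprod_lift_class.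
elim: s => //= [s <- t <-|s <-|s <- t <-].
- by rewrite -rmorphD; congr (psi _); apply/esym/coprod_addE.
- by rewrite -rmorphN; congr (psi _); apply/esym/coprod_oppE.
- by rewrite -rmorphM; congr (psi _); apply/esym/coprod_mulE.
Qed.

End LiftTheory.
End Coproduct.

Section GPCGI.
Variables (D : nzRingType) (n m : nat).

Local Notation F := (center D).
Local Notation A := ('M[D]_n).

(* [A_F[X,X^-1]], the indeterminates being indexed by ['I_m]; [F[X,X^-1]] is
   [grpalg F (free_group 'I_m)], an [F]-algebra through [ga_const]. *)
Definition gen_laurent : pzRingType :=
  coprod (@scalar_center D n) (@ga_const F (free_group 'I_m)).

Implicit Types (w : gen_laurent) (c : 'I_m -> GL D n).

Definition coef (a : A) : gen_laurent := coprod_inl _ _ a.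

Definition var_pow (x : 'I_m) (k : int) : gen_laurent :=
  coprod_inr _ _ (ga_elt F (expgz (fg_gen x) k)).

(* The morphism [A_F[X,X^-1] -> A] that is the identity on [A] and maps each
   indeterminate [x] to [c x]. *)
Definition eval c w : A :=
  coprod_lift idfun
    (ga_lift (@scalar_center D n) (fun g => unit_val (fg_lift c g))) w.

Section EvalTheory.
Variable c : 'I_m -> GL D n.

Local Notation phi := (fun g : free_group 'I_m => unit_val (fg_lift c g)).

Let phi1 : phi 1%g = 1.
Proof. by rewrite /fg_lift big_nil. Qed.

Let phiM g h : phi (g * h)%g = phi g * phi h.
Proof. by rewrite /= fg_liftM. Qed.

Let phiC z g : scalar_center n z * phi g = phi g * scalar_center n z.
Proof. exact: scalar_center_comm. Qed.

Let lift := ga_lift (@scalar_center D n) phi.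

Let lift_zmod : zmod_morphism lift.
Proof.
move=> x y; apply: (addIr (lift y)).
by rewrite -[LHS]ga_liftD !subrK.
Qed.

Let lift_monoid : monoid_morphism lift.
Proof. by split; [apply: ga_lift1 | apply: ga_liftM]. Qed.

Let lift_rmorphism := HB.pack_for {rmorphism grpalg F (free_group 'I_m) -> A}
  lift (GRing.isZmodMorphism.Build _ _ lift lift_zmod)
  (GRing.isMonoidMorphism.Build _ _ lift lift_monoid).

Let liftP z : idfun (scalar_center n z) = lift_rmorphism (ga_const _ z).
Proof. by rewrite [RHS]ga_lift_const. Qed.

Lemma eval_coef a : eval c (coef a) = a.
Proof. exact: (coprod_lift_inl liftP). Qed.

Lemma eval_var_pow x k : eval c (var_pow x k) = unit_val (expgz (c x) k).
Proof.
rewrite [LHS](coprod_lift_inr liftP) [LHS]ga_lift_elt.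
have liftX g p : fg_lift c (g ^+ p)%g = (fg_lift c g ^+ p)%g.
  elim: p => [|p IHp]; first by rewrite /fg_lift big_nil.
  by rewrite !expgS fg_liftM IHp.
have liftV g : fg_lift c g^-1%g = (fg_lift c g)^-1%g.
  apply: (mulgI (fg_lift c g)); rewrite -fg_liftM !mulgV.
  by rewrite /fg_lift big_nil.
by case: k => p; rewrite /= ?liftV liftX fg_lift_gen.
Qed.

Lemma evalB w1 w2 : eval c (w1 - w2) = eval c w1 - eval c w2.
Proof. exact: (coprod_liftB liftP). Qed.

Lemma evalM w1 w2 : eval c (w1 * w2) = eval c w1 * eval c w2.
Proof. exact: (coprod_liftM liftP). Qed.

Lemma eval1 : eval c 1 = 1.
Proof. exact: (coprod_lift1 liftP). Qed.

End EvalTheory.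

Definition generalized_group_monomial w : Prop :=
  ~ range coef w /\
  exists (s : seq (GL D n * 'I_m * int)) (a : GL D n),
    w = (\prod_(u <- s) (coef (unit_val u.1.1) * var_pow u.1.2 u.2))
        * coef (unit_val a).

Definition GPCGI (H : set (GL D n)) w : Prop :=
  generalized_group_monomial w /\
  forall c, (forall x, H (c x)) ->
    exists2 p : nat, (0 < p)%N & range (@scalar_center D n) (eval c w ^+ p).

Definition nontrivial_GPCGI (H : set (GL D n)) w : Prop :=
  GPCGI H w /\ forall p : nat, (0 < p)%N -> ~ range coef (w ^+ p).

End GPCGI.

(* Main.v *)
Require Import Defs.
From HB Require Import structures.
From mathcomp Require Import all_boot all_order all_algebra all_fingroup cyclic all_field.
From mathcomp Require Import boolp classical_sets cardinality.
From mathcomp Require Import zify ring lra.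

Set Implicit Arguments.
Unset Strict Implicit.
Unset Printing Implicit Defensive.

Import Order.TTheory GRing.Theory Num.Theory.

Local Open Scope classical_set_scope.
Local Open Scope ring_scope.

(* Let [g] be a noncentral element of [N].  Almost subnormality gives [r] and [k]
   such that, for every [a] in [N], iterating [y |-> [y, a]^k] at least [r] times
   sends the whole of [GL_n(D)] into [N].  Substituting conjugates of such an
   iterate for the indeterminates, it suffices to find, for each word in one
   variable [y] that is cyclically reduced with respect to [a], some [x] whose
   iterate makes the value of the word not power central.

   All the data live in a division subring [S] that is finite over its center, and
   [M_n(S)] acts by right multiplication on its rows, which form a vector space of
   finite dimension [N] over a maximal subfield [L] of [S].  If every value [W(x)]
   were power central, all eigenvalue ratios of its matrix would be roots of unity,
   so that [tr(W)^N / det W] would be a sum of [N^N] roots of unity.  Along a line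
   in [M_n(S)] this is a rational function [P(t) / Q(t)], and a rational function
   with such values at all [t] of an infinite multiplicative set of the center is
   constant: otherwise, in an extension of [L], a matrix of generalized Vandermonde
   type would be singular, which reduction to complex roots of unity and a
   dominance estimate (or, in positive characteristic, the finiteness of the ring
   generated by the roots of unity) forbid.
   By density the ratio is then constant on the whole of [M_N(L)], but at
   [1 + t u psi], with [psi u = 0] and [u], [psi] generic, the determinant does not
   depend on [t] whereas the trace is a polynomial of positive degree in [t]. *)

(** * Sums of roots of unity as values of rational functions *)

(** The exponent of a power central value varies with the point, so neither the orders of the roots
    of unity nor the field they generate is bounded; only their number [N ^ N] is. The dominance
    argument uses nothing else. Its unknowns are the coefficients of both [P] and [Q], whence two
    equations for each index, taken at points where [P / Q] has different values: either one makes
    the two unknowns nearly proportional, and together they make both small. In characteristic zero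
    the points are powers of a large natural number, which conjugation of roots of unity fixes.
    Conjugation might bring the two values close to each other, but the product of all these
    differences has a nonzero integer norm, so one conjugate keeps all of them apart at once. The
    ratio [tr ^ N / det] is used because it is homogeneous of degree zero: it ignores the unknown
    scalar in a power central value and the one introduced by replacing inverses by adjugates. The
    matrices over [S] do not fill the matrices over [L]; only their [L]-span does. Lines are
    therefore run with parameters central in [S], and the identity obtained is extended one
    coordinate at a time. *)

Section Dominance.
Variables (E : idomainType) (R : realFieldType) (v : E -> R).
Hypothesis v0 : v 0 = 0.
Hypothesis v_ge0 : forall x, 0 <= v x.
Hypothesis v_eq0 : forall x, v x = 0 -> x = 0.
Hypothesis vM : forall x y, v (x * y) = v x * v y.
Hypothesis vD : forall x y, v (x + y) <= v x + v y.
Hypothesis vN : forall x, v (- x) = v x.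

Lemma abs_one : v 1 = 1.
Proof.
have v1 : v 1 != 0 by apply/negP => /eqP/v_eq0/eqP; rewrite oner_eq0.
by apply: (mulfI v1); rewrite -vM !mulr1.
Qed.

Lemma abs_exp x n : v (x ^+ n) = v x ^+ n.
Proof.
by elim: n => [|n IHn]; rewrite ?expr0 ?abs_one // !exprS vM IHn.
Qed.

Lemma abs_sum (I : Type) (r : seq I) (P : pred I) (F : I -> E) :
  v (\sum_(i <- r | P i) F i) <= \sum_(i <- r | P i) v (F i).
Proof.
elim/big_rec2: _ => [|i x y _ le_xy]; first by rewrite v0.
by rewrite (le_trans (vD _ _)) // lerD2l.
Qed.

Variables (a : nat) (beta : E) (J : bool -> nat -> nat) (s : nat -> nat).
Variables (tau : bool -> nat -> E) (C delta : R).
Hypothesis hJ : forall b e k, (e <= a)%N -> (k <= a)%N -> k != e ->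
  (s e + J b e * k + 1 <= s k + J b e * e)%N.
Hypothesis tauC : forall b e, (e <= a)%N -> v (tau b e) <= C.
Hypothesis tau_delta : forall e, (e <= a)%N ->
  delta <= v (tau false e - tau true e).
Hypotheses (delta_gt0 : 0 < delta) (delta_le1 : delta <= 1) (C_ge1 : 1 <= C).
Hypothesis beta_big : a.+1%:R * (1 + C) * (4 * (C + 1)) <= delta * v beta.

(* The inequalities [hJ] say that, after rescaling the unknowns by [s], the term
   [k = e] dominates the equation [(b, e)] when [beta] is large; so [x e] would be
   close to both [tau false e * y e] and [tau true e * y e]. *)
Lemma dominance (x y : 'I_a.+1 -> E) :
  (forall b (e : 'I_a.+1),
     \sum_(k < a.+1) beta ^+ (J b e * k) * (x k - tau b e * y k) = 0) ->
  forall k, x k = 0 /\ y k = 0.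
Proof.
move=> ker0; set B := v beta.
have hC := C_ge1; have hd0 := delta_gt0; have hd1 := delta_le1.
pose mu k := Num.max (v (x k)) (v (y k)).
have mu_ge0 k : 0 <= mu k by rewrite le_max v_ge0.
have xmu k : v (x k) <= mu k by rewrite le_max lexx.
have ymu k : v (y k) <= mu k by rewrite le_max lexx orbT.
have a1 : 1 <= a.+1%:R :> R by rewrite ler1n.
have B_ge1 : 1 <= B.
  have h1 : 1 <= a.+1%:R * (1 + C) * (4 * (C + 1)).
    have h2 : 1 <= 1 + C by lra.
    have h3 : 1 <= 4 * (C + 1) by lra.
    by apply: mulr_ege1 => //; apply: mulr_ege1.
  have := le_trans h1 beta_big; rewrite -/B => h2.
  have B0 : 0 <= B := v_ge0 _.
  rewrite (le_trans h2) // -[X in _ <= X]mul1r; exact: ler_wpM2r.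
have B_gt0 : 0 < B by exact: lt_le_trans ltr01 B_ge1.
(* At an index maximizing the weighted size, [hJ] makes every other term of the equations of index
   [e] smaller than [B ^+ (J b e * e) * mu e] by a factor [B], up to the constant [1 + C]. *)
have [e _ emax] := @arg_maxP _ _ _ ord0 xpredT (fun k : 'I_a.+1 => mu k * B ^+ s k) isT.
have {}emax k : mu k * B ^+ s k <= mu e * B ^+ s e by exact: emax.
suff mue0 : mu e = 0.
  move=> k; have muk0 : mu k = 0.
    apply/eqP; rewrite eq_le mu_ge0 andbT.
    have := emax k; rewrite mue0 mul0r pmulr_lle0 // exprn_gt0 //.
  split; apply: v_eq0; apply/eqP; rewrite eq_le v_ge0 andbT -muk0.
    exact: xmu.
  exact: ymu.
(* [eta * mu e] bounds the sum of the other terms after division by the dominant power; [beta_big]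
   says that [eta * (4 * (C + 1)) <= delta]. *)
pose eta := a.+1%:R * (1 + C) / B.
have off b k : k != e ->
    v (beta ^+ (J b e * k) * (x k - tau b e * y k)) <=
    (1 + C) * mu e * B ^+ (J b e * e) / B.
  move=> ke; rewrite vM abs_exp -/B.
  have le1 : v (x k - tau b e * y k) <= (1 + C) * mu k.
    rewrite (le_trans (vD _ _)) // vN vM mulrDl mul1r lerD //.
    by apply: ler_pM => //; apply: tauC; rewrite -ltnS.
  have le2 : B ^+ (J b e * k) * mu k * B <= mu e * B ^+ (J b e * e).
    have Bs : 0 < B ^+ s k by rewrite exprn_gt0.
    have step1 : B ^+ (J b e * k) * mu k * B * B ^+ s k <=
        B ^+ (J b e * k).+1 * (mu e * B ^+ s e).
      have -> : B ^+ (J b e * k) * mu k * B * B ^+ s k =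
        B ^+ (J b e * k).+1 * (mu k * B ^+ s k) by rewrite exprS; ring.
      by apply: ler_wpM2l => //; apply/exprn_ge0/ltW.
    rewrite -(ler_pM2r Bs) (le_trans step1) // mulrCA -exprD -mulrA -exprD.
    rewrite ler_wpM2l // ler_weXn2l //.
    by have := @hJ b e k (ltn_ord e) (ltn_ord k) ke; clear; lia.
  rewrite ler_pdivlMr // (le_trans (y := B ^+ (J b e * k) * ((1 + C) * mu k) * B)) //.
    apply: ler_wpM2r; first exact: ltW.
    by apply: ler_wpM2l => //; apply/exprn_ge0/ltW.
  have -> : B ^+ (J b e * k) * ((1 + C) * mu k) * B =
    (1 + C) * (B ^+ (J b e * k) * mu k * B) by ring.
  rewrite -[X in _ <= X]mulrA ler_wpM2l //; lra.
have main b : v (x e - tau b e * y e) <= eta * mu e.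
  have := ker0 b e; rewrite (bigD1 e) //= => /eqP; rewrite addr_eq0 => /eqP ker1.
  have := congr1 v ker1; rewrite vN vM abs_exp -/B => ker2.
  have BJ : 0 < B ^+ (J b e * e) by rewrite exprn_gt0.
  rewrite -(ler_pM2l BJ) ker2 (le_trans (abs_sum _ _ _)) //.
  rewrite (le_trans (ler_sum _ (fun k ke => off b k ke))) //.
  rewrite sumr_const -mulr_natl.
  have -> : B ^+ (J b e * e) * (eta * mu e) =
    a.+1%:R * ((1 + C) * mu e * B ^+ (J b e * e) / B) by rewrite /eta; field; lra.
  rewrite ler_wpM2r //.
    have B0 : 0 <= B := ltW B_gt0.
    by rewrite !mulr_ge0 ?exprn_ge0 ?invr_ge0 //; lra.
  rewrite ler_nat (leq_trans (max_card _)) // card_ord //.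
have eta_small : eta * (4 * (C + 1)) <= delta.
  rewrite /eta mulrAC ler_pdivrMr //.
have eta_ge0 : 0 <= eta.
  have B0 : 0 <= B := ltW B_gt0.
  by rewrite /eta !mulr_ge0 ?ler0n ?invr_ge0 //; lra.
have ysmall : delta * v (y e) <= 2 * eta * mu e.
  have h1 : v ((tau false e - tau true e) * y e) <= 2 * eta * mu e.
    have -> : (tau false e - tau true e) * y e =
      (x e - tau true e * y e) - (x e - tau false e * y e) by ring.
    rewrite (le_trans (vD _ _)) // vN.
    have := main false; have := main true; lra.
  rewrite (le_trans _ h1) // vM ler_wpM2r //; apply: tau_delta.
  by rewrite -ltnS.
have ysmall2 : v (y e) * (2 * (C + 1)) <= mu e.
  rewrite -(ler_pM2l delta_gt0) [X in X <= _]mulrA.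
  apply: (le_trans (y := 2 * eta * mu e * (2 * (C + 1)))).
    by apply: ler_wpM2r => //; lra.
  have -> : 2 * eta * mu e * (2 * (C + 1)) = eta * (4 * (C + 1)) * mu e by ring.
  by apply: ler_wpM2r.
have xsmall : v (x e) <= eta * mu e + C * v (y e).
  have -> : x e = (x e - tau false e * y e) + tau false e * y e by ring.
  rewrite (le_trans (vD _ _)) // vM lerD //; apply: ler_wpM2r => //.
  by apply: tauC; rewrite -ltnS.
have h8 : eta * 8 <= 1.
  apply: (le_trans _ (le_trans eta_small delta_le1)).
  by apply: ler_wpM2l => //; lra.
have h8' : eta * mu e * 8 <= mu e.
  by rewrite mulrAC -[X in _ <= X]mul1r; apply: ler_wpM2r.
have hy : C * v (y e) * 2 <= mu e.
  apply: le_trans ysmall2.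
  have -> : C * v (y e) * 2 = v (y e) * (2 * C) by ring.
  by apply: ler_wpM2l => //; lra.
have hy2 : v (y e) * 2 <= mu e.
  by apply: le_trans ysmall2; apply: ler_wpM2l => //; lra.
(* [mu e] is one of the two sizes, and these are at most [5/8 mu e] (namely [1/8 + 1/2]) for [x e]
   and [1/2 mu e] for [y e]. *)
have : mu e * 8 <= mu e * 5.
  rewrite {1}/mu; case: (leP (v (x e)) (v (y e))) => _; have := mu_ge0 e; lra.
have := mu_ge0 e; lra.
Qed.

End Dominance.

(** * Roots of unity in characteristic zero and their complex models *)

Section Cyclotomic.
Local Notation pZto R := (map_poly (intr : int -> R)).

Section Prim.
Variables (m : nat) (w : algC).
Hypothesis prim_w : m.-primitive_root w.

Lemma size_intr_poly (p : {poly int}) : size (pZto algC p) = size p.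
Proof. by rewrite size_map_inj_poly //; apply: intr_inj. Qed.

(** The cyclotomic polynomial has the degree of the minimal polynomial of [w] over the rationals. *)
Lemma root_small_eq0 (r : {poly int}) :
  root (pZto algC r) w -> (size r < size ('Phi_m)%R)%N -> r = 0.
Proof.
move=> rw lt_r; have [p [Dp mon_p] dv_p] := minCpolyP w.
have Dr : pZto algC r = map_poly ratr (pZto rat r).
  by rewrite -map_poly_comp; apply: eq_map_poly => b; rewrite /= rmorph_int.
move: rw; rewrite Dr dv_p => /dvdp_leq le_pr.
apply: contraTeq lt_r => r0; rewrite -leqNgt.
have sp : size p = size ('Phi_m)%R.
  rewrite -(size_map_poly (@ratr algC) p) -Dp (minCpoly_cyclotomic prim_w).
  by rewrite -size_intr_poly (Cintr_Cyclotomic prim_w).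
have sr : size (pZto rat r) = size r.
  by rewrite size_map_inj_poly //; apply: intr_inj.
rewrite -sp -sr le_pr // -size_poly_eq0 sr size_poly_eq0 //.
Qed.

Lemma root_cyclotomic_dvd (f : {poly int}) :
  root (pZto algC f) w -> exists q : {poly int}, f = q * ('Phi_m)%R.
Proof.
move=> fw; have mon := Cyclotomic_monic m.
have Df := Pdiv.RingMonic.rdivp_eq mon f.
set q := Pdiv.CommonRing.rdivp _ _ in Df; set r := Pdiv.CommonRing.rmodp _ _ in Df.
exists q; rewrite [LHS]Df; have -> : r = 0; last by rewrite addr0.
apply: root_small_eq0; last by rewrite Pdiv.CommonRing.ltn_rmodp monic_neq0.
move: fw; rewrite Df rmorphD rmorphM /= (Cintr_Cyclotomic prim_w) /root hornerD hornerM.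
have /rootP -> : root (cyclotomic w m) w by rewrite root_cyclotomic.
by rewrite mulr0 add0r.
Qed.

End Prim.

(** Since [X^m - 1] is the product of the cyclotomic polynomials of the divisors of [m], [z] is a
    root of one of them, of index [d]; then [z ^+ d = 1] and the order of [z] forces [d = m]. *)
Lemma root_Cyclotomic_char0 (L : fieldType) (m : nat) (z : L) :
  (forall n, (0 < n)%N -> n%:R != 0 :> L) ->
  m.-primitive_root z -> root (pZto L ('Phi_m)%R) z.
Proof.
move=> char0 prim_z; have m_gt0 := prim_order_gt0 prim_z.
have : root (pZto L (\prod_(d <- divisors m) ('Phi_d)%R)) z.
  rewrite prod_Cyclotomic // rmorphB rmorph1 /= map_polyXn.
  by rewrite /root !hornerE (prim_expr_order prim_z) subrr.
rewrite rmorph_prod /= /root horner_prod prodf_seq_eq0 => /hasP[d].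
rewrite -dvdn_divisors // => dm /= Pdz.
suff -> : m = d by [].
apply/eqP; rewrite eqn_dvd dm andbT (prim_order_dvd prim_z) -subr_eq0.
have d_gt0 : (0 < d)%N by rewrite (dvdn_gt0 _ dm).
have -> : z ^+ d - 1 = (pZto L ('X^d - 1)).[z].
  by rewrite rmorphB rmorph1 /= map_polyXn !hornerE.
rewrite -prod_Cyclotomic // rmorph_prod horner_prod prodf_seq_eq0.
by apply/hasP; exists d; rewrite // -dvdn_divisors.
Qed.

Section Transfer.
Variables (L : fieldType) (m : nat) (z : L) (w : algC).
Hypothesis char0 : forall n, (0 < n)%N -> n%:R != 0 :> L.
Hypotheses (prim_z : m.-primitive_root z) (prim_w : m.-primitive_root w).

Lemma intr_char0 (c : int) : c != 0 -> c%:~R != 0 :> L.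
Proof.
case: c => [[|n]|n] // _; first exact: (char0 (n := n.+1)).
by rewrite NegzE rmorphN oppr_eq0; apply: (char0 (n := n.+1)).
Qed.

(** If [f] and the cyclotomic polynomial were coprime, a Bezout relation would make a nonzero
    integer vanish in [L]. Otherwise their gcd vanishes at [w], because its cofactor in the
    cyclotomic polynomial has too small a degree to do so. *)
Lemma root_algC_of_root (f : {poly int}) :
  root (pZto L f) z -> root (pZto algC f) w.
Proof.
move=> fz; have [/Bezout_coprimepP[[u v] /= /eqpP[[c1 c2] /= /andP[c10 c20]]]|] :=
    boolP (coprimep f ('Phi_m)%R).
  move=> /(congr1 (fun p => (pZto L p).[z])).
  rewrite !linearZ /= rmorphD !rmorphM rmorph1 /= !hornerE /= (rootP fz).
  have /rootP -> := root_Cyclotomic_char0 char0 prim_z.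
  rewrite !mulr0 addr0 mulr0 => /eqP; rewrite eq_sym.
  by rewrite (negbTE (intr_char0 c20)).
rewrite /coprimep; set g := gcdp _ _ => g1.
have P0 : ('Phi_m)%R != 0 :> {poly int} by rewrite monic_neq0 ?Cyclotomic_monic.
have [[c q] /= c0 Dq] := Pdiv.Idomain.dvdpP _ _ (dvdp_gcdl f ('Phi_m)%R).
have [[d h] /= d0 Dh] := Pdiv.Idomain.dvdpP _ _ (dvdp_gcdr f ('Phi_m)%R).
rewrite -/g in Dq Dh.
have g0 : g != 0 by rewrite gcdp_eq0 negb_and P0 orbT.
have : root (pZto algC (h * g)) w.
  rewrite -Dh linearZ /= (Cintr_Cyclotomic prim_w) /root hornerZ.
  have /rootP -> : root (cyclotomic w m) w by rewrite root_cyclotomic.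
  by rewrite mulr0.
rewrite rmorphM rootM => /orP[hw|gw]; last first.
  have : root (pZto algC (c *: f)) w by rewrite Dq rmorphM rootM gw orbT.
  rewrite linearZ /= rootZ // intr_eq0 //.
have h0 : h != 0.
  apply: contraNneq P0 => h0; rewrite h0 mul0r in Dh.
  by rewrite -size_poly_eq0 -(size_scale _ d0) Dh size_poly0.
suff lt : (size h < size ('Phi_m)%R)%N.
  by move: h0; rewrite (root_small_eq0 prim_w hw lt) eqxx.
have sP : size ('Phi_m)%R = size (h * g) by rewrite -Dh size_scale.
rewrite sP size_mul //.
have : (1 < size g)%N by rewrite ltn_neqAle eq_sym g1 size_poly_gt0.
by move: h0; rewrite -size_poly_gt0; lia.
Qed.

Lemma root_of_root_algC (f : {poly int}) :
  root (pZto algC f) w -> root (pZto L f) z.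
Proof.
move=> /(root_cyclotomic_dvd prim_w)[q ->].
by rewrite rmorphM rootM (root_Cyclotomic_char0 char0 prim_z) orbT.
Qed.

End Transfer.

(* The product of the conjugates of [X(w)] is congruent to an integer modulo
   [Phi_m], since it takes the same value at all primitive roots. *)
Lemma exists_conj_ge1 (m : nat) (w : algC) (X : {poly int}) :
  m.-primitive_root w -> ~~ root (pZto algC X) w ->
  exists2 w', m.-primitive_root w' & 1 <= `|(pZto algC X).[w']|.
Proof.
move=> prim_w Xw; apply: contrapT => none.
have m_gt0 := prim_order_gt0 prim_w.
have lt1 w' : m.-primitive_root w' -> `|(pZto algC X).[w']| < 1.
  move=> pw; rewrite real_ltNge ?normr_real ?rpred1 //.
  by apply/negP => le1; apply: none; exists w'.
pose rs (w' : algC) := [seq w' ^+ k | k <- index_iota 0 m & coprime k m].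
have Drs w' : \prod_(x <- rs w') ('X - x%:P) = cyclotomic w' m :> {poly algC}.
  by rewrite /rs big_map big_filter big_mkord.
have rs_perm w' : m.-primitive_root w' -> perm_eq (rs w') (rs w).
  move=> pw; apply: prod_XsubC_eq; rewrite !Drs.
  by rewrite -(Cintr_Cyclotomic pw) -(Cintr_Cyclotomic prim_w).
pose G : {poly int} := \prod_(k <- index_iota 0 m | coprime k m) (X \Po 'X^k).
have GE w' : (pZto algC G).[w'] = \prod_(x <- rs w') (pZto algC X).[x].
  rewrite /G rmorph_prod horner_prod /rs big_map big_filter.
  apply: eq_bigr => k _; rewrite /= map_comp_poly /= map_polyXn horner_comp.
  by rewrite hornerXn.
have Gconst w' : m.-primitive_root w' -> (pZto algC G).[w'] = (pZto algC G).[w].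
  by move=> pw; rewrite !GE; apply/perm_big/rs_perm.
have rs_prim x : x \in rs w -> m.-primitive_root x.
  case/mapP=> k; rewrite mem_filter => /andP[co _] ->.
  by rewrite prim_root_exp_coprime.
have rs_uniq : uniq (rs w).
  rewrite map_inj_in_uniq ?filter_uniq ?iota_uniq // => i j.
  rewrite !mem_filter !mem_index_iota => /andP[_ im] /andP[_ jm] /eqP.
  by rewrite (eq_prim_root_expr prim_w) !modn_small // => /eqP.
pose p := (pZto algC G).[w].
have mon := Cyclotomic_monic m.
have DG := Pdiv.RingMonic.rdivp_eq mon G.
set q := Pdiv.CommonRing.rdivp _ _ in DG; set r := Pdiv.CommonRing.rmodp _ _ in DG.
have rp x : m.-primitive_root x -> (pZto algC r).[x] = p.
  move=> px; rewrite /p -(Gconst x px) [in RHS]DG rmorphD rmorphM /=.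
  rewrite (Cintr_Cyclotomic px) hornerD hornerM.
  have /rootP -> : root (cyclotomic x m) x by rewrite root_cyclotomic.
  by rewrite mulr0 add0r.
have sz_rs : size (rs w) = totient m.
  apply: succn_inj; rewrite -(size_prod_XsubC (rs w) id) Drs.
  by rewrite size_cyclotomic.
(* The remainder [r] has degree below [totient m] and takes the value [p] at [totient m] distinct
   points. Hence [p] is the constant coefficient of [r], an integer. *)
have Dr : pZto algC r = p%:P.
  apply/eqP; rewrite -subr_eq0; apply: contraT => nz.
  have all_rs : all (root (pZto algC r - p%:P)) (rs w).
    by apply/allP => x /rs_prim px; rewrite /root !hornerE rp // subrr.
  have := max_poly_roots nz all_rs rs_uniq; apply: contraTT => _.
  rewrite -leqNgt sz_rs (leq_trans (size_polyD _ _)) // size_polyN geq_max.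
  have := Pdiv.CommonRing.ltn_rmodp G ('Phi_m)%R; rewrite monic_neq0 // -/r.
  rewrite size_Cyclotomic ltnS size_intr_poly => -> /=.
  by rewrite (leq_trans (size_polyC_leq1 _)) // totient_gt0.
have p_int : p \is a Num.int.
  have : (pZto algC r)`_0 = p by rewrite Dr coefC eqxx.
  by rewrite coef_map /= => <-; apply: rpred_int.
(* An integer that is a nonempty product of factors of modulus below one is zero. Then [X] vanishes
   at some primitive root, is a multiple of the cyclotomic polynomial and vanishes at [w] too. *)
have p0 : p = 0.
  apply: contraTeq isT => p0; have := norm_intr_ge1 p_int p0.
  rewrite real_leNgt ?rpred1 ?normr_real // => /negP[].
  rewrite /p GE normr_prod.
  have w_rs : w ^+ 1 \in rs w \/ m = 1%N.
    case: (ltngtP 1 m) m_gt0 => // m1 _; last by right.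
    left; apply/mapP; exists 1%N => //.
    by rewrite mem_filter mem_index_iota m1 /coprime gcd1n.
  have [s0 s0P] : exists s0, s0 \in rs w.
    case: w_rs => [h|m1]; first by exists (w ^+ 1).
    exists (w ^+ 0); apply/mapP; exists 0%N => //.
    by rewrite mem_filter m1.
  rewrite (big_rem _ s0P) /=.
  have h1 : `|(pZto algC X).[s0]| < 1 by apply/lt1/rs_prim.
  apply: le_lt_trans h1; rewrite ler_piMr // big_seq.
  apply: prodr_ile1 => x /mem_rem/rs_prim/lt1/ltW ->.
  by rewrite normr_ge0.
move: p0; rewrite /p GE => /eqP; rewrite prodf_seq_eq0 => /hasP[x /rs_prim px /=].
move=> /eqP/rootP Xx; move: Xw => /negP[].
have [Q ->] := root_cyclotomic_dvd px Xx.
rewrite rmorphM rootM /= (Cintr_Cyclotomic prim_w) root_cyclotomic //.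
by rewrite prim_w orbT.
Qed.

End Cyclotomic.

(** * Finite rings generated by elements of finite order *)

Lemma finite_combinations (R : nzRingType) (A : set R) (q : nat) (b : 'I_q -> R) :
  finite_set A ->
  finite_set [set y | exists2 f : 'I_q -> R, forall i, A (f i) &
                        y = \sum_i f i * b i].
Proof.
move=> /finite_seqP[s ->].
pose F (g : {ffun 'I_q -> seq_sub s}) : R := \sum_i val (g i) * b i.
apply: (@sub_finite_set _ _ (range F)); last exact/finite_image/finite_finset.
move=> y [f fA ->]; exists [ffun i => SeqSub (fA i)] => //.
by apply: eq_bigr => i _; rewrite ffunE.
Qed.

Lemma finite_repeat (T : choiceType) (A : set T) (f : nat -> T) :
  finite_set A -> (forall i, A (f i)) -> exists i j, (i < j)%N /\ f i = f j.
Proof.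
move=> finA fA; apply: contrapT => none; apply: infinite_nat.
have inj_f : injective f.
  move=> i j fij; case: (ltngtP i j) => // lt; exfalso; apply: none.
    by exists i, j.
  by exists j, i.
apply: (@sub_finite_set _ _ (f @^-1` A)) => [i _ /=|]; first exact: fA.
by apply: finite_preimage => // i j _ _; apply: inj_f.
Qed.

Section FiniteSubring.
Variable R : nzRingType.
Implicit Types (A : set R) (x : R).

(** Opposites are left out because they come for free when a positive integer vanishes in [R]: see
    [semisubring_opp]. *)
Definition semisubring A : Prop :=
  [/\ A 0, A 1, forall x y, A x -> A y -> A (x + y) &
      forall x y, A x -> A y -> A (x * y)].

Definition torsion x : Prop := x = 0 \/ exists2 e, (0 < e)%N & x ^+ e = 1.

Lemma semisubring_sum A (I : Type) (r : seq I) (P : pred I) (F : I -> R) :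
  semisubring A -> (forall i, P i -> A (F i)) -> A (\sum_(i <- r | P i) F i).
Proof. by move=> [A0 _ AD _] AF; elim/big_ind: _. Qed.

Lemma semisubring_opp A n x : semisubring A -> (0 < n)%N -> n%:R = 0 :> R ->
  A x -> A (- x).
Proof.
case: n => // n sA _ n0 Ax; have -> : - x = \sum_(i < n) x.
  apply: (addrI x); rewrite subrr sumr_const card_ord -mulrS -mulr_natl n0.
  by rewrite mul0r.
exact: semisubring_sum.
Qed.

(** Adjoining [x] with [x ^+ e = 1] to a finite [A] that commutes with it gives the combinations of
    the first [e] powers of [x]. As [R] need not be commutative, the last clause is what lets the
    next generator commute with all of [A]. *)
Lemma finite_semisubring n (xs : seq R) :
  (0 < n)%N -> n%:R = 0 :> R -> (forall x, x \in xs -> torsion x) ->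
  (forall x y, x \in xs -> y \in xs -> x * y = y * x) ->
  exists A, [/\ finite_set A, semisubring A, forall x, x \in xs -> A x &
    forall y, (forall x, x \in xs -> x * y = y * x) ->
      forall a, A a -> a * y = y * a].
Proof.
move=> n_gt0 n0; elim: xs => [|x xs IHxs] tors comm.
  pose f (i : 'I_n) : R := (i : nat)%:R.
  have modE k : k%:R = (k %% n)%:R :> R.
    by rewrite {1}(divn_eq k n) natrD natrM n0 mulr0 add0r.
  have fE k : range f k%:R.
    by exists (Ordinal (ltn_pmod k n_gt0)) => //; rewrite /f /= -modE.
  exists (range f); split=> //.
  - exact/finite_image/finite_finset.
  - split; [exact: (fE 0%N)|exact: (fE 1%N)| |].
      by move=> _ _ [i _ <-] [j _ <-]; rewrite /f -natrD.
    by move=> _ _ [i _ <-] [j _ <-]; rewrite /f -natrM.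
  - by move=> y _ _ [i _ <-]; rewrite /f mulr_natl mulr_natr.
have [||A [finA sA xsA commA]] := IHxs.
- by move=> z z_xs; apply: tors; rewrite inE z_xs orbT.
- by move=> y z y_xs z_xs; apply: comm; rewrite inE ?y_xs ?z_xs orbT.
have [A0 A1 AD AM] := sA.
have xA a : A a -> a * x = x * a.
  by apply: commA => z z_xs; apply: comm; rewrite inE ?z_xs ?eqxx ?orbT.
have [x0|[e e_gt0 xe]] := tors x (mem_head _ _).
  exists A; split=> // [z|y cy].
    by rewrite inE => /orP[/eqP ->|/xsA //]; rewrite x0.
  by apply: commA => z z_xs; apply: cy; rewrite inE z_xs orbT.
pose B : set R := [set y | exists2 f : 'I_e -> R, forall i, A (f i) &
                        y = \sum_i f i * x ^+ i].
have BD y z : B y -> B z -> B (y + z).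
  move=> [f fA ->] [g gA ->]; exists (fun i => f i + g i) => [i|]; first exact: AD.
  by rewrite -big_split; apply: eq_bigr => i _; rewrite mulrDl.
have B0 : B 0.
  by exists (fun=> 0) => //; rewrite big1 // => i _; rewrite mul0r.
have Bmon a k : A a -> B (a * x ^+ k).
  move=> Aa; pose i0 := Ordinal (ltn_pmod k e_gt0).
  exists (fun i => if i == i0 then a else 0) => [i|]; first by case: ifP.
  rewrite (bigD1 i0) //= eqxx big1 ?addr0 => [|i /negbTE ->]; last by rewrite mul0r.
  by rewrite {1}(divn_eq k e) exprD mulnC exprM xe expr1n mul1r.
have Bsum k (F : 'I_k -> R) : (forall i, B (F i)) -> B (\sum_i F i).
  by move=> BF; elim/big_ind: _.
exists B; split.
- exact: finite_combinations.
- split=> //; first by rewrite -[1]mulr1 -(expr0 x); apply: Bmon.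
  move=> _ _ [f fA ->] [g gA ->]; rewrite mulr_suml; apply: (Bsum) => i.
  rewrite mulr_sumr; apply: Bsum => j.
  have -> : f i * x ^+ i * (g j * x ^+ j) = (f i * g j) * x ^+ (i + j).
    have cX k : g j * x ^+ k = x ^+ k * g j.
      elim: k => [|k IHk]; first by rewrite expr0 mulr1 mul1r.
      by rewrite exprSr mulrA IHk -!mulrA xA.
    by rewrite exprD -!mulrA [x ^+ i * (g j * _)]mulrA -cX -!mulrA.
  exact/Bmon/AM.
- move=> z; rewrite inE => /orP[/eqP ->|/xsA Az].
    by rewrite -[x]mul1r -{1}[x]expr1; apply: Bmon.
  by rewrite -[z]mulr1 -(expr0 x); apply: Bmon.
- move=> y cy _ [f fA ->]; rewrite mulr_suml mulr_sumr; apply: eq_bigr => i _.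
  have cfy : f i * y = y * f i.
    by apply: commA => // z z_xs; apply: cy; rewrite inE z_xs orbT.
  have cX k : y * x ^+ k = x ^+ k * y.
    elim: k => [|k IHk]; first by rewrite expr0 mulr1 mul1r.
    by rewrite exprSr mulrA IHk -!mulrA cy ?mem_head.
  by rewrite -mulrA -cX mulrA cfy mulrA.
Qed.

End FiniteSubring.

Lemma finite_closed_torsion (R : unitRingType) (A : set R) x :
  finite_set A -> semisubring A -> A x -> x \is a GRing.unit -> torsion x.
Proof.
move=> finA [_ A1 _ AM] Ax Ux; have [|i [j [ij eij]]] := finite_repeat (f := fun i => x ^+ i) finA.
  by elim=> [|i IHi]; rewrite ?expr0 // exprS; apply: AM.
right; exists (j - i)%N; first by rewrite subn_gt0.
apply: (mulrI (unitrX i Ux)); rewrite -exprD subnKC ?mulr1 //; exact: ltnW.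
Qed.

(** A nonzero leading coefficient lies in the finite [A], so it has an inverse among its own powers.
    Then [f] expresses a power of [th] through lower ones with coefficients in [A], all powers of
    [th] lie in a finite set, and [th] has finite order. *)
Lemma torsion_coef_root (E : fieldType) (A : set E) (th : E) (f : {poly E}) :
  finite_set A -> semisubring A -> (forall i, A f`_i) ->
  th != 0 -> (forall i, (0 < i)%N -> th ^+ i != 1) -> root f th -> f = 0.
Proof.
move=> finA sA fA th0 th_inf /rootP f0; apply: contrapT => /eqP nz_f.
have [A0 A1 AD AM] := sA.
pose d := (size f).-1; pose c := lead_coef f.
have c0 : c != 0 by rewrite lead_coef_eq0.
have [/eqP|[e e_gt0 ce]] : torsion c.
  by apply: (finite_closed_torsion finA sA (fA _)); rewrite unitfE.
  by rewrite (negbTE c0).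
have Aexp x k : A x -> A (x ^+ k).
  by move=> Ax; elim: k => [|k IHk]; rewrite ?expr0 // exprS; apply: AM.
pose r i := (- (f`_i * c ^+ e.-1))%R.
have thd : th ^+ d = \sum_(i < d) r i * th ^+ i.
  have := f0; rewrite horner_coef -(prednK (n := size f)) ?size_poly_gt0 //.
  rewrite big_ord_recr /= -/d => /eqP; rewrite addr_eq0 => /eqP f1.
  have cinv : c ^+ e.-1 * c = 1 by rewrite -exprSr prednK.
  rewrite -[LHS]mul1r -cinv -mulrA.
  have -> : c * th ^+ d = - \sum_(i < d) f`_i * th ^+ i by rewrite f1 opprK.
  rewrite mulrN mulr_sumr -sumrN; apply: eq_bigr => i _.
  by rewrite /r mulNr mulrA [c ^+ _ * _]mulrC.
have Ar i : A (r i).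
  suff Aneg : A (-1) by rewrite /r -mulN1r; apply/AM/AM/Aexp/fA.
  have [n n_gt0 n0] : exists2 n, (0 < n)%N & n%:R = 0 :> E.
    have [|n1 [n2 [lt12 e12]]] := finite_repeat (f := fun i => i%:R) finA.
      by elim=> [//|k IHk]; rewrite -addn1 natrD; apply: AD.
    exists (n2 - n1)%N; first by rewrite subn_gt0.
    by rewrite natrB ?e12 ?subrr // ltnW.
  exact: (semisubring_opp sA n_gt0 n0).
pose B : set E := [set y | exists2 g : 'I_d -> E, forall i, A (g i) &
                     y = \sum_i g i * th ^+ i].
have finB : finite_set B by apply: finite_combinations.
have BD y z : B y -> B z -> B (y + z).
  move=> [g gA ->] [h hA ->]; exists (fun i => g i + h i) => [i|]; first exact: AD.
  by rewrite -big_split; apply: eq_bigr => i _; rewrite mulrDl.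
have B0 : B 0.
  by exists (fun=> 0) => //; rewrite big1 // => i _; rewrite mul0r.
have Bmon a i : (i < d)%N -> A a -> B (a * th ^+ i).
  move=> id Aa; exists (fun j => if j == Ordinal id then a else 0) => [j|].
    by case: ifP.
  rewrite (bigD1 (Ordinal id)) //= eqxx big1 ?addr0 // => j /negbTE ->.
  by rewrite mul0r.
have BZ a y : A a -> B y -> B (a * y).
  move=> Aa [g gA ->]; exists (fun i => a * g i) => [i|]; first exact: AM.
  by rewrite mulr_sumr; apply: eq_bigr => i _; rewrite mulrA.
have Bsum k (F : 'I_k -> E) : (forall i, B (F i)) -> B (\sum_i F i).
  by move=> BF; elim/big_ind: _.
have Bth y : B y -> B (y * th).
  move=> [g gA ->]; rewrite mulr_suml; apply: Bsum => i.
  rewrite -mulrA -exprSr; have [lt_id|] := ltnP i.+1 d; first exact: Bmon.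
  rewrite leq_eqVlt ltnNge ltn_ord orbF => /eqP <-; rewrite thd.
  by apply: BZ => //; exists r.
have [d0|d_gt0] := posnP d.
  have fC := size1_polyC (p := f); rewrite -[size f]prednK ?size_poly_gt0 // -/d d0 in fC.
  move: f0 nz_f; rewrite fC // hornerC => ->; by rewrite eqxx.
have Bpow i : B (th ^+ i).
  elim: i => [|i IHi]; first by rewrite -[_ ^+ _]mul1r; apply: Bmon.
  by rewrite exprSr; apply: Bth.
have [n1 [n2 [lt12 e12]]] := finite_repeat finB Bpow.
have := th_inf (n2 - n1)%N; rewrite subn_gt0 => /(_ lt12)/eqP; apply.
by apply: (mulfI (expf_neq0 n1 th0)); rewrite -exprD subnKC ?mulr1 // ltnW.
Qed.

(** * Power scalar matrices and spaced exponents *)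

Definition torsion_sum (L : fieldType) (e d : nat) (x : L) : Prop :=
  exists zs : seq L, [/\ size zs = d,
    forall z, z \in zs -> z ^+ e = 1 & x = \sum_(z <- zs) z].

Lemma exists_irreducible_factor (L : fieldType) (p : {poly L}) :
  (1 < size p)%N -> exists2 q, irreducible_poly q & q %| p.
Proof.
have [n] := ubnP (size p); elim: n p => // n IHn p lt_pn p_gt1.
have [irr|] := pselect (irreducible_poly p); first by exists p.
move=> nirr; have [q [q1 qp nqp]] : exists q : {poly L}, [/\ size q != 1%N, q %| p & ~~ (q %= p)].
  apply: contrapT => none; apply: nirr; split=> // q q1 qp.
  by apply: contrapT => nqp; apply: none; exists q; split=> //; apply/negP.
have p0 : p != 0 by rewrite -size_poly_gt0; apply: ltn_trans p_gt1.
have q0 : q != 0 by apply: contraTneq qp => ->; rewrite dvd0p.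
have lt_qp : (size q < size p)%N.
  by rewrite ltn_neqAle dvdp_leq // andbT dvdp_size_eqp.
have [||r irr rq] := IHn q; first exact: leq_trans lt_qp lt_pn.
  by rewrite ltn_neqAle eq_sym q1 size_poly_gt0.
by exists r => //; apply: dvdp_trans qp.
Qed.

Lemma splitting_extension (L : fieldType) (p : {poly L}) : p != 0 ->
  exists (E : fieldType) (f : {rmorphism L -> E}) (rs : seq E),
    map_poly f p %= \prod_(r <- rs) ('X - r%:P).
Proof.
have [n] := ubnP (size p); elim: n L p => // n IHn L p lt_pn p0.
have [sz_p|sz_p] := leqP (size p) 1.
  exists L, idfun, [::]; rewrite big_nil map_poly_id // -size_poly_eq1.
  by rewrite eqn_leq sz_p size_poly_gt0.
have [q irr qp] := exists_irreducible_factor sz_p.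
have [K _ [x qx _]] := irredp_FAdjoin irr.
have /factor_theorem[r Dr] : root (map_poly (in_alg K) p) x.
  by have /dvdpP[h ->] := qp; rewrite rmorphM rootM qx orbT.
have p'0 : map_poly (in_alg K) p != 0 by rewrite map_poly_eq0.
have r0 : r != 0 by apply: contraNneq p'0 => r0; rewrite Dr r0 mul0r.
have [||E [f [rs Drs]]] := IHn K r => //.
  have := size_map_poly (in_alg K) p; rewrite Dr size_mul ?polyXsubC_eq0 //.
  rewrite size_XsubC addn2 /= => sr; by rewrite -ltnS sr.
exists E, (f \o in_alg K), (f x :: rs); rewrite big_cons.
rewrite map_poly_comp /= Dr rmorphM /= map_polyXsubC mulrC.
by apply: eqp_mull.
Qed.

(** Every eigenvalue has [p]-th power [l], so a product of [N] eigenvalues has the same [p]-th power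
    as the determinant. Expanding the [N]-th power of the trace gives one such product for each map
    [g] from ['I_N] to itself. *)
Lemma torsion_sum_of_power_scalar (L : fieldType) (N p : nat) (M : 'M[L]_N)
    (l : L) (E : fieldType) (f : {rmorphism L -> E}) (rs : seq E) :
  (0 < N)%N -> (0 < p)%N -> l != 0 -> M ^+ p = l%:M ->
  map_poly f (char_poly M) = \prod_(r <- rs) ('X - r%:P) ->
  torsion_sum p (N ^ N) (f (\tr M ^+ N / \det M)).
Proof.
move=> N_gt0 p_gt0 l0 Mp split_M.
have sz_rs : size rs = N.
  apply: succn_inj; rewrite -(size_char_poly M) -(size_map_poly f) split_M.
  by rewrite size_prod_XsubC.
have rs_l r : r \in rs -> r ^+ p = f l.
  move=> r_rs; have : root (char_poly (map_mx f M)) r.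
    by rewrite -map_char_poly split_M root_prod_XsubC.
  rewrite -eigenvalue_root_char => /eigenvalueP[v vM v0].
  have vMk k : v *m (map_mx f M) ^+ k = r ^+ k *: v.
    elim: k => [|k IHk]; first by rewrite expr0 mulmx1 scale1r.
    by rewrite exprSr mulmxA IHk -scalemxAl vM scalerA -exprSr.
  have := vMk p; rewrite -[map_mx f M ^+ p](rmorphXn (map_mx f)) Mp /= map_scalar_mx.
  rewrite mul_mx_scalar => /eqP; rewrite eq_sym -subr_eq0 -scalerBl scaler_eq0.
  by rewrite (negbTE v0) orbF subr_eq0 => /eqP.
have trE : f (\tr M) = \sum_(r <- rs) r.
  have := coefPn_prod_XsubC (ps := rs); rewrite sz_rs -lt0n => /(_ N_gt0).
  rewrite -split_M coef_map /= char_poly_trace // rmorphN => /eqP.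
  by rewrite eqr_opp => /eqP.
have detE : f (\det M) = \prod_(r <- rs) r.
  have := coef0_prod_XsubC rs; rewrite sz_rs.
  rewrite -split_M coef_map /= char_poly_det rmorphM rmorphXn rmorphN1.
  by move/(mulfI (expf_neq0 _ _)) => -> //; rewrite oppr_eq0 oner_eq0.
have r0 r : r \in rs -> r != 0.
  move=> /rs_l; apply: contra_eqN => /eqP ->.
  by rewrite expr0n gtn_eqF // eq_sym fmorph_eq0.
pose z (g : {ffun 'I_N -> 'I_N}) := (\prod_i rs`_(g i)) / \prod_(r <- rs) r.
have pow_prod (s : seq E) : {subset s <= rs} ->
    (\prod_(r <- s) r) ^+ p = f l ^+ size s.
  elim: s => [|x s IHs] sub_s; first by rewrite big_nil expr1n expr0.
  rewrite big_cons exprMn rs_l ?sub_s ?mem_head // IHs ?exprS // => y ys.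
  by rewrite sub_s // inE ys orbT.
exists [seq z g | g : {ffun 'I_N -> 'I_N}]; split=> //.
- by rewrite size_map -cardE card_ffun !card_ord.
- move=> _ /mapP[g _ ->]; rewrite /z expr_div_n pow_prod // sz_rs.
  have -> : \prod_i rs`_(g i) = \prod_(r <- [seq rs`_(g i) | i : 'I_N]) r.
    by rewrite big_map enumT.
  rewrite pow_prod => [|_ /mapP[i _ ->]]; last by rewrite mem_nth // sz_rs.
  by rewrite size_image card_ord divff // expf_neq0 // fmorph_eq0.
- rewrite big_map enumT rmorphM rmorphXn fmorphV /= trE detE /z -mulr_suml.
  congr (_ / _); rewrite -(bigA_distr_bigA (fun i j : 'I_N => rs`_j)) /=.
  rewrite prodr_const card_ord; congr (_ ^+ _).
  by rewrite (big_nth 0) sz_rs big_mkord.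
Qed.

(** The last inequality says that [s k - J b e * k] has its strict minimum at [k = e], for both [b].
    This holds because [s] is convex with slopes [J true e + 1] that interlace the [J b e]; the gap
    [2] in [pos] leaves room for these slopes. *)
Lemma spread_pairs (G : nat -> nat -> Prop) :
  (forall n, exists j0 j1, [/\ (n <= j0)%N, (j0 <= j1)%N & G j0 j1]) ->
  exists (J : bool -> nat -> nat) (s : nat -> nat),
    (forall e, G (J false e) (J true e)) /\
    forall b e k, k != e -> (s e + J b e * k + 1 <= s k + J b e * e)%N.
Proof.
move=> exG.
have [n|h hP] := @choice _ _ (fun n (h : nat * nat) =>
    [/\ (n <= h.1)%N, (h.1 <= h.2)%N & G h.1 h.2]).
  by have [j0 [j1 ?]] := exG n; exists (j0, j1).
pose pos := fix pos e := if e is e'.+1 then ((h (pos e')).2 + 2)%N else 0%N.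
pose J (b : bool) e := if b then (h (pos e)).2 else (h (pos e)).1.
pose s := fix s e := if e is e'.+1 then (s e' + (J true e').+1)%N else 0%N.
have Jtrue b e : (J b e <= J true e)%N.
  by case: b => //; have [] := hP (pos e).
have Jlt b e : (J true e + 2 <= J b e.+1)%N.
  have [h1 h2 _] := hP (pos e.+1); case: b; last exact: h1.
  exact: (leq_trans h1 h2).
have JG e : G (J false e) (J true e) by have [] := hP (pos e).
have sS e : s e.+1 = (s e + (J true e).+1)%N by [].
clearbody s J.
have Jmono b e d : (J b e <= J true (e + d))%N.
  elim: d => [|d IHd]; first by rewrite addn0.
  by rewrite addnS; have := Jlt true (e + d)%N; lia.
have Jmono' b e d : (J true e + 2 <= J b (e + d.+1))%N.
  rewrite [(e + _)%N]addnS; apply: (leq_trans _ (Jlt b (e + d)%N)).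
  by rewrite leq_add2r; apply: Jmono.
exists J, s; split=> // b e k ke.
have up d : (s e + d * (J b e).+1 <= s (e + d))%N.
  elim: d => [|d IHd]; first by rewrite addn0 mul0n addn0.
  by rewrite addnS sS mulSn; have := Jmono b e d; lia.
have down d : (d <= e)%N -> (s e + d <= s (e - d) + d * J b e)%N.
  elim: d => [_|d IHd lt_de]; first by rewrite subn0.
  have := IHd (ltnW lt_de); rewrite mulSn.
  have -> : (e - d = (e - d.+1).+1)%N by rewrite subnSK.
  by rewrite sS; have := Jmono' b (e - d.+1)%N d; rewrite subnK //; lia.
case: (ltngtP k e) ke => // lt _.
  have := down (e - k)%N (leq_subr _ _); rewrite subKn; last exact: ltnW.
  have -> : (J b e * e = (e - k) * J b e + J b e * k)%N.
    by rewrite [((e - k) * _)%N]mulnC -mulnDr subnK // ltnW.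
  by move: lt; rewrite -subn_gt0; lia.
have := up (k - e)%N; rewrite subnKC; last exact: ltnW.
have -> : (J b e * k = (k - e) * J b e + J b e * e)%N.
  by rewrite [((k - e) * _)%N]mulnC -mulnDr subnK // ltnW.
by rewrite mulnS; move: lt; rewrite -subn_gt0; lia.
Qed.

(** * Nonvanishing of the generalized Vandermonde determinant *)

Section Pencil.
Variables (a : nat) (J : bool -> nat -> nat).

(* A vector of the left kernel is a pair of polynomials [P], [Q] of degree at most [a]
   (with coefficients [x], [y]) such that [P = tau b e * Q] at [beta ^+ J b e]. *)
Definition pencil (R : comNzRingType) (beta : R) (tau : bool -> nat -> R) :
    'M[R]_(a.+1 + a.+1) :=
  block_mx (\matrix_(k, e) beta ^+ (J false e * k))
           (\matrix_(k, e) beta ^+ (J true e * k))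
           (\matrix_(k, e) - (beta ^+ (J false e * k) * tau false e))
           (\matrix_(k, e) - (beta ^+ (J true e * k) * tau true e)).

Lemma map_pencil (R R' : comNzRingType) (f : {rmorphism R -> R'}) beta tau :
  map_mx f (pencil beta tau) = pencil (f beta) (fun b e => f (tau b e)).
Proof.
by rewrite /pencil map_block_mx; congr block_mx; apply/matrixP => k e;
  rewrite !mxE ?rmorphN ?rmorphM ?rmorphXn.
Qed.

Lemma det_pencil_eq0 (R : idomainType) (beta : R) tau :
  \det (pencil beta tau) = 0 <->
  exists x y : 'I_a.+1 -> R, (exists k, ~ (x k = 0 /\ y k = 0)) /\
    forall b (e : 'I_a.+1),
      \sum_(k < a.+1) beta ^+ (J b e * k) * (x k - tau b e * y k) = 0.
Proof.
have kerE (x y : 'rV[R]_a.+1) : row_mx x y *m pencil beta tau = 0 <->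
    forall b (e : 'I_a.+1),
      \sum_(k < a.+1) beta ^+ (J b e * k) * (x 0 k - tau b e * y 0 k) = 0.
  rewrite /pencil mul_row_block -(row_mx0 _ 1 a.+1 a.+1).
  have E b (e : 'I_a.+1) :
      \sum_(k < a.+1) beta ^+ (J b e * k) * (x 0 k - tau b e * y 0 k) =
      (x *m (\matrix_(k < a.+1, e < a.+1) beta ^+ (J b e * k)) +
       y *m (\matrix_(k < a.+1, e < a.+1) - (beta ^+ (J b e * k) * tau b e))) 0 e.
    by rewrite !mxE -big_split; apply: eq_bigr => k _; rewrite !mxE /=; ring.
  split=> [/eq_row_mx[h0 h1] [] e|h]; rewrite ?E ?h0 ?h1 ?mxE //.
  by congr row_mx; apply/rowP => e; rewrite -E h mxE.
split=> [/eqP/det0P[v v0 vA]|[x [y [[k nz] h]]]].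
  exists (fun k => lsubmx v 0 k), (fun k => rsubmx v 0 k).
  split; last by apply/kerE; rewrite hsubmxK.
  apply: contrapT => none; move/eqP: v0; apply; rewrite -[v]hsubmxK -row_mx0.
  by congr row_mx; apply/rowP => k; rewrite [RHS]mxE;
    have [] : lsubmx v 0 k = 0 /\ rsubmx v 0 k = 0 by
      apply: contrapT => nz; apply: none; exists k.
apply/eqP/det0P; exists (row_mx (\row_k x k) (\row_k y k)); last first.
  by apply/kerE => b e; rewrite -[RHS](h b e); apply: eq_bigr => i _; rewrite !mxE.
apply: contra_notN nz; rewrite -row_mx0 => /eqP/eq_row_mx[/rowP/(_ k) + /rowP/(_ k)].
by rewrite !mxE.
Qed.

End Pencil.

Section PencilNonzero.
Variables (a : nat) (J : bool -> nat -> nat) (s : nat -> nat).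
Hypothesis hJ :
  forall b e k, k != e -> (s e + J b e * k + 1 <= s k + J b e * e)%N.

Section Charp.
Variables (E : fieldType) (A : set E) (th : E) (tau : bool -> nat -> E).
Hypotheses (finA : finite_set A) (sA : semisubring A).
Hypotheses (th0 : th != 0) (th_inf : forall i, (0 < i)%N -> th ^+ i != 1).
Hypothesis tauA : forall b e, (e <= a)%N -> A (tau b e).
Hypothesis tau_neq : forall e, (e <= a)%N -> tau false e != tau true e.

(** With [th] replaced by an indeterminate, the determinant is a polynomial with coefficients in the
    finite ring [A]; if it vanished at [th], of infinite order, it would be zero. Dominance over
    polynomials, with the absolute value given by the degree, excludes this: there all nonzero
    constants have absolute value one. *)
Lemma det_pencil_charp n : (0 < n)%N -> n%:R = 0 :> E ->
  \det (pencil a J th tau) != 0.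
Proof.
move=> n_gt0 n0; apply/negP => /eqP det0.
(* For [C = delta = 1] the bound [beta_big] reads [a.+1 * 2 * 8 <= B], where [B] is the absolute
   value of the indeterminate. *)
pose B : rat := (16 * a.+1)%:R.
pose v (f : {poly E}) : rat := if f == 0 then 0 else B ^+ (size f).-1.
have B_ge1 : 1 <= B by rewrite ler1n muln_gt0.
have B_gt0 : 0 < B by apply: lt_le_trans B_ge1.
pose D := pencil a J ('X : {poly E}) (fun b e => (tau b (minn e a))%:P).
have [A0 A1 AD AM] := sA.
have AN x : A x -> A (- x) by apply: (semisubring_opp sA n_gt0 n0).
pose pA : {pred E} := fun x => `[< A x >].
have pA_sub : subring_closed pA.
  by split=> [|x y /asboolP Ax /asboolP Ay|x y /asboolP Ax /asboolP Ay];
    apply/asboolP; [|apply/AD/AN|apply: AM].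
pose AA : subringClosed E := HB.pack pA (GRing.isSubringClosed.Build E pA pA_sub).
have tau' b e : A (tau b (minn e a)) by apply/tauA/geq_minr.
have D_A i j : D i j \is a polyOver AA.
  have XA (k : nat) : ('X^k : {poly E}) \is a polyOver AA.
    by apply: rpredX; apply: polyOverX.
  have CA b e : (tau b (minn e a))%:P \is a polyOver AA.
    by rewrite polyOverC; apply/asboolP.
  rewrite /D /pencil; case: (split_ordP i) => i' ->; case: (split_ordP j) => j' ->;
    rewrite ?(block_mxEul, block_mxEur, block_mxEdl, block_mxEdr) mxE //;
    by rewrite rpredN rpredM.
have detA i : A (\det D)`_i.
  suff /polyOverP/(_ i)/asboolP : \det D \is a polyOver AA by [].
  rewrite /determinant; apply: rpred_sum => sg _; rewrite rpredMsign.
  by apply: rpred_prod => k _; apply: D_A.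
have root_det : root (\det D) th.
  rewrite /root; have -> : (\det D).[th] = \det (map_mx (horner_eval th) D).
    by rewrite det_map_mx.
  rewrite map_pencil /= /horner_eval hornerX.
  have -> : pencil a J th (fun b e => (tau b (minn e a))%:P.[th]) = pencil a J th tau.
    by rewrite /pencil; congr block_mx; apply/matrixP => k e; rewrite !mxE //
      hornerC (minn_idPl _) // -ltnS.
  by rewrite det0.
have /det_pencil_eq0[x [y [[k nz] ker]]] :=
  torsion_coef_root finA sA detA th0 th_inf root_det.
apply: nz; move: k; apply: (@dominance _ _ v _ _ _ _ _ _ a 'X J s
  (fun b e => (tau b (minn e a))%:P) 1 1) => //.
- by rewrite /v eqxx.
- by move=> f; rewrite /v; case: eqP => // _; apply/exprn_ge0/ltW.
- move=> f; rewrite /v; case: eqVneq => [-> //|_] /eqP.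
  by rewrite expf_eq0 (gt_eqF B_gt0) andbF.
- move=> f g; rewrite /v mulf_eq0; case: eqVneq => [->|f0]; first by rewrite /= mul0r.
  case: eqVneq => [->|g0] /=; first by rewrite mulr0.
  rewrite -exprD size_mul //; congr (_ ^+ _).
  move: f0 g0; rewrite -!size_poly_gt0.
  by case: (size f) => // i; case: (size g) => // j _ _; rewrite addSn addnS.
- have vB (f : {poly E}) k : (size f <= k.+1)%N -> v f <= B ^+ k.
    rewrite /v; case: eqP => _ lef; first by apply/exprn_ge0/ltW.
    by apply: ler_weXn2l => //; lia.
  move=> f g; have [->|f0] := eqVneq f 0; first by rewrite add0r /v eqxx add0r.
  have [->|g0] := eqVneq g 0; first by rewrite addr0 /v eqxx addr0.
  have B0 k : 0 <= B ^+ k by apply/exprn_ge0/ltW.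
  have sz := size_polyD f g; rewrite {2 3}/v (negbTE f0) (negbTE g0).
  have f1 : (size f).-1.+1 = size f by rewrite prednK // size_poly_gt0.
  have g1 : (size g).-1.+1 = size g by rewrite prednK // size_poly_gt0.
  case: (leqP (size f) (size g)) => le_fg.
    rewrite (le_trans (vB _ (size g).-1 _)) ?lerDr // g1.
    by rewrite (leq_trans sz) // geq_max le_fg leqnn.
  rewrite (le_trans (vB _ (size f).-1 _)) ?lerDl // f1.
  by rewrite (leq_trans sz) // geq_max leqnn ltnW.
- by move=> f; rewrite /v oppr_eq0 size_polyN.
- by move=> b e k _ _; apply: hJ.
- move=> b e _; rewrite /v; case: eqVneq => // nz.
  by rewrite size_polyC -polyC_eq0 nz.
- move=> e le_e; rewrite /v (minn_idPl le_e) -polyCB polyC_eq0 subr_eq0.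
  by rewrite (negbTE (tau_neq le_e)) size_polyC subr_eq0 (negbTE (tau_neq le_e)).
- rewrite /v polyX_eq0 size_polyX expr1 /B natrM; lra.
Qed.

End Charp.

Section Char0.
Variables (E : fieldType) (m d : nat) (z : E) (ks : bool -> nat -> seq nat).
Hypothesis char0 : forall n, (0 < n)%N -> n%:R != 0 :> E.
Hypotheses (prim_z : m.-primitive_root z) (d_gt0 : (0 < d)%N).
Hypothesis sz_ks : forall b e, (e <= a)%N -> size (ks b e) = d.
Let tau b e := \sum_(k <- ks b e) z ^+ k.
Hypothesis tau_neq : forall e, (e <= a)%N -> tau false e != tau true e.

(** The determinant is the value at [z] of an integer polynomial, so it also vanishes at every
    complex primitive [m]-th root. At a suitable one the product of the [a.+1] differences has
    modulus at least one; each is at most [2 * d], so each is at least [(2 * d) ^- a.+1]. The base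
    is what dominance requires for this [delta] and [C = d]. *)
Lemma det_pencil_char0 :
  \det (pencil a J (a.+1 * d.+1 * (4 * d.+1) * (2 * d) ^ a.+1)%:R tau) != 0.
Proof.
set B := (_ * (2 * d) ^ a.+1)%N; apply/negP => /eqP det0.
have m_gt0 := prim_order_gt0 prim_z.
have [w prim_w] := C_prim_root_exists m_gt0.
pose g b e : {poly int} := \sum_(k <- ks b e) 'X^k.
have gE (R : nzRingType) b e (x : R) :
    (map_poly intr (g b e)).[x] = \sum_(k <- ks b e) x ^+ k.
  rewrite /g rmorph_sum horner_sum; apply: eq_bigr => k _.
  by rewrite /= map_polyXn hornerXn.
pose D := pencil a J (B%:R : {poly int}) g.
have evalD (R : comNzRingType) (x : R) : (map_poly intr (\det D)).[x] =
    \det (pencil a J (B%:R : R) (fun b e => \sum_(k <- ks b e) x ^+ k)).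
  have -> : (map_poly intr (\det D)).[x] =
      (horner_eval x \o map_poly (intr : int -> R)) (\det D) by [].
  rewrite -(det_map_mx (horner_eval x \o map_poly (intr : int -> R))) map_pencil.
  rewrite rmorph_nat; congr (\det (pencil _ _ _ _)).
  by apply/funext => b; apply/funext => e; rewrite -gE.
have rootD x : m.-primitive_root x -> root (map_poly (intr : int -> algC) (\det D)) x.
  move=> px; apply: (root_algC_of_root char0 prim_z px).
  by rewrite /root evalD; apply/eqP.
pose X := \prod_(e < a.+1) (g false e - g true e).
have XE (R : comNzRingType) (x : R) : (map_poly intr X).[x] =
    \prod_(e < a.+1) (\sum_(k <- ks false e) x ^+ k - \sum_(k <- ks true e) x ^+ k).
  rewrite /X rmorph_prod horner_prod; apply: eq_bigr => e _.
  by rewrite /= rmorphB hornerD hornerN /= !gE.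
have Xw : ~~ root (map_poly (intr : int -> algC) X) w.
  apply/negP => /(root_of_root_algC char0 prim_z prim_w); rewrite /root XE.
  apply/negP; rewrite prodf_seq_neq0; apply/allP => e _ /=.
  by rewrite subr_eq0; apply: tau_neq; rewrite -ltnS.
have [x prim_x Xx] := exists_conj_ge1 prim_w Xw.
have normx k : `|x ^+ k| = 1.
  rewrite normrX (_ : `|x| = 1) ?expr1n //; apply/eqP.
  by rewrite -(pexpr_eq1 m_gt0) // -normrX (prim_expr_order prim_x) normr1.
pose t b e := \sum_(k <- ks b e) x ^+ k.
have t_le b e : (e <= a)%N -> `|t b e| <= d%:R.
  move=> le_e; rewrite (le_trans (ler_norm_sum _ _ _)) //.
  rewrite (eq_bigr (fun=> 1)) => [|k _]; last exact: normx.
  by rewrite big_const_seq count_predT iter_addr_0 sz_ks.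
have dC : 0 < (2 * d)%:R :> algC by rewrite ltr0n muln_gt0.
have t_ge e : (e <= a)%N -> 1 <= (2 * d)%:R ^+ a.+1 * `|t false e - t true e|.
  move=> le_e; rewrite (le_trans Xx) // XE normr_prod.
  pose e' : 'I_a.+1 := Ordinal (le_e : (e < a.+1)%N).
  have le2d (i : 'I_a.+1) : `|t false i - t true i| <= (2 * d)%:R.
    rewrite (le_trans (ler_normB _ _)) // mul2n -addnn natrD lerD ?t_le // -ltnS //.
  rewrite (bigD1 e') //= mulrC ler_wpM2r ?normr_ge0 //.
  rewrite (le_trans (ler_prod _ (fun i _ => _ : 0 <= _ <= (2 * d)%:R))) //.
    by move=> i; rewrite normr_ge0 le2d.
  rewrite prodr_const ler_weXn2l ?ler1n ?muln_gt0 //.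
  by rewrite (leq_trans (max_card _)) // card_ord.
have /det_pencil_eq0[u [y [[k nz] ker]]] : \det (pencil a J (B%:R : algC) t) = 0.
  by rewrite -[LHS]evalD; apply/rootP/rootD.
(* Dominance needs absolute values in a totally ordered field, so the modulus is read in the real
   algebraic numbers. *)
pose v (c : algC) : algR := in_algR (normr_real c).
apply: nz; move: k.
have d2 : 0 < (2 * d)%:R :> algR by rewrite ltr0n muln_gt0.
apply: (@dominance _ _ v _ _ _ _ _ _ a B%:R J s t d%:R
  ((2 * d)%:R ^- a.+1)) => //.
- by apply: val_inj; rewrite /= normr0.
- by move=> c; apply: normr_ge0.
- by move=> c /(congr1 val)/= /normr0_eq0.
- by move=> c c'; apply: val_inj; rewrite /= normrM.
- by move=> c c'; apply: ler_normD.
- by move=> c; apply: val_inj; rewrite /= normrN.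
- by move=> b e k' _ _; apply: hJ.
- move=> b e le_e; change (`|t b e| <= algRval d%:R).
  by rewrite rmorph_nat; apply: t_le.
- move=> e le_e; have h : 1 <= (2 * d)%:R ^+ a.+1 * v (t false e - t true e).
    change (algRval 1 <= algRval ((2 * d)%:R ^+ a.+1 * v (t false e - t true e))).
    by rewrite rmorph1 rmorphM rmorphXn rmorph_nat; apply: t_ge.
  rewrite -(ler_pM2l (exprn_gt0 a.+1 d2)) mulfV //.
  by rewrite expf_neq0 // gt_eqF.
- by rewrite invr_gt0 exprn_gt0.
- by rewrite invf_le1 ?exprn_gt0 // exprn_ege1 // ler1n muln_gt0.
- by rewrite ler1n.
- have -> : v B%:R = B%:R by apply: val_inj; rewrite /= normr_nat rmorph_nat.
  rewrite /B [(_ * _ ^ _)%:R]natrM natrX [X in _ <= X]mulrCA mulVf ?mulr1; last first.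
    by rewrite expf_neq0 // gt_eqF.
  by rewrite !natrM -!natr1 [1 + _]addrC.
Qed.
End Char0.
End PencilNonzero.

Lemma nonroot_power (L : fieldType) (beta : L) (R : {poly L}) (n : nat) :
  injective (fun i => beta ^+ i) -> R != 0 ->
  exists2 j, (n <= j)%N & R.[beta ^+ j] != 0.
Proof.
move=> inj_beta R0; apply: contrapT => none.
pose rs := [seq beta ^+ j | j <- iota n (size R)].
have all_rs : all (root R) rs.
  apply/allP => x /mapP[j]; rewrite mem_iota => /andP[nj _] ->.
  by apply: contrapT => /negP Rj; apply: none; exists j.
have uniq_rs : uniq rs by rewrite map_inj_uniq ?iota_uniq.
by have := max_poly_roots R0 all_rs uniq_rs; rewrite size_map size_iota ltnn.
Qed.

Lemma monic_split (L : fieldType) (p : {poly L}) (rs : seq L) :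
  p \is monic -> p %| \prod_(r <- rs) ('X - r%:P) ->
  exists rs', p = \prod_(r <- rs') ('X - r%:P).
Proof.
move=> mon_p dv_p; have [m eqp_m] := dvdp_prod_XsubC dv_p; exists (mask m rs); apply/eqP.
by rewrite -eqp_monic // monic_prod_XsubC.
Qed.

(** * Rational functions whose values are ratios of power scalar matrices *)

Section PowerScalarRatio.
Variables (L : fieldType) (N : nat) (P Q : {poly L}) (beta : L).
Hypotheses (N_gt0 : (0 < N)%N) (Q0 : Q != 0).
Hypothesis inj_beta : injective (fun i => beta ^+ i).
Hypothesis hPQ : forall i, Q.[beta ^+ i] != 0 ->
  exists (M : 'M[L]_N) (p : nat) (l : L), [/\ (0 < p)%N, l != 0, M ^+ p = l%:M &
    P.[beta ^+ i] = \tr M ^+ N / \det M * Q.[beta ^+ i]].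
Hypothesis nconst : forall tau, P <> tau *: Q.

(** If [P / Q] took only the value [T j0] from [j0] on, the nonzero polynomial [P - T j0 *: Q] would
    have too many roots; so pairs of exponents with different values occur arbitrarily far. The
    coefficients of [P] and [Q] form the kernel vector. *)
Lemma singular_pencil (a := maxn (size P) (size Q)) :
  exists (J : bool -> nat -> nat) (s : nat -> nat),
  (forall b e k, k != e -> (s e + J b e * k + 1 <= s k + J b e * e)%N) /\
  exists (E : fieldType) (f : {rmorphism L -> E}) (tau : bool -> nat -> E)
    (m : nat) (rs : seq E),
  [/\ (0 < m)%N, 'X^m - 1 = \prod_(r <- rs) ('X - r%:P),
      forall b e, (e <= a)%N -> exists zs : seq E, [/\ size zs = (N ^ N)%N,
        forall z, z \in zs -> z ^+ m = 1 & tau b e = \sum_(z <- zs) z],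
      forall e, (e <= a)%N -> tau false e != tau true e &
      \det (pencil a J (f beta) tau) = 0].
Proof.
pose T j := P.[beta ^+ j] / Q.[beta ^+ j].
have [|J [s [JG hJ]]] := @spread_pairs (fun j0 j1 =>
    [/\ Q.[beta ^+ j0] != 0, Q.[beta ^+ j1] != 0 & T j0 != T j1]).
  move=> n; have [j0 n_j0 Qj0] := nonroot_power n inj_beta Q0.
  have [|j1 j01] := nonroot_power (R := Q * (P - T j0 *: Q)) j0 inj_beta.
    by rewrite mulf_neq0 // subr_eq0; apply/eqP/nconst.
  rewrite hornerM mulf_eq0 => /norP[Qj1 Rj1]; exists j0, j1; split=> //.
  split=> //; apply: contraNneq Rj1 => T01.
  by rewrite hornerD hornerN hornerZ T01 /T divfK // subrr.
exists J, s; split=> //.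
have QJ b e : Q.[beta ^+ J b e] != 0 by case: b; have [] := JG e.
have [be|h hP] := @choice (bool * nat) ('M[L]_N * nat * L) (fun be h =>
  [/\ (0 < h.1.2)%N, h.2 != 0, h.1.1 ^+ h.1.2 = h.2%:M &
    P.[beta ^+ J be.1 be.2] = \tr h.1.1 ^+ N / \det h.1.1 * Q.[beta ^+ J be.1 be.2]]).
  by have [M [p [l [? ? ? ?]]]] := hPQ (QJ be.1 be.2); exists (M, p, l).
pose pw := fun be : bool * nat => (h be).1.2; pose M be := (h be).1.1.
pose ix := [seq (b, e) | b <- [:: false; true], e <- iota 0 a.+1].
have ixP b e : (e <= a)%N -> (b, e) \in ix.
  move=> le_e; apply/allpairsP; exists (b, e); split=> //.
    by rewrite /=; case: (b).
  by rewrite mem_iota.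
(* A common multiple of the exponents turns all the roots of unity into [m]-th roots; splitting
   [pol] then puts these and all eigenvalues into a single extension. *)
pose m := (\prod_(be <- ix) pw be)%N.
have m_gt0 : (0 < m)%N.
  by rewrite /m prodn_cond_gt0 // => be _; have [] := hP be.
pose pol := ('X^m - 1) * \prod_(be <- ix) char_poly (M be).
have mon_pol : pol \is monic.
  rewrite rpredM ?monicXnsubC //; apply: monic_prod => be _.
  exact: char_poly_monic.
have [E [f [rs Drs]]] := splitting_extension (monic_neq0 mon_pol).
have dvd_rs (p : {poly L}) : p \is monic -> p %| pol ->
    exists rs', map_poly f p = \prod_(r <- rs') ('X - r%:P).
  move=> mon_p p_pol; apply: (@monic_split _ _ rs); first by rewrite map_monic.
  by rewrite -(eqp_dvdr _ Drs) dvdp_map.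
have [rsm Drsm] := dvd_rs _ (monicXnsubC 1 m_gt0) (dvdp_mulr _ (dvdpp _)).
exists E, f, (fun b e => f (T (J b e))), m, rsm; split=> //.
- by rewrite -Drsm rmorphB rmorph1 /= map_polyXn.
- move=> b e le_e; have [p0 l0 Mp PE] := hP (b, e).
  have [|rs' Drs'] := dvd_rs _ (char_poly_monic (M (b, e))).
    by rewrite dvdp_mull // (big_rem _ (ixP b e le_e)) /= dvdp_mulr.
  have [zs [sz_zs zs1 DT]] := torsion_sum_of_power_scalar N_gt0 p0 l0 Mp Drs'.
  exists zs; split=> // [z /zs1 z1|].
    by rewrite /m (big_rem _ (ixP b e le_e)) exprM z1 expr1n.
  by rewrite -DT /T PE mulfK.
- by move=> e _; rewrite (inj_eq (fmorph_inj f)); have [] := JG e.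
apply/det_pencil_eq0.
exists (fun k => f P`_k), (fun k => f Q`_k); split.
  have szQ : ((size Q).-1 < a.+1)%N by rewrite ltnS /a; lia.
  exists (Ordinal szQ) => -[_ /eqP]; rewrite /= fmorph_eq0.
  by rewrite -lead_coefE lead_coef_eq0 (negbTE Q0).
have hornerE_big (R : {poly L}) (x : L) : (size R <= a)%N ->
    R.[x] = \sum_(k < a.+1) R`_k * x ^+ k.
  move=> le_R; rewrite (horner_coef_wide x (n := a.+1)) //; exact: leqW.
move=> b e; have := hP (b, val e) => -[_ _ _ PE].
have : f (P.[beta ^+ J b e] - T (J b e) * Q.[beta ^+ J b e]) = 0.
  by rewrite /T divfK // subrr rmorph0.
rewrite !hornerE_big ?leq_maxl ?leq_maxr // mulr_sumr -sumrB rmorph_sum.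
move=> eq0; rewrite -[RHS]eq0; apply: eq_bigr => k _.
by rewrite /= rmorphB !rmorphM !rmorphXn -exprM; ring.
Qed.

End PowerScalarRatio.

(** Natural numbers are fixed by conjugation of roots of unity, and an element of infinite order is
    not annihilated by a nonzero polynomial over a finite ring: these are the parameters that the
    two determinant estimates can handle. *)
Definition rich_subset (L : fieldType) (K : set L) : Prop :=
  ((forall n, (0 < n)%N -> n%:R != 0 :> L) /\ (forall n, K n%:R)) \/
  ((exists2 n, (0 < n)%N & n%:R = 0 :> L) /\ exists th : L,
    [/\ th != 0, forall i, (0 < i)%N -> th ^+ i != 1 & forall i, K (th ^+ i)]).

Lemma power_scalar_ratio_const (L : fieldType) (N : nat) (K : set L)
    (P Q : {poly L}) :
  (0 < N)%N -> rich_subset K -> Q != 0 ->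
  (forall t, K t -> Q.[t] != 0 ->
    exists (M : 'M[L]_N) (p : nat) (l : L), [/\ (0 < p)%N, l != 0, M ^+ p = l%:M &
      P.[t] = \tr M ^+ N / \det M * Q.[t]]) ->
  exists tau, P = tau *: Q.
Proof.
move=> N_gt0 richK Q0 hPQ; apply: contrapT => none.
have nconst tau : P <> tau *: Q by move=> PQ; apply: none; exists tau.
pose a := maxn (size P) (size Q).
have d_gt0 : (0 < N ^ N)%N by rewrite expn_gt0 N_gt0.
case: richK => [[char0 KN]|[[n n_gt0 n0] [th [th0 th_inf Kth]]]].
  set d := (N ^ N)%N in d_gt0.
  pose B := (a.+1 * d.+1 * (4 * d.+1) * (2 * d) ^ a.+1)%N.
  have B_gt1 : (1 < B)%N.
    have h : (0 < (2 * d) ^ a.+1)%N by rewrite expn_gt0 muln_gt0 d_gt0.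
    apply: (@leq_trans (4 * 1)) => //; rewrite /B.
    have -> : (a.+1 * d.+1 * (4 * d.+1) * (2 * d) ^ a.+1 =
      4 * (a.+1 * d.+1 * d.+1 * (2 * d) ^ a.+1))%N by ring.
    by rewrite leq_mul2l !muln_gt0 h.
  have injN : injective (fun k : nat => k%:R : L).
    have lt i j : (i < j)%N -> i%:R <> j%:R :> L.
      move=> ij /eqP; rewrite eq_sym -subr_eq0 -natrB; last exact: ltnW.
      by apply/negP/char0; rewrite subn_gt0.
    by move=> i j ij; case: (ltngtP i j) => // /lt; rewrite ij.
  have inj_beta : injective (fun i => B%:R ^+ i : L).
    by move=> i j; rewrite -!natrX => /injN/eqP; rewrite eqn_exp2l // => /eqP.
  have [i|J [s [hJ [E [f [tau [m [rs [m_gt0 Drs tauE tau_neq det0]]]]]]]]] :=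
    singular_pencil N_gt0 Q0 inj_beta _ nconst.
    by rewrite -natrX; apply: hPQ.
  have char0E k : (0 < k)%N -> k%:R != 0 :> E.
    by move=> k_gt0; rewrite -(rmorph_nat f) fmorph_eq0; apply: char0.
  have rs1 : all m.-unity_root rs.
    apply/allP => r r_rs; rewrite unity_rootE.
    have : root (\prod_(r <- rs) ('X - r%:P)) r by rewrite root_prod_XsubC.
    by rewrite -Drs /root !hornerE subr_eq0.
  have uniq_rs : uniq rs.
    by rewrite -separable_prod_XsubC -Drs separable_Xn_sub_1 // char0E.
  have sz_rs : (m <= size rs)%N.
    by rewrite -ltnS -(size_prod_XsubC rs id) -Drs size_XnsubC.
  have /hasP[z _ prim_z] := has_prim_root m_gt0 rs1 uniq_rs sz_rs.
  have [be|ks ksP] := @choice (bool * nat) (seq nat) (fun be ks => (be.2 <= a)%N ->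
      size ks = d /\ tau be.1 be.2 = \sum_(k <- ks) z ^+ k).
    have [le_e|] := boolP (be.2 <= a)%N; last by exists [::].
    have [zs [sz_zs zs1 ->]] := tauE be.1 be.2 le_e.
    have [ks [sz_ks ->]] : exists ks : seq nat, size ks = size zs /\
        \sum_(z <- zs) z = \sum_(k <- ks) z ^+ k.
      elim: zs zs1 {sz_zs} => [|x zs IHzs] zs1; first by exists [::]; rewrite !big_nil.
      have [|ks [sz_ks Dks]] := IHzs; first by move=> y y_zs; rewrite zs1 // inE y_zs orbT.
      have [k Dx] := prim_rootP prim_z (zs1 x (mem_head _ _)).
      by exists (val k :: ks); rewrite /= sz_ks !big_cons Dks Dx.
    by exists ks; rewrite sz_ks.
  have := @det_pencil_char0 a J s hJ E m d z (fun b e => ks (b, e)) char0E prim_z d_gt0.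
  case/(_ _ _)/negP.
  - by move=> b e /(ksP (b, e))[].
  - move=> e le_e; have [_ /= <-] := ksP (false, e) le_e.
    by have [_ /= <-] := ksP (true, e) le_e; apply: tau_neq.
  apply/eqP; rewrite -[RHS]det0 rmorph_nat; congr (\det _).
  rewrite /pencil; congr block_mx; apply/matrixP => k e; rewrite !mxE //.
    by have [_ /= ->] := ksP (false, val e) (ltn_ord e).
  by have [_ /= ->] := ksP (true, val e) (ltn_ord e).
have inj_beta : injective (fun i => th ^+ i).
  have lt i j : (i < j)%N -> th ^+ i <> th ^+ j.
    move=> ij eij; have := th_inf (j - i)%N; rewrite subn_gt0 => /(_ ij)/eqP; apply.
    by apply: (mulfI (expf_neq0 i th0)); rewrite -exprD subnKC ?mulr1 // ltnW.
  by move=> i j ij; case: (ltngtP i j) => // /lt; rewrite ij.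
have [i|J [s [hJ [E [f [tau [m [rs [m_gt0 Drs tauE tau_neq det0]]]]]]]]] :=
  singular_pencil N_gt0 Q0 inj_beta _ nconst.
  exact: hPQ.
have n0E : n%:R = 0 :> E by rewrite -(rmorph_nat f) n0 rmorph0.
have rsP z : (z \in rs) = (z ^+ m == 1).
  by rewrite -root_prod_XsubC -Drs /root !hornerE subr_eq0.
have [r||A [finA sA rsA _]] := @finite_semisubring E n rs n_gt0 n0E.
- by rewrite rsP => /eqP ?; right; exists m.
- by move=> x y _ _; rewrite mulrC.
have := @det_pencil_charp a J s hJ E A (f th) tau finA sA _ _ _ _ n n_gt0 n0E.
case/(_ _ _ _ _)/negP.
- by rewrite fmorph_eq0.
- by move=> i i_gt0; rewrite -rmorphXn fmorph_eq1; apply: th_inf.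
- move=> b e le_e; have [zs [_ zs1 ->]] := tauE b e le_e.
  rewrite big_seq; apply: semisubring_sum => // z z_zs.
  by apply: rsA; rewrite rsP zs1.
- exact: tau_neq.
exact/eqP.
Qed.

(** * Words in iterated commutators of matrices and their leading coefficients *)

Section SquareScale.
Variables (R : comPzRingType) (n : nat).
Implicit Types (a : R) (M : 'M[R]_n).

Lemma mulmxZl a M M' : (a *: M) * M' = a *: (M * M').
Proof. by rewrite [RHS]scalemxAl. Qed.

Lemma mulmxZr a M M' : M * (a *: M') = a *: (M * M').
Proof. by rewrite [RHS]scalemxAr. Qed.

Lemma exprmxZ a M k : (a *: M) ^+ k = a ^+ k *: M ^+ k.
Proof.
elim: k => [|k IHk]; first by rewrite !expr0 scale1r.
by rewrite !exprS IHk mulmxZl mulmxZr scalerA.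
Qed.

End SquareScale.

Section MatrixWords.
Variable N : nat.

(* Throughout, a pair [Y] stands for a matrix and its inverse. *)
Definition mx_step (R : comNzRingType) (A A' : 'M[R]_N) (k : nat)
    (Y : 'M[R]_N * 'M[R]_N) : 'M[R]_N * 'M[R]_N :=
  ((Y.1 * A * Y.2 * A') ^+ k, (A * Y.1 * A' * Y.2) ^+ k).

Definition mx_word (R : comNzRingType) (s : seq ('M[R]_N * bool))
    (Y : 'M[R]_N * 'M[R]_N) : 'M[R]_N :=
  \prod_(l <- s) (l.1 * (if l.2 then Y.2 else Y.1)).

Definition mx_eval (R : comNzRingType) (A A' : 'M[R]_N) (k r : nat)
    (s : seq ('M[R]_N * bool)) (X X' : 'M[R]_N) : 'M[R]_N :=
  mx_word s (iter r (mx_step A A' k) (X, X')).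

Section Map.
Variables (R R' : comNzRingType) (f : {rmorphism R -> R'}).

Lemma map_mx_eval A A' k r s X X' :
  map_mx f (mx_eval A A' k r s X X') =
  mx_eval (map_mx f A) (map_mx f A') k r [seq ((map_mx f l.1), l.2) | l <- s] (map_mx f X) (map_mx f X').
Proof.
have stepE Y : (fun Z => ((map_mx f Z.1), (map_mx f Z.2))) (mx_step A A' k Y) =
    mx_step (map_mx f A) (map_mx f A') k ((map_mx f Y.1), (map_mx f Y.2)).
  by rewrite /mx_step /= !(rmorphXn (map_mx f)) /= !map_mxM.
have iterE : (fun Z => ((map_mx f Z.1), (map_mx f Z.2))) (iter r (mx_step A A' k) (X, X')) =
    iter r (mx_step (map_mx f A) (map_mx f A') k) ((map_mx f X), (map_mx f X')).
  by elim: r => //= r <-; apply: stepE.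
rewrite /mx_eval -iterE /mx_word big_map (rmorph_prod (map_mx f)).
by apply: eq_bigr => l _; rewrite /= map_mxM; case: l.2.
Qed.

End Map.

Lemma mx_eval_scale (L : fieldType) (A A' : 'M[L]_N) k r s X X' (c : L) :
  c != 0 -> exists2 g : L, g != 0 &
    mx_eval A A' k r s X (c *: X') = g *: mx_eval A A' k r s X X'.
Proof.
move=> c0; rewrite /mx_eval.
have [a [b [a0 b0 ->]]] : exists a b : L, [/\ a != 0, b != 0 &
    iter r (mx_step A A' k) (X, c *: X') =
    (a *: (iter r (mx_step A A' k) (X, X')).1,
     b *: (iter r (mx_step A A' k) (X, X')).2)].
  elim: r => [|r [a [b [a0 b0 IHr]]]]; first by exists 1, c; rewrite oner_eq0 scale1r.
  exists ((a * b) ^+ k), ((a * b) ^+ k); rewrite expf_neq0 ?mulf_neq0 //.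
  split=> //; rewrite !iterS IHr /mx_step /=.
  set Y := (iter _ _ _).1; set Y' := (iter _ _ _).2.
  have -> : a *: Y * A * (b *: Y') * A' = (a * b) *: (Y * A * Y' * A').
    by rewrite !(mulmxZl, mulmxZr) scalerA 1?[b * a]mulrC.
  have -> : A * (a *: Y) * A' * (b *: Y') = (a * b) *: (A * Y * A' * Y').
    by rewrite !(mulmxZl, mulmxZr) scalerA 1?[b * a]mulrC.
  by rewrite !exprmxZ.
move: (iter _ _ _) => [Y Y'] /=; elim: s => [|l s [g g0 IHs]].
  by exists 1; rewrite ?oner_eq0 // scale1r /mx_word !big_nil.
have E Z : mx_word (l :: s) Z = l.1 * (if l.2 then Z.2 else Z.1) * mx_word s Z.
  by rewrite /mx_word big_cons.
rewrite !E IHs.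
exists ((if l.2 then b else a) * g); first by rewrite mulf_neq0 //; case: l.2.
by case: l.2; rewrite /= !(mulmxZl, mulmxZr) scalerA 1?[g * _]mulrC.
Qed.

End MatrixWords.

Section Leading.
Variables (L : fieldType) (N : nat).

(** [C] is the coefficient of degree [e] and may vanish, so that the relation is multiplicative
    without any condition. *)
Definition leading (e : nat) (M : 'M[{poly L}]_N) (C : 'M[L]_N) : Prop :=
  forall i j, (size (M i j) <= e.+1)%N /\ (M i j)`_e = C i j.

Lemma leading_mul e e' M M' C C' :
  leading e M C -> leading e' M' C' -> leading (e + e') (M * M') (C * C').
Proof.
move=> lM lM' i j.
have coefMe (p q : {poly L}) : (size p <= e.+1)%N -> (size q <= e'.+1)%N ->
    (size (p * q)%R <= (e + e').+1)%N /\ (p * q)`_(e + e') = p`_e * q`_e'.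
  move=> sp sq; split.
    by rewrite (leq_trans (size_polyMleq _ _)) //; lia.
  have lt_e : (e < (e + e').+1)%N by rewrite ltnS leq_addr.
  rewrite coefM (bigD1 (Ordinal lt_e)) //= addKn big1 ?addr0 // => k.
  rewrite -val_eqE /= => ke; have lt_k := ltn_ord k; have [le|gt] := leqP k e.
    have -> : q`_(e + e' - k) = 0 by rewrite nth_default // (leq_trans sq) //; lia.
    by rewrite mulr0.
  have -> : p`_k = 0 by rewrite nth_default // (leq_trans sp).
  by rewrite mul0r.
rewrite !mxE; split.
  apply: (leq_trans (size_sum _ _ _)); apply/bigmax_leqP => k _.
  by have [] := coefMe _ _ (lM i k).1 (lM' k j).1.
rewrite coef_sum; apply: eq_bigr => k _.
by have [_ ->] := coefMe _ _ (lM i k).1 (lM' k j).1; rewrite (lM i k).2 (lM' k j).2.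
Qed.

Lemma leading_const A : leading 0 (map_mx polyC A) A.
Proof.
by move=> i j; rewrite !mxE coefC eqxx; split=> //; apply: size_polyC_leq1.
Qed.

Lemma leading_exp e M C k : leading e M C -> leading (k * e) (M ^+ k) (C ^+ k).
Proof.
move=> lM; elim: k => [|k IHk]; last by rewrite mulSn !exprS; apply: leading_mul.
have -> : (M ^+ 0 = map_mx polyC 1%:M) by rewrite map_mx1.
exact: leading_const.
Qed.

Variables (A A' : 'M[L]_N) (u : 'cV[L]_N) (psi : 'rV[L]_N) (k : nat).
Hypotheses (AA' : A * A' = 1) (A'A : A' * A = 1) (k_gt0 : (0 < k)%N).
Hypotheses (psiA : (psi *m A *m u) 0 0 != 0) (psiA' : (psi *m A' *m u) 0 0 != 0).

Let U (b : bool) := if b then A *m u else u.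
Let Psi (b : bool) := if b then psi else psi *m A'.

Lemma rank1_exp (c : L) (x : 'cV[L]_N) (y : 'rV[L]_N) (n : nat) :
  (0 < n)%N -> (c *: (x *m y) : 'M_N) ^+ n =
    (c ^+ n * ((y *m x) 0 0) ^+ n.-1) *: (x *m y).
Proof.
case: n => // n _; elim: n => [|n IHn]; first by rewrite expr1 expr0 mulr1.
rewrite exprS IHn mulmxZl mulmxZr scalerA -[_ * (x *m y)]mulmxA (mulmxA y).
rewrite [y *m x]mx11_scalar mul_scalar_mx -scalemxAr scalerA mxE eqxx mulr1n.
by congr (_ *: _); rewrite /= !exprS; ring.
Qed.

Lemma rank1_sandwich (x z : 'cV[L]_N) (y t : 'rV[L]_N) :
  (x *m y) * (z *m t) = (y *m z) 0 0 *: (x *m t).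
Proof.
by rewrite -[LHS]mulmxA (mulmxA y) {1}[y *m z]mx11_scalar mul_scalar_mx -scalemxAr.
Qed.

(* The relation [psi *m u = 0] makes [1 - t u psi] the inverse of [1 + t u psi] and
   keeps all leading coefficients of rank one, so that powers do not cancel. *)
Lemma leading_iter r : exists e c1 c2, [/\ (0 < e)%N, c1 != 0, c2 != 0,
  leading e (iter r.+1 (mx_step (map_mx polyC A) (map_mx polyC A') k)
     (1 + 'X *: map_mx polyC (u *m psi), 1 - 'X *: map_mx polyC (u *m psi))).1 (c1 *: (U false *m Psi false)) &
  leading e (iter r.+1 (mx_step (map_mx polyC A) (map_mx polyC A') k)
     (1 + 'X *: map_mx polyC (u *m psi), 1 - 'X *: map_mx polyC (u *m psi))).2 (c2 *: (U true *m Psi true))].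
Proof.
have step e Y Y' c1 c2 (x1 x2 : 'cV[L]_N) (y1 y2 : 'rV[L]_N) :
   (0 < e)%N -> c1 != 0 -> c2 != 0 ->
   leading e Y (c1 *: (x1 *m y1)) -> leading e Y' (c2 *: (x2 *m y2)) ->
   (y1 *m A *m x2) 0 0 != 0 -> (y1 *m A' *m x2) 0 0 != 0 ->
   (y2 *m A' *m x1) 0 0 != 0 -> (y2 *m A *m x1) 0 0 != 0 ->
   exists e' d1 d2, [/\ (0 < e')%N, d1 != 0, d2 != 0,
     leading e' (mx_step (map_mx polyC A) (map_mx polyC A') k (Y, Y')).1 (d1 *: (x1 *m (y2 *m A'))) &
     leading e' (mx_step (map_mx polyC A) (map_mx polyC A') k (Y, Y')).2 (d2 *: (A *m x1 *m y2))].
  move=> e_gt0 c10 c20 lY lY' h1 h2 h3 h4.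
  have lA := leading_const A; have lA' := leading_const A'.
  pose b1 := c1 * c2 * (y1 *m A *m x2) 0 0.
  pose b2 := c1 * c2 * (y1 *m A' *m x2) 0 0.
  have E1 : (c1 *: (x1 *m y1)) * A * (c2 *: (x2 *m y2)) * A' =
      b1 *: (x1 *m (y2 *m A')).
    rewrite !(mulmxZl, mulmxZr) scalerA -[x1 *m y1 * A]mulmxA.
    rewrite rank1_sandwich mulmxZl scalerA -[_ * A']mulmxA; congr (_ *: _).
    by rewrite /b1; ring.
  have E2 : A * (c1 *: (x1 *m y1)) * A' * (c2 *: (x2 *m y2)) =
      b2 *: (A *m x1 *m y2).
    rewrite !(mulmxZl, mulmxZr) scalerA.
    rewrite -[_ * _ * A']mulrA -[x1 *m y1 * A']mulmxA [A * _]mulmxA.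
    by rewrite rank1_sandwich scalerA; congr (_ *: _); rewrite /b2; ring.
  exists (k * (e + e))%N, (b1 ^+ k * (y2 *m A' *m x1) 0 0 ^+ k.-1),
    (b2 ^+ k * (y2 *m A *m x1) 0 0 ^+ k.-1); split.
  - by rewrite muln_gt0 k_gt0 addn_gt0 e_gt0.
  - by rewrite !(mulf_neq0, expf_neq0).
  - by rewrite !(mulf_neq0, expf_neq0).
  - rewrite -rank1_exp // -E1; apply: leading_exp.
    have := leading_mul (leading_mul (leading_mul lY lA) lY') lA'.
    by rewrite !addn0.
  - rewrite -(mulmxA y2 A x1) -rank1_exp // -E2; apply: leading_exp.
    have := leading_mul (leading_mul (leading_mul lA lY) lA') lY'.
    by rewrite add0n addn0.
have lX (c : {poly L}) (d : L) (M : 'M[L]_N) : (size c <= 2)%N -> c`_1 = d ->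
    leading 1 (1 + c *: map_mx polyC M) (d *: M).
  move=> sz_c c1 i j; rewrite -[X in X + _]/(1%:M) !mxE; split.
    rewrite (leq_trans (size_polyD _ _)) // geq_max; apply/andP; split.
      by case: (i == j); rewrite ?mulr1n ?mulr0n ?size_poly1 ?size_poly0.
    rewrite (leq_trans (size_polyMleq _ _)) //.
    by rewrite -subn1 leq_subLR addnC leq_add ?size_polyC_leq1.
  rewrite coefD coefMC c1; case: (i == j); last by rewrite mulr0n coef0 add0r.
  by rewrite mulr1n coef1 add0r.
have lX1 : leading 1 (1 + 'X *: map_mx polyC (u *m psi)) (1 *: (u *m psi)).
  by apply: lX; rewrite ?size_polyX ?coefX.
have lX2 : leading 1 (1 - 'X *: map_mx polyC (u *m psi)) (- 1 *: (u *m psi)).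
  by rewrite -scaleNr; apply: lX; rewrite ?size_polyN ?size_polyX // coefN coefX.
elim: r => [|r [e [c1 [c2 [e_gt0 c10 c20 l1 l2]]]]].
  have n10 : (-1 : L) != 0 by rewrite oppr_eq0 oner_neq0.
  have [e' [d1 [d2 [? ? ? ? ?]]]] := step 1%N _ _ 1 (-1) u u psi psi isT
    (oner_neq0 _) n10 lX1 lX2 psiA psiA' psiA' psiA.
  by exists e', d1, d2; split.
(* After one step the shape of the two rank one coefficients no longer changes; since [A' * A = 1],
   the four scalars required by [step] are again [psi A u] and [psi A' u]. *)
have := step e _ _ c1 c2 _ _ _ _ e_gt0 c10 c20 l1 l2; rewrite /U /Psi /=.
have -> : psi *m A' *m A *m (A *m u) = psi *m A *m u.
  by rewrite -(mulmxA psi A' A) [A' *m A]A'A mulmx1 mulmxA.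
have -> : psi *m A' *m A' *m (A *m u) = psi *m A' *m u.
  by rewrite -!mulmxA (mulmxA A' A) [A' *m A]A'A mul1mx.
move=> /(_ psiA psiA' psiA' psiA)[e' [d1 [d2 [? ? ? ? ?]]]].
by exists e', d1, d2; split=> //; rewrite iterS [iter _ _ _]surjective_pairing.
Qed.
End Leading.

Lemma poly_zero_of_roots (R : idomainType) (kappa : nat -> R) (p : {poly R}) :
  injective kappa -> (forall i, p.[kappa i] = 0) -> p = 0.
Proof.
move=> inj_k p0; apply: contrapT => /eqP nz.
have all_rs : all (root p) [seq kappa i | i <- iota 0 (size p)].
  by apply/allP => x /mapP[i _ ->]; apply/rootP.
have := max_poly_roots nz all_rs; rewrite map_inj_uniq // iota_uniq => /(_ isT).
by rewrite size_map size_iota ltnn.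
Qed.

(** * Vectors in general position *)

Section Generic.
Variables (L : fieldType) (N : nat) (kappa : nat -> L).
Hypothesis inj_kappa : injective kappa.

(* The row [u^T (Z - Z^T)] kills [u] whatever [Z] is. *)
Let form (R : comNzRingType) (b : 'M[R]_N) (u : 'cV[R]_N) (Z : 'M[R]_N) : R :=
  (u^T *m (Z - Z^T) *m b *m u) 0 0.

(** For [Z] a matrix unit the form is a two by two minor of [u] and [b u]. If all of them vanish,
    every [u] is an eigenvector of [b]; basis vectors and their pairwise sums then show that [b] is
    scalar. *)
Lemma form_nonzero (b : 'M[L]_N) : ~~ is_scalar_mx b -> exists u Z, form b u Z != 0.
Proof.
move=> nsb; apply: contrapT => none; move/negP: nsb; apply.
have swap (u : 'cV[L]_N) i j : u i 0 * (b *m u) j 0 = u j 0 * (b *m u) i 0.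
  apply/eqP; rewrite -subr_eq0; apply: contrapT => /negP nz; apply: none.
  exists u, (delta_mx i j); congr (_ != 0) : nz.
  have dE i' j' : (u^T *m delta_mx i' j' *m (b *m u)) 0 0 = u i' 0 * (b *m u) j' 0.
    rewrite mxE (bigD1 j') //= big1 ?addr0 => [|l lj].
      rewrite mxE (bigD1 i') //= big1 ?addr0 => [|l li].
        by rewrite !mxE !eqxx mulr1.
      by rewrite !mxE (negbTE li) mulr0.
    rewrite mxE big1 ?mul0r // => l' _.
    by rewrite !mxE (negbTE lj) andbF mulr0.
  by rewrite /form trmx_delta mulmxBr !mulmxBl -![_ *m b *m u]mulmxA [RHS]mxE [X in _ = _ + X]mxE !dE.
have bE j l : (b *m delta_mx l 0 : 'cV_N) j 0 = b j l.
  rewrite mxE (bigD1 l) //= big1 ?addr0 => [|l' ll']; first by rewrite mxE !eqxx mulr1.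
  by rewrite mxE (negbTE ll') mulr0.
have off j l : j != l -> b j l = 0.
  move=> jl; have := swap (delta_mx l 0) l j; rewrite !bE !mxE !eqxx (negbTE jl).
  by rewrite mul0r mul1r.
have diag j l : b j j = b l l.
  have [-> //|jl] := eqVneq j l.
  have := swap (delta_mx j 0 + delta_mx l 0) j l.
  have lj : l != j by rewrite eq_sym.
  rewrite mulmxDr ![(_ + _ : 'cV_N) _ _]mxE !bE !mxE !eqxx (negbTE jl) (negbTE lj) /=.
  by rewrite (off j l jl) (off l j lj) !addr0 !add0r !mul1r => ->.
apply/is_scalar_mxP; have [i0|] := pselect (exists i0 : 'I_N, true).
  have [i _] := i0; exists (b i i); apply/matrixP => j l; rewrite mxE.
  case: (eqVneq j l) => [->|jl]; last by rewrite mulr0n off.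
  by rewrite mulr1n; apply: diag.
by move=> no; exists 0; apply/matrixP => j; exfalso; apply: no; exists j.
Qed.

(** The pairs [(u, Z)] range over an affine space and each condition is polynomial. On the line from
    a pair good for [bs] to one good for [b], no condition vanishes identically, so some point
    satisfies them all. *)
Lemma generic_vectors (bs : seq 'M[L]_N) : (forall b, b \in bs -> ~~ is_scalar_mx b) ->
  exists (u : 'cV[L]_N) (psi : 'rV[L]_N), psi *m u = 0 /\
    forall b, b \in bs -> (psi *m b *m u) 0 0 != 0.
Proof.
move=> nsb; suff [u [Z uZ]] : exists u Z, forall b, b \in bs -> form b u Z != 0.
  exists u, (u^T *m (Z - Z^T)); split=> //.
  rewrite mulmxBr mulmxBl; apply/eqP; rewrite subr_eq0; apply/eqP.
  apply/matrixP => i j; rewrite !ord1.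
  have -> : u^T *m Z^T *m u = (u^T *m Z *m u)^T by rewrite !trmx_mul trmxK mulmxA.
  by rewrite [RHS]mxE.
elim: bs nsb => [|b bs IHbs] nsb; first by exists 0, 0.
have [|u1 [Z1 h1]] := IHbs; first by move=> c c_bs; apply: nsb; rewrite inE c_bs orbT.
have [u2 [Z2 h2]] := form_nonzero (nsb b (mem_head _ _)).
pose line (m n : nat) (M1 M2 : 'M[L]_(m, n)) : 'M[{poly L}]_(m, n) :=
  map_mx polyC M1 + 'X *: map_mx polyC (M2 - M1).
pose at_ (m n : nat) (t : L) (M : 'M[{poly L}]_(m, n)) := map_mx (horner_eval t) M.
have lineE m n t (M1 M2 : 'M[L]_(m, n)) : at_ _ _ t (line _ _ M1 M2) = M1 + t *: (M2 - M1).
  by apply/matrixP => i j; rewrite !mxE /= /horner_eval !hornerE.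
pose p c := form (map_mx polyC c) (line _ _ u1 u2) (line _ _ Z1 Z2).
have pE c t : (p c).[t] = form c (u1 + t *: (u2 - u1)) (Z1 + t *: (Z2 - Z1)).
  have -> : (p c).[t] = map_mx (horner_eval t) ((line _ _ u1 u2)^T *m
      (line _ _ Z1 Z2 - (line _ _ Z1 Z2)^T) *m map_mx polyC c *m line _ _ u1 u2) 0 0.
    by rewrite [RHS]mxE.
  rewrite !map_mxM map_mxB -!map_trmx -!lineE; congr ((_ *m _ *m _) 0 0).
  by apply/matrixP => i j; rewrite !mxE /= /horner_eval hornerC.
pose q := \prod_(c <- b :: bs) p c.
have q0 : q != 0.
  rewrite /q prodf_seq_neq0; apply/allP => c c_bs /=; apply/negP => /eqP pc0.
  move: c_bs; rewrite inE => /orP[/eqP cb|c_bs].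
    have := pE c 1; rewrite pc0 horner0 cb !scale1r !(addrC _ (_ - _)) !subrK.
    by move/eqP; rewrite eq_sym (negbTE h2).
  have := pE c 0; rewrite pc0 horner0 !scale0r !addr0 => /eqP.
  by rewrite eq_sym (negbTE (h1 c c_bs)).
have [t qt] : exists t, q.[t] != 0.
  apply: contrapT => none; move/eqP: q0; apply.
  apply: (poly_zero_of_roots inj_kappa) => i; apply: contrapT => nz.
  by apply: none; exists (kappa i); apply/eqP.
exists (u1 + t *: (u2 - u1)), (Z1 + t *: (Z2 - Z1)) => c c_bs; rewrite -pE.
by move: qt; rewrite /q horner_prod prodf_seq_neq0 => /allP/(_ c c_bs).
Qed.

End Generic.

Lemma pred_muln_le1 (N m n : nat) :
  (0 < N)%N -> (n <= 1)%N -> n.-1 = (m.-1 * N)%N -> (m <= 1)%N.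
Proof. by case: m => [|[|m]] //=; nia. Qed.

(** * Trace and determinant of a word on a unipotent line *)

Section RatioNotConst.
Variables (L : fieldType) (N : nat) (kappa : nat -> L).
Hypothesis inj_kappa : injective kappa.
Variables (A A' : 'M[L]_N) (k r : nat) (s : seq ('M[L]_N * bool)).
Hypotheses (AA' : A * A' = 1) (A'A : A' * A = 1) (k_gt0 : (0 < k)%N).

(** The leading coefficient of [Y] ends with [psi *m A'] and that of its inverse begins with
    [A *m u]; so [psi *m junction l1 l2 *m u] is the scalar produced between two consecutive
    letters. *)
Definition junction (l1 l2 : 'M[L]_N * bool) : 'M[L]_N :=
  (if l1.2 then 1 else A') * l2.1 * (if l2.2 then A else 1).

(* The adjugate replaces the inverse, which multiplies the word by a scalar that
   cancels in [tr^N / det]; the factor [\det X] makes both sides vanish when [X] is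
   singular. *)
Definition word_numer (X : 'M[L]_N) : L :=
  \tr (mx_eval A A' k r.+1 s X (\adj X)) ^+ N * \det X.

Definition word_denom (X : 'M[L]_N) : L :=
  \det (mx_eval A A' k r.+1 s X (\adj X)) * \det X.

Lemma word_polys (C0 C1 : 'M[L]_N) : exists P Q : {poly L}, forall t,
  P.[t] = word_numer (C0 + t *: C1) /\ Q.[t] = word_denom (C0 + t *: C1).
Proof.
pose X := map_mx polyC C0 + 'X *: map_mx polyC C1.
pose W := mx_eval (map_mx polyC A) (map_mx polyC A') k r.+1
  [seq (map_mx polyC l.1, l.2) | l <- s] X (\adj X).
exists (\tr W ^+ N * \det X), (\det W * \det X) => t.
have evC (M : 'M[L]_N) : map_mx (horner_eval t) (map_mx polyC M) = M.
  by apply/matrixP => i j; rewrite !mxE /horner_eval hornerC.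
have evX : map_mx (horner_eval t) X = C0 + t *: C1.
  apply/matrixP => i j; rewrite !mxE /= /horner_eval !hornerE //.
have evW : map_mx (horner_eval t) W =
    mx_eval A A' k r.+1 s (C0 + t *: C1) (\adj (C0 + t *: C1)).
  rewrite /W map_mx_eval !evC map_mx_adj evX -map_comp; congr mx_eval.
  by rewrite -[RHS]map_id; apply: eq_map => -[M b] /=; rewrite evC.
rewrite /word_numer /word_denom -evW -evX; split.
  by rewrite hornerM horner_exp det_map_mx trace_map_mx.
by rewrite hornerM !det_map_mx.
Qed.

(** The first [j] coordinates are freed one by one: along the line that moves a single coordinate
    [H] is a polynomial, and it vanishes at the infinitely many values [kappa i]. *)
Lemma word_density (K : L -> Prop) (H : 'M[L]_N -> L) (q : nat)
    (B : 'I_q -> 'M[L]_N) :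
  (forall i, K (kappa i)) ->
  (forall C0 C1, exists P : {poly L}, forall t, P.[t] = H (C0 + t *: C1)) ->
  (forall c : 'I_q -> L, (forall i, K (c i)) -> H (\sum_i c i *: B i) = 0) ->
  forall c : 'I_q -> L, H (\sum_i c i *: B i) = 0.
Proof.
move=> Kk Hpoly H0.
suff main j (c : 'I_q -> L) : (forall i : 'I_q, (j <= i)%N -> K (c i)) ->
    H (\sum_i c i *: B i) = 0.
  by move=> c; apply: (main q) => i; rewrite leqNgt ltn_ord.
elim: j c => [|j IHj] c Kc; first by apply: H0 => i; apply: Kc.
have [lt_jq|le_qj] := ltnP j q; last first.
  by apply: IHj => i le_ji; have := leq_trans le_qj le_ji; rewrite leqNgt ltn_ord.
pose j0 := Ordinal lt_jq.
pose upd t (i : 'I_q) := if i == j0 then t else c i.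
have updE t : \sum_i upd t i *: B i = (\sum_(i | i != j0) c i *: B i) + t *: B j0.
  rewrite (bigD1 j0) //= /upd eqxx addrC; congr (_ + _).
  by apply: eq_bigr => i /negbTE ->.
have [P PE] := Hpoly (\sum_(i | i != j0) c i *: B i) (B j0).
have P0 : P = 0.
  apply: (poly_zero_of_roots inj_kappa) => i; rewrite PE -updE; apply: IHj => l le_jl.
  rewrite /upd; case: eqVneq => // ne; apply: Kc.
  by rewrite ltn_neqAle le_jl andbT eq_sym; apply: contraNneq ne => e; apply/eqP/val_inj.
have -> : \sum_i c i *: B i = \sum_i upd (c j0) i *: B i.
  by apply: eq_bigr => i _; rewrite /upd; case: eqVneq => // ->.
by rewrite updE -PE P0 horner0.
Qed.

Hypotheses (nsA : ~~ is_scalar_mx A) (nsA' : ~~ is_scalar_mx A').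
Hypothesis s_unit : forall l, l \in s -> l.1 \in unitmx.
Hypothesis s_nil : s != [::].
Hypothesis s_cycle : path.cycle (fun l1 l2 => ~~ is_scalar_mx (junction l1 l2)) s.

Lemma word_ratio_not_const (tau : L) :
  ~ (forall X, word_numer X = tau * word_denom X).
Proof.
move=> const.
pose bs := A :: A' :: [seq b <- [seq junction l1 l2 | l1 <- s, l2 <- s] | ~~ is_scalar_mx b].
have [|u [psi [psi_u hbs]]] := @generic_vectors _ _ _ inj_kappa bs.
  by move=> b; rewrite !inE => /or3P[/eqP ->|/eqP ->|] //; rewrite mem_filter => /andP[].
have psiA : (psi *m A *m u) 0 0 != 0 by apply: hbs; rewrite inE eqxx.
have psiA' : (psi *m A' *m u) 0 0 != 0 by apply: hbs; rewrite !inE eqxx orbT.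
pose E := u *m psi.
have EE : E *m E = 0 by rewrite /E -mulmxA (mulmxA psi) psi_u mul0mx mulmx0.
pose X : 'M[{poly L}]_N := 1 + 'X *: map_mx polyC E.
pose X' : 'M[{poly L}]_N := 1 - 'X *: map_mx polyC E.
have [e [c1 [c2 [e_gt0 c10 c20 lY lY']]]] :=
  leading_iter A'A k_gt0 psiA psiA' r.
pose Ac := map_mx polyC A; pose Ac' := map_mx polyC A'.
rewrite -/E -/X -/X' -/Ac -/Ac' in lY lY'.
pose Y := iter r.+1 (mx_step Ac Ac' k) (X, X').
rewrite -/Y in lY lY'.
pose sc := [seq (map_mx polyC l.1, l.2) | l <- s].
pose W := mx_eval Ac Ac' k r.+1 sc X X'.
pose U (b : bool) := if b then A *m u else u.
pose Psi (b : bool) := if b then psi else psi *m A'.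
pose cc (b : bool) := if b then c2 else c1.
have lW : leading (size s * e) W
    (\prod_(l <- s) (l.1 * (cc l.2 *: (U l.2 *m Psi l.2)))).
  rewrite /W /mx_eval -/Y /mx_word /sc big_map /=.
  elim: (s) => [|l s' IHs]; first by rewrite !big_nil mul0n; have := leading_const (1%:M : 'M[L]_N);
    rewrite map_mx1.
  have lYl : leading e (if l.2 then Y.2 else Y.1) (cc l.2 *: (U l.2 *m Psi l.2)).
    by case: l.2.
  have := leading_mul (leading_mul (leading_const l.1) lYl) IHs.
  by rewrite !big_cons /= mulSn add0n.
(* The leading coefficient of [W] is a product of rank one matrices. The trace closes it up into a
   nonzero constant times one junction scalar for each pair of cyclically consecutive letters. *)
have size_tr : (\tr W)`_(size s * e) != 0.
  have -> : (\tr W)`_(size s * e) =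
      \tr (\prod_(l <- s) (l.1 * (cc l.2 *: (U l.2 *m Psi l.2)))).
    by rewrite /mxtrace coef_sum; apply: eq_bigr => i _; case: (lW i i).
  have good l1 l2 : l1 \in s -> l2 \in s -> ~~ is_scalar_mx (junction l1 l2) ->
      (Psi l1.2 *m l2.1 *m U l2.2) 0 0 != 0.
    move=> s1 s2 ns; have := hbs (junction l1 l2); rewrite !inE mem_filter ns.
    have -> : junction l1 l2 \in [seq junction l1 l2 | l1 <- s, l2 <- s].
      by apply/allpairsP; exists (l1, l2).
    rewrite !orbT => /(_ isT); congr (_ != 0); congr (fun_of_matrix _ _ _).
    rewrite /junction /Psi /U -![_ * _]/(_ *m _).
    by case: l1.2; case: l2.2; rewrite ?mul1mx ?mulmx1 ?mulmxA.
  have gprod l0 s' : path (fun l1 l2 => (Psi l1.2 *m l2.1 *m U l2.2) 0 0 != 0) l0 s' ->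
      exists2 c, c != 0 & \prod_(l <- l0 :: s') (l.1 * (cc l.2 *: (U l.2 *m Psi l.2))) =
        c *: (l0.1 *m U l0.2 *m Psi (last l0 s').2).
    have ccn b : cc b != 0 by case: b.
    elim: s' l0 => [|l1 s' IHs] l0 /=.
      by exists (cc l0.2); rewrite // big_seq1 mulmxZr [_ * _]mulmxA.
    case/andP=> h01 /IHs[c c0 Dc].
    exists (cc l0.2 * c * (Psi l0.2 *m l1.1 *m U l1.2) 0 0); first by rewrite !mulf_neq0.
    rewrite big_cons Dc !(mulmxZl, mulmxZr) scalerA.
    rewrite [l0.1 * (_ *m _)]mulmxA rank1_sandwich scalerA mulmxA; congr (_ *: _).
    by ring.
  case Ds: s s_nil s_cycle => [//|l0 s'] _ cyc.
  have {cyc}: path (fun l1 l2 => (Psi l1.2 *m l2.1 *m U l2.2) 0 0 != 0) l0 (rcons s' l0).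
    apply: (sub_in_path (P := mem s) _ _ cyc) => [l1 l2 s1 s2|]; first exact: good.
    apply/allP => l; rewrite inE mem_rcons inE => hl; change (l \in s).
    by rewrite Ds inE; case/or3P: hl => ->; rewrite ?orbT.
  rewrite rcons_path => /andP[/gprod[c c0 ->] glast].
  rewrite mxtraceZ mulf_neq0 // mxtrace_mulC.
  by rewrite mulmxA trace_mx11.
(* As [X * X' = 1], the word is invertible over the polynomial ring and its determinant is a nonzero
   constant. A constant ratio then makes the [N]-th power of the trace constant. *)
have tr_const : (size (\tr W) <= 1)%N.
  have XX' : X * X' = 1.
    rewrite /X /X' mulrBr mulr1 mulrDl mul1r mulmxZl mulmxZr scalerA.
    rewrite -[map_mx polyC E * _]map_mxM EE map_mx0 scaler0 addr0 addrK //.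
  have WI : W \in unitmx.
    have [Au Au'] : Ac \in unitmx /\ Ac' \in unitmx.
      by apply: mulmx1_unit; rewrite -map_mxM [A *m A']AA' map_mx1.
    have Xu := mulmx1_unit XX'.
    have Yu j : (iter j (mx_step Ac Ac' k) (X, X')).1 \in unitmx /\
        (iter j (mx_step Ac Ac' k) (X, X')).2 \in unitmx.
      have expu (M : 'M[{poly L}]_N) i : M \in unitmx -> M ^+ i \in unitmx.
        move=> Mu; elim: i => [|i IHi]; first exact: unitmx1.
        by rewrite exprS unitmx_mul Mu.
      elim: j => [|j [IH1 IH2]] //; rewrite iterS /mx_step /=.
      by split; apply: expu; rewrite !unitmx_mul IH1 IH2 Au Au'.
    have [Y1 Y2] := Yu r.+1.
    rewrite /W /mx_eval /mx_word /sc big_map big_seq.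
    elim/big_ind: _ => [|M M'|l l_s]; first exact: unitmx1.
      by rewrite unitmx_mul => -> ->.
    rewrite unitmx_mul; apply/andP; split; last by case: l.2.
    rewrite unitmxE det_map_mx /= poly_unitE coefC eqxx -unitmxE s_unit // andbT.
    by rewrite size_polyC -unitfE -unitmxE s_unit.
  have evW t : map_mx (horner_eval t) W = mx_eval A A' k r.+1 s
     (1 + t *: E) (1 - t *: E).
    have evC (M : 'M[L]_N) : map_mx (horner_eval t) (map_mx polyC M) = M.
      by apply/matrixP => i j; rewrite !mxE /= /horner_eval hornerC.
    have ev1 : map_mx (horner_eval t) 1 = 1 by exact: map_mx1.
    rewrite /W map_mx_eval !evC -map_comp; congr mx_eval.
    - by rewrite -[RHS]map_id; apply: eq_map => -[M b] /=; rewrite evC.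
    - by rewrite /X map_mxD ev1 map_mxZ evC /= /horner_eval hornerX.
    - by rewrite /X' map_mxB ev1 map_mxZ evC /= /horner_eval hornerX.
  have eqW : \tr W ^+ N = tau *: \det W.
    apply/eqP; rewrite -subr_eq0; apply/eqP.
    apply: (poly_zero_of_roots inj_kappa) => i; set t := kappa i.
    rewrite hornerD hornerN hornerZ horner_exp.
    have -> : (\tr W).[t] = \tr (mx_eval A A' k r.+1 s (1 + t *: E) (1 - t *: E)).
      by rewrite -evW trace_map_mx.
    have -> : (\det W).[t] = \det (mx_eval A A' k r.+1 s (1 + t *: E) (1 - t *: E)).
      by rewrite -evW det_map_mx.
    set Xt := 1 + t *: E; set Xt' := 1 - t *: E.
    have XXt : Xt * Xt' = 1.
      rewrite /Xt /Xt' mulrBr mulr1 mulrDl mul1r mulmxZl mulmxZr scalerA.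
      by rewrite [E * E]EE scaler0 addr0 addrK.
    have [Xtu _] := mulmx1_unit XXt.
    have d0 : \det Xt != 0 by rewrite -unitfE -unitmxE.
    have adjE : \adj Xt = \det Xt *: Xt'.
      by rewrite -[LHS]mulmx1 -[1%:M]XXt [_ *m _]mulmxA mul_adj_mx mul_scalar_mx.
    have [g g0 Dg] := mx_eval_scale A A' k r.+1 s Xt Xt' d0.
    have := const Xt; rewrite /word_numer /word_denom adjE Dg mulrA.
    move/(mulIf d0); rewrite mxtraceZ detZ exprMn mulrCA => /(mulfI (expf_neq0 N g0)) ->.
    by rewrite subrr.
  have sz_det : (size (tau *: \det W : {poly L}) <= 1)%N.
    rewrite (leq_trans (size_scale_leq _ _)) //.
    by move: WI; rewrite unitmxE poly_unitE => /andP[/eqP ->].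
  have N_gt0 : (0 < N)%N.
    rewrite lt0n; apply: contraNneq psiA => N0.
    by rewrite mxE big1 // => -[i lt_i]; exfalso; move: lt_i; rewrite N0.
  have := size_exp (\tr W) N; rewrite eqW.
  by apply: pred_muln_le1 N_gt0 sz_det.
move: size_tr; rewrite nth_default ?eqxx // (leq_trans tr_const) //.
by rewrite muln_gt0 e_gt0 andbT lt0n size_eq0.
Qed.

End RatioNotConst.

(** * Matrices over a maximal subfield *)

Lemma maximal_commuting (R : pzRingType) (S : set R) : exists C : set R,
  [/\ C `<=` S, forall x y, C x -> C y -> x * y = y * x &
      forall x, S x -> (forall y, C y -> x * y = y * x) -> C x].
Proof.
pose P := [set C : set R | C `<=` S /\ forall x y, C x -> C y -> x * y = y * x].
have [F FP totF|C [[CS Ccomm] Cmax]] := @Zorn_bigcup _ P.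
  split=> [x [C FC Cx]|x y [C FC Cx] [C' FC' C'y]]; first by have [CS _] := FP C FC; apply: CS.
  have [sub|sub] := totF C C' FC FC'.
    by have [_ comm] := FP C' FC'; apply: comm => //; apply: sub.
  by have [_ comm] := FP C FC; apply: comm => //; apply: sub.
exists C; split=> // x Sx xC; apply: contrapT => nCx.
apply: (Cmax (C `|` [set x])).
  by split=> [y Cy|/(_ x (or_intror erefl)) //]; left.
split=> [y [/CS //|-> //]|y z [Cy|->] [Cz|->]] //; first exact: Ccomm.
- by rewrite xC.
- exact: xC.
Qed.

Section CommDivision.
Variable D : unitRingType.

Record comm_division := CommDivision {
  cd_pred :> {pred D};
  cd_closed : GRing.divring_closed cd_pred;
  cd_comm : {in cd_pred &, forall x y, x * y = y * x};
  cd_unit : {in cd_pred, forall x, x != 0 -> x \is a GRing.unit}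
}.

Variable c : comm_division.

HB.instance Definition _ :=
  GRing.isDivringClosed.Build D (cd_pred c) (cd_closed c).

Record cd_field := CdField { cd_val : D; _ : cd_val \in cd_pred c }.

HB.instance Definition _ := [isSub for cd_val].
HB.instance Definition _ := [Choice of cd_field by <:].
HB.instance Definition _ := [SubChoice_isSubUnitRing of cd_field by <:].

Fact cd_field_mulC : commutative (@GRing.mul cd_field).
Proof. by move=> x y; apply/val_inj/cd_comm; apply: valP. Qed.

HB.instance Definition _ :=
  GRing.PzRing_hasCommutativeMul.Build cd_field cd_field_mulC.

Fact cd_field_axiom : GRing.field_axiom cd_field.
Proof.
move=> x x0; have x0' : val x != 0 by rewrite -(inj_eq val_inj) in x0.
have Ux : val x \is a GRing.unit := cd_unit (valP x) x0'.
have xV : (val x)^-1 \in cd_pred c by rewrite rpredV; apply: valP.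
apply/unitrP; exists (CdField xV); split; apply: val_inj.
  by rewrite /= mulVr.
by rewrite /= divrr.
Qed.

HB.instance Definition _ := GRing.ComUnitRing_isField.Build cd_field cd_field_axiom.

End CommDivision.

(** Everything in [S] that commutes with a maximal commuting subset belongs to it; this gives the
    closure under differences and quotients. *)
Lemma exists_maximal_field (D : unitRingType) (S : set D) :
  division_ring D -> division_subring S -> exists c : comm_division D,
    (forall x, x \in c -> S x) /\
    forall x, S x -> (forall y, y \in c -> x * y = y * x) -> x \in c.
Proof.
move=> divD [S1 SB SV]; have [C [CS Ccomm Cmax]] := maximal_commuting S.
pose P : {pred D} := fun x => `[< C x >].
have P_closed : GRing.divring_closed P.
  split=> [|x y /asboolP Cx /asboolP Cy|x y /asboolP Cx /asboolP Cy]; apply/asboolP.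
  - by apply: Cmax => [|y Cy]; [apply/set_mem/S1|rewrite mul1r mulr1].
  - apply: Cmax => [|z Cz]; first by apply/set_mem/SB; apply/mem_set/CS.
    by rewrite mulrBl mulrBr !(Ccomm z).
  - apply: Cmax => [|z Cz]; first by apply/set_mem/SV; apply/mem_set/CS.
    have zy : GRing.comm z y^-1 by apply/commrV/Ccomm.
    by rewrite -mulrA -zy mulrA (Ccomm x z) // -mulrA.
have P_comm : {in P &, forall x y, x * y = y * x}.
  by move=> x y /asboolP Cx /asboolP Cy; apply: Ccomm.
have P_unit : {in P, forall x, x != 0 -> x \is a GRing.unit}.
  by move=> x _; apply: divD.
exists (CommDivision P_closed P_comm P_unit); split=> [x /asboolP/CS //|x Sx xC].
by apply/asboolP/Cmax => // y Cy; apply: xC; apply/asboolP.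
Qed.

(** Jacobson density, proved by prescribing the images of independent rows. If some [M] in [R] kills
    all rows but the first, irreducibility corrects the image of the first. If none does, [l *m M]
    is a function of [La' *m M] whose components commute with [R], hence are scalar, and [l] depends
    on the other rows. *)
Lemma density_theorem (L : fieldType) (N : nat) (R : 'M[L]_N -> Prop) :
  (forall a, R a%:M) -> (forall M M', R M -> R M' -> R (M + M')) ->
  (forall M M', R M -> R M' -> R (M *m M')) ->
  (forall v w : 'rV[L]_N, v != 0 -> exists2 M, R M & v *m M = w) ->
  (forall f : 'rV[L]_N -> 'rV[L]_N, (forall v M, R M -> f (v *m M) = f v *m M) ->
     exists a, forall v, f v = a *: v) ->
  forall M, R M.
Proof.
move=> RC RD RM Rirr Rcomm.
have RN M : R M -> R (- M).
  by move=> RMM; rewrite -scaleN1r -mul_scalar_mx; apply: RM.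
suff main k (La : 'M[L]_(k, N)) : (forall c : 'rV_k, c *m La = 0 -> c = 0) ->
    forall Z : 'M[L]_(k, N), exists2 M, R M & La *m M = Z.
  move=> M; have [c|M' RM' <-] := main N 1%:M _ M; first by rewrite mulmx1.
  by rewrite mul1mx.
elim: k La => [|k IHk]; first by move=> La _ Z; exists 0%:M => //; apply/matrixP => -[].
rewrite -[k.+1]/(1 + k)%N => La indep Z.
pose l := usubmx La; pose La' := dsubmx La.
have DLa : La = col_mx l La' by rewrite vsubmxK.
have {}IHk := IHk La'.
have indep' (c : 'rV_k) : c *m La' = 0 -> c = 0.
  move=> cL; have := indep (row_mx (0 : 'rV_1) c : 'rV_(1 + k)).
  rewrite DLa mul_row_col mul0mx add0r cL => /(_ erefl).
  by rewrite -row_mx0 => /eq_row_mx[].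
have {}IHk := IHk indep'.
have [[M [RMM LM lM]]|none] := pselect (exists M, [/\ R M, La' *m M = 0 & l *m M != 0]).
  have [M1 RM1 E1] := IHk (dsubmx Z).
  have [M2 RM2 E2] := Rirr _ (usubmx Z - l *m M1) lM.
  exists (M1 + M *m M2); first by apply: RD => //; apply: RM.
  rewrite DLa mul_col_mx !mulmxDr E1 !mulmxA LM mul0mx addr0 E2.
  by rewrite addrC subrK vsubmxK.
have kill M : R M -> La' *m M = 0 -> l *m M = 0.
  by move=> RMM LM; apply: contrapT => /eqP lM; apply: none; exists M.
have [g gP] := @choice 'M[L]_(k, N) 'M[L]_N (fun Z' M => R M /\ La' *m M = Z')
  (fun Z' => let: ex_intro2 M h1 h2 := IHk Z' in ex_intro _ M (conj h1 h2)).
have gE Z' M : R M -> La' *m M = Z' -> l *m g Z' = l *m M.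
  move=> RMM LM; have [RgZ LgZ] := gP Z'; apply/eqP; rewrite -subr_eq0 -mulmxBr.
  by apply/eqP/kill; [apply/RD/RN|rewrite mulmxBr LgZ LM subrr].
pose f (j : 'I_k) (z : 'rV[L]_N) := l *m g (delta_mx j 0 *m z).
have [j|c cP] := @choice 'I_k L (fun j a => forall z, f j z = a *: z).
  apply: Rcomm => z M RMM; rewrite /f; have [Rg Lg] := gP (delta_mx j 0 *m z).
  rewrite -mulmxA; apply: gE; first exact: RM.
  by rewrite mulmxA Lg mulmxA.
suff lE : l = (\row_j c j) *m La'.
  have := indep (row_mx (1 : 'rV_1) (- \row_j c j) : 'rV_(1 + k)).
  rewrite DLa mul_row_col [1 *m l]mul1mx mulNmx -lE subrr => /(_ erefl).
  rewrite -row_mx0 => /eq_row_mx[/matrixP/(_ 0 0)/eqP].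
  by rewrite !mxE oner_eq0.
have gD (I : finType) (F : I -> 'M[L]_(k, N)) :
    l *m g (\sum_i F i) = \sum_i l *m g (F i).
  rewrite -mulmx_sumr; apply: gE; last first.
    by rewrite mulmx_sumr; apply: eq_bigr => i _; have [] := gP (F i).
  elim/big_ind: _ => [||i _]; [|exact: RD|by have [] := gP (F i)].
  by have := RC 0; rewrite raddf0.
have := gE La' 1%:M (RC 1) (mulmx1 _); rewrite mulmx1 => <-.
have {1}-> : La' = \sum_j delta_mx j 0 *m row j La'.
  apply/matrixP => i l'; rewrite summxE (bigD1 i) //= big1 ?addr0 => [|j ji].
    by rewrite [RHS]mxE big_ord1 [X in _ = X * _]mxE [row _ _ _ _]mxE !eqxx mul1r.
  by rewrite [LHS]mxE big_ord1 !mxE eq_sym (negbTE ji) mul0r.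
rewrite gD mulmx_sum_row; apply: eq_bigr => j _; rewrite mxE -cP //.
Qed.

Section Representation.
Variables (D : unitRingType) (n : nat) (S : set D) (c : comm_division D).
Hypotheses (divD : division_ring D) (subS : division_subring S).
Hypothesis cS : forall x, x \in c -> S x.
Hypothesis cmax : forall x, S x -> (forall y, y \in c -> x * y = y * x) -> x \in c.
Local Notation L := (cd_field c).
Local Notation lift M := (map_mx (val : L -> D) M).

Definition mx_in (p q : nat) (M : 'M[D]_(p, q)) : Prop := forall i j, S (M i j).

Lemma subS1 : S 1. Proof. by case: subS => S1 _ _; apply/set_mem/S1. Qed.
Lemma subSB x y : S x -> S y -> S (x - y).
Proof. by case: subS => _ SB _ Sx Sy; apply/set_mem/SB; apply/mem_set. Qed.
Lemma subSV x : S x -> S x^-1.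
Proof.
by case: subS => _ _ SV Sx; rewrite -[_^-1]mul1r; apply/set_mem/SV; apply/mem_set => //; apply: subS1.
Qed.
Lemma subS0 : S 0. Proof. by rewrite -(subrr 1); apply: subSB; apply: subS1. Qed.
Lemma subSD x y : S x -> S y -> S (x + y).
Proof.
move=> Sx Sy; rewrite -[y]opprK; apply: subSB => //; rewrite -sub0r.
by apply: subSB => //; apply: subS0.
Qed.
Lemma subSM x y : S x -> S y -> S (x * y).
Proof.
case: subS => _ _ SV Sx Sy; rewrite -[y]invrK; apply/set_mem/SV; apply/mem_set => //.
exact: subSV.
Qed.
Lemma subS_sum (I : Type) (r : seq I) (P : pred I) (F : I -> D) :
  (forall i, P i -> S (F i)) -> S (\sum_(i <- r | P i) F i).
Proof. by move=> SF; elim/big_ind: _ => //; [apply: subS0|apply: subSD]. Qed.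

Lemma mx_in_mul p q r (M : 'M_(p, q)) (M' : 'M_(q, r)) :
  mx_in M -> mx_in M' -> mx_in (M *m M').
Proof. by move=> h h' i j; rewrite mxE; apply: subS_sum => k _; apply: subSM. Qed.

Lemma mx_in_add p q (M M' : 'M_(p, q)) : mx_in M -> mx_in M' -> mx_in (M + M').
Proof. by move=> h h' i j; rewrite mxE; apply: subSD. Qed.

Lemma mx_in_sub p q (M M' : 'M_(p, q)) : mx_in M -> mx_in M' -> mx_in (M - M').
Proof. by move=> h h' i j; rewrite !mxE; apply: subSB. Qed.

Lemma mx_in_scalar q a : S a -> mx_in (a%:M : 'M_q).
Proof.
by move=> Sa i j; rewrite mxE; case: eqP => _; rewrite ?mulr1n ?mulr0n //; apply: subS0.
Qed.

Lemma mx_in_delta p q (i : 'I_p) (j : 'I_q) : mx_in (delta_mx i j).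
Proof.
by move=> i' j'; rewrite mxE; case: (_ && _); [apply: subS1|apply: subS0].
Qed.

Lemma mx_in_lift p q (M : 'M[L]_(p, q)) : mx_in (lift M).
Proof. by move=> i j; rewrite mxE; apply: cS; exact: (valP (M i j)). Qed.

Hypothesis cfS : centrally_finite S.
Hypothesis n_gt0 : (0 < n)%N.

(** By maximality the center of [S] lies in [c], so a spanning family of [S] over its center, placed
    in each of the [n] coordinates, spans the rows over [c]. A spanning family of least size is
    free. *)
Lemma exists_basis : exists (N : nat) (EE : 'M[D]_(N, n)),
  [/\ mx_in EE,
     forall p (Z : 'M[D]_(p, n)), mx_in Z -> exists M : 'M[L]_(p, N), Z = lift M *m EE &
     forall p (M : 'M[L]_(p, N)), lift M *m EE = 0 -> M = 0].
Proof.
pose spans N (EE : 'M[D]_(N, n)) := mx_in EE /\ forall v : 'rV[D]_n, mx_in v ->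
  exists l : 'rV[L]_N, v = lift l *m EE.
have ex_span : exists N, `[< exists EE : 'M[D]_(N, n), spans N EE >].
  have [b [bS b_span]] := cfS.
  pose T : finType := ('I_n * 'I_(size b))%type; exists #|T|; apply/asboolP.
  pose ev : 'I_#|T| -> T := enum_val.
  exists (\matrix_(i, j) if (ev i).1 == j then b`_(ev i).2 else 0).
  split=> [i j|v Sv].
    rewrite mxE; case: ifP => _; last exact: subS0.
    by apply/set_mem/bS/mem_nth.
  have [j|co coP] := @choice _ _ (fun j (co : 'I_(size b) -> L) =>
      v 0 j = \sum_k val (co k) * b`_k).
    have [co co_c ->] := b_span _ (Sv 0 j).
    have co_in k : co k \in c.
      have [Sk ck] := co_c k; apply: cmax => // y yc; exact/ck/cS.
    by exists (fun k => CdField (co_in k)).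
  exists (\row_i co (ev i).1 (ev i).2).
  apply/rowP => j; rewrite coP [RHS]mxE.
  transitivity (\sum_(t : T) if t.1 == j then val (co t.1 t.2) * b`_t.2 else 0); last first.
    rewrite (reindex ev) /=; last first.
      by exists enum_rank => i _; rewrite /ev ?enum_valK ?enum_rankK.
    by apply: eq_bigr => i _; rewrite !mxE; case: ifP; rewrite ?mulr0.
  rewrite -(pair_bigA _ (fun i k => if i == j then val (co i k) * b`_k else 0)) /=.
  rewrite (bigD1 j) //= [X in _ = _ + X]big1 ?addr0 => [|i /negbTE ij].
    by apply: eq_bigr => k _; rewrite eqxx.
  by rewrite big1 // => k _; rewrite ij.
have [N /asboolP[EE [EEin span]] Nmin] := ex_minnP ex_span.
have indep (l : 'rV[L]_N) : lift l *m EE = 0 -> l = 0.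
  move=> l0; apply: contrapT => /eqP/rV0Pn[i li].
  case: N i => [[]//|N] i in EE EEin span Nmin l l0 li *.
  suff : (N.+1 <= N)%N by rewrite ltnn.
  apply: Nmin; apply/asboolP; exists (row' i EE); split=> [k j|v Sv].
    by rewrite mxE; apply: EEin.
  have [m Dv] := span v Sv; pose l' := m - (m 0 i / l 0 i) *: l.
  exists (col' i l').
  have Dl' : v = lift l' *m EE.
    by rewrite /l' map_mxB map_mxZ mulmxBl -scalemxAl l0 scaler0 subr0.
  have l'i : l' 0 i = 0 by rewrite !mxE divfK // subrr.
  rewrite {1}Dl'; apply/rowP => j; rewrite !mxE (bigD1_ord i) //= mxE l'i mul0r add0r.
  by apply: eq_bigr => k _; rewrite !mxE.
exists N, EE; split=> // [p Z SZ|p M M0].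
  have [i|l lP] := @choice 'I_p 'rV[L]_N (fun i l => row i Z = lift l *m EE).
    by apply: span => i' j; rewrite mxE.
  exists (\matrix_i l i); apply/row_matrixP => i.
  by rewrite lP row_mul; congr (_ *m _); apply/rowP => j; rewrite !mxE.
apply/row_matrixP => i; rewrite row0; apply: indep.
by rewrite map_row -row_mul M0 row0.
Qed.

Variables (N : nat) (EE : 'M[D]_(N, n)).
Hypothesis EEin : mx_in EE.
Hypothesis EEspan :
  forall p (Z : 'M[D]_(p, n)), mx_in Z -> exists M : 'M[L]_(p, N), Z = lift M *m EE.
Hypothesis EEfree : forall p (M : 'M[L]_(p, N)), lift M *m EE = 0 -> M = 0.

(* [M] is the matrix, in the basis [EE], of right multiplication by [B] on the rows
   over [S], seen as a left vector space over [c]. *)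
Definition rep (B : 'M[D]_n) (M : 'M[L]_N) : Prop := EE *m B = lift M *m EE.

Lemma rep_exists B : mx_in B -> exists M, rep B M.
Proof. by move=> SB; apply: EEspan; apply: mx_in_mul. Qed.

Lemma repM B B' M M' : rep B M -> rep B' M' -> rep (B * B') (M * M').
Proof.
by rewrite /rep => h h'; rewrite -[B * B']/(B *m B') mulmxA h -mulmxA h' mulmxA -map_mxM.
Qed.

Lemma rep1 : rep 1 1.
Proof. by rewrite /rep mulmx1 map_mx1 mul1mx. Qed.

Lemma rep_injr B M M' : rep B M -> rep B M' -> M = M'.
Proof.
rewrite /rep => -> h; apply/eqP; rewrite -subr_eq0; apply/eqP/EEfree.
by rewrite map_mxB mulmxBl h subrr.
Qed.

Lemma mul_lift_inj p (M M' : 'M[L]_(p, N)) : lift M *m EE = lift M' *m EE -> M = M'.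
Proof.
move=> h; apply/eqP; rewrite -subr_eq0; apply/eqP/EEfree.
by rewrite map_mxB mulmxBl h subrr.
Qed.

(** Writing the identity as [lift La *m EE] suggests the inverse [lift (La *m invmx M) *m EE], whose
    entries stay in [S]; freeness of [EE] makes it two-sided. *)
Lemma rep_unit B M : mx_in B -> rep B M -> M \in unitmx ->
  exists B', [/\ B * B' = 1, B' * B = 1, mx_in B' & rep B' (invmx M)].
Proof.
move=> SB h uM; have [La D1] := EEspan (mx_in_scalar (q := n) subS1).
pose B' : 'M[D]_n := lift (La *m invmx M) *m EE.
have SB' : mx_in B' by apply: mx_in_mul => //; apply: mx_in_lift.
have B'B : B' *m B = 1.
  by rewrite /B' -mulmxA h mulmxA -map_mxM mulmxKV // -D1.
have BB' : B *m B' = 1.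
  have SZ : mx_in (B *m B' - 1%:M).
    apply: mx_in_sub; first exact: mx_in_mul.
    exact/mx_in_scalar/subS1.
  have [La' DZ] := EEspan SZ.
  have : lift (La' *m M) *m EE = 0.
    rewrite map_mxM -mulmxA -h mulmxA -DZ mulmxBl -mulmxA [B' *m B]B'B.
    by rewrite mulmx1 mul1mx subrr.
  move/EEfree => La'M; have La'0 : La' = 0 by rewrite -[La'](mulmxK uM) La'M mul0mx.
  by apply/eqP; rewrite -subr_eq0 DZ La'0 map_mx0 mul0mx.
exists B'; split=> //; have [M' h'] := rep_exists SB'.
have MM' : M * M' = 1.
  by apply: (@rep_injr 1); [rewrite -BB'; apply: repM|apply: rep1].
by have -> : invmx M = M' by rewrite -[M']mul1mx -(mulVmx uM) -mulmxA [M *m M']MM' mulmx1.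
Qed.

(** Coefficients central in [S] let scaling on the left pass through right multiplication by the
    [B i]; an arbitrary element of [L] would not. *)
Lemma rep_sum (q : nat) (a : 'I_q -> L) (B : 'I_q -> 'M[D]_n) (M : 'I_q -> 'M[L]_N) :
  (forall i s, S s -> val (a i) * s = s * val (a i)) ->
  (forall i, rep (B i) (M i)) -> rep (\sum_i val (a i) *: B i) (\sum_i a i *: M i).
Proof.
move=> aZ h; rewrite /rep mulmx_sumr map_mx_sum mulmx_suml; apply: eq_bigr => i _.
rewrite map_mxZ -scalemxAl -h; apply/matrixP => j k; rewrite !mxE mulr_sumr.
by apply: eq_bigr => l _; rewrite !mxE mulrA -aZ // -mulrA.
Qed.

Lemma rep_scalar (z : D) (zc : z \in c) :
  (forall s, S s -> z * s = s * z) -> rep z%:M (CdField zc)%:M.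
Proof.
move=> zS; rewrite /rep map_scalar_mx mul_scalar_mx; apply/matrixP => i j.
rewrite !mxE (bigD1 j) //= big1 ?addr0 => [|k kj]; first by rewrite mxE eqxx mulr1n zS.
by rewrite mxE (negbTE kj) mulr0n mulr0.
Qed.

Let j0 : 'I_n := Ordinal n_gt0.
Let e1 : 'rV[D]_n := delta_mx 0 j0.

(* A scalar matrix acts on all rows as left multiplication by a fixed element;
   comparing [s e_1] for [s] in [S] shows that this element is central in [S]. *)
Lemma rep_is_scalar B (l : L) : rep B l%:M ->
  B = (val l)%:M /\ forall s, S s -> val l * s = s * val l.
Proof.
move=> h; have act (v : 'rV[D]_n) : mx_in v -> v *m B = val l *: v.
  move=> Sv; have [m ->] := EEspan Sv.
  rewrite -mulmxA h mulmxA -map_mxM mul_mx_scalar map_mxZ scalemxAl //.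
have DB : B = (val l)%:M.
  apply/row_matrixP => i; rewrite !rowE act; last exact: mx_in_delta.
  apply/rowP => j; rewrite [LHS]mxE [RHS]mxE (bigD1 i) //= big1 ?addr0 => [|k ki].
    by rewrite !mxE !eqxx mul1r /= eq_sym; case: eqP => _; rewrite ?mulr1 ?mulr0.
  by rewrite mxE (negbTE ki) andbF mul0r.
split=> // s Ss; have Sse : mx_in (s *: e1).
  by move=> i j; rewrite mxE; apply: subSM => //; apply: mx_in_delta.
have := act _ Sse; rewrite -scalemxAl act; last exact: mx_in_delta.
by move/rowP/(_ j0); rewrite !mxE !eqxx !mulr1 => ->.
Qed.

Let rowmx (j : 'I_n) (v : 'rV[D]_n) : 'M[D]_n := \matrix_(i, k) if i == j then v 0 k else 0.

Let rowmxE (j : 'I_n) (u v : 'rV[D]_n) : u *m rowmx j v = u 0 j *: v.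
Proof.
apply/rowP => k; rewrite !mxE (bigD1 j) //= mxE eqxx big1 ?addr0 // => i /negbTE ij.
by rewrite mxE ij mulr0.
Qed.

Let rowmx_in (j : 'I_n) (v : 'rV[D]_n) : mx_in v -> mx_in (rowmx j v).
Proof. by move=> Sv i k; rewrite mxE; case: ifP => _ //; apply: subS0. Qed.

(** Matrices with a single nonzero row carry [e1] to any row over [S], so [f] is left multiplication
    by one element of [S]. Linearity over [c] makes it commute with [c], and maximality puts it in
    [c]. *)
Lemma rep_commutant (f : 'rV[L]_N -> 'rV[L]_N) :
  (forall v B M, mx_in B -> rep B M -> f (v *m M) = f v *m M) ->
  (forall v a, f (a *: v) = a *: f v) -> exists a, forall v, f v = a *: v.
Proof.
move=> fB fZ; have [ep De1] := EEspan (@mx_in_delta _ _ (0 : 'I_1) j0 : mx_in e1).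
have SV p (l : 'M[L]_(p, N)) : mx_in (lift l *m EE).
  by apply: mx_in_mul => //; apply: mx_in_lift.
pose phi := lift (f ep) *m EE.
have [s Ss main] : exists2 s, S s & forall v, lift (f v) *m EE = s *: (lift v *m EE).
  exists (phi 0 j0); first exact: SV.
  move=> v; have SB := rowmx_in j0 (SV 1%N v); have [M repM_] := rep_exists SB.
  have Dv : v = ep *m M.
    apply: mul_lift_inj; rewrite map_mxM -mulmxA -repM_ mulmxA -De1 rowmxE.
    by rewrite mxE !eqxx scale1r.
  rewrite {1}Dv (fB _ _ _ SB repM_) map_mxM -mulmxA -repM_ mulmxA.
  by rewrite -/phi rowmxE.
have sc : s \in c.
  apply: cmax => // y yc.
  have := main (CdField yc *: ep); rewrite fZ !map_mxZ -!scalemxAl -De1.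
  rewrite main -De1 => /rowP/(_ j0); rewrite !mxE !eqxx !mulr1 => /=.
  by move=> ->.
exists (CdField sc) => v; apply: mul_lift_inj.
by rewrite main map_mxZ -scalemxAl.
Qed.

(** The [L]-span of the represented matrices is a ring to which density applies. It is irreducible
    because a nonzero row has an entry invertible in [S], and one matrix with a single nonzero row
    then carries it to any given row. *)
Lemma rep_span (M : 'M[L]_N) : exists (q : nat) (B : 'I_q -> 'M[D]_n)
    (R : 'I_q -> 'M[L]_N) (a : 'I_q -> L),
  (forall i, mx_in (B i) /\ rep (B i) (R i)) /\ M = \sum_i a i *: R i.
Proof.
pose R M := exists2 s : seq (L * 'M[L]_N),
  forall t, t \in s -> exists2 B, mx_in B & rep B t.2 & M = \sum_(t <- s) t.1 *: t.2.
have [s sP ->] : R M.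
  have Rrep B M' : mx_in B -> rep B M' -> R M'.
    move=> SB h; exists [:: (1, M')]; last by rewrite big_seq1 scale1r.
    by move=> t; rewrite inE => /eqP ->; exists B.
  have RC a : R a%:M.
    exists [:: (a, 1)]; last by rewrite big_seq1 /= scalemx1.
    by move=> t; rewrite inE => /eqP ->; exists 1; [apply/mx_in_scalar/subS1|apply: rep1].
  move: M; apply: density_theorem => //.
  - move=> M M' [s sP ->] [s' sP' ->]; exists (s ++ s'); last by rewrite big_cat.
    by move=> t; rewrite mem_cat => /orP[/sP|/sP'].
  - move=> M M' [s sP ->] [s' sP' ->].
    exists [seq (t.1 * t'.1, t.2 *m t'.2) | t <- s, t' <- s'].
      move=> _ /allpairsP[[t t'] [/= /sP[B SB h] /sP'[B' SB' h'] ->]].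
      by exists (B *m B'); [apply: mx_in_mul|apply: repM].
    rewrite big_allpairs_dep mulmx_suml; apply: eq_bigr => t _.
    rewrite mulmx_sumr; apply: eq_bigr => t' _.
    by rewrite /= -scalemxAl -scalemxAr scalerA.
  - move=> v w v0; have SV (l : 'rV[L]_N) : mx_in (lift l *m EE).
      by apply: mx_in_mul => //; apply: mx_in_lift.
    have /rV0Pn[j vj] : lift v *m EE != 0.
      by apply: contraNneq v0 => /EEfree ->.
    pose x := (lift v *m EE) 0 j.
    have Sx : mx_in (x^-1 *: (lift w *m EE)).
      by move=> i k; rewrite mxE; apply: subSM; [apply/subSV/SV|apply: SV].
    have SB := rowmx_in j Sx; have [M h] := rep_exists SB.
    exists M; first exact: Rrep h.
    apply: mul_lift_inj; rewrite map_mxM -mulmxA -h mulmxA rowmxE scalerA.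
    by rewrite divrr ?scale1r //; apply: divD.
  move=> f fR; apply: rep_commutant => [v B M SB h|v a]; first exact/fR/(Rrep B).
  by rewrite -!mul_mx_scalar; apply: fR.
have [i|B BP] := @choice 'I_(size s) 'M[D]_n (fun i B =>
    mx_in B /\ rep B (tnth (in_tuple s) i).2).
  by have [B SB h] := sP _ (mem_tnth i (in_tuple s)); exists B.
exists (size s), B, (fun i => (tnth (in_tuple s) i).2), (fun i => (tnth (in_tuple s) i).1).
by split=> //; rewrite (big_tnth _ _ s).
Qed.

End Representation.

(** * Finite division subrings and central elements of infinite order *)

Section FiniteDivision.
Variable D : unitRingType.

(** The enumeration makes the subring a finite type, to which Wedderburn's theorem applies. *)
Record finite_division := FiniteDivision {
  fd_pred :> {pred D};
  fd_closed : GRing.divring_closed fd_pred;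
  fd_unit : {in fd_pred, forall x, x != 0 -> x \is a GRing.unit};
  fd_enum : seq D;
  fd_enumP : {subset fd_pred <= fd_enum}
}.

Variable c : finite_division.

HB.instance Definition _ :=
  GRing.isDivringClosed.Build D (fd_pred c) (fd_closed c).

Record fd_ring := FdRing { fd_val : D; _ : fd_val \in fd_pred c }.

HB.instance Definition _ := [isSub for fd_val].
HB.instance Definition _ := [Choice of fd_ring by <:].
HB.instance Definition _ := [SubChoice_isSubUnitRing of fd_ring by <:].

Definition fd_index (x : fd_ring) : seq_sub (fd_enum c) :=
  SeqSub (fd_enumP (valP x)).
Definition fd_of_index (i : seq_sub (fd_enum c)) : option fd_ring := insub (ssval i).
Lemma fd_indexK : pcancel fd_index fd_of_index.
Proof. by move=> x; rewrite /fd_of_index /= valK. Qed.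

HB.instance Definition _ : isCountable fd_ring := PCanIsCountable fd_indexK.
HB.instance Definition _ : isFinite fd_ring := PCanIsFinite fd_indexK.

Fact fd_ring_domain : GRing.integral_domain_axiom fd_ring.
Proof.
move=> x y /(congr1 val) /= xy0; apply/norP => -[x0 y0].
have Ux : val x \is a GRing.unit by apply: fd_unit; [apply: valP|rewrite -(inj_eq val_inj) in x0].
by move: y0; rewrite -(inj_eq val_inj) /= -(mulKr Ux (val y)) xy0 mulr0 eqxx.
Qed.

Lemma finite_division_comm : {in fd_pred c &, forall x y, x * y = y * x}.
Proof.
move=> x y Px Py.
by have := congr1 val (finDomain_mulrC fd_ring_domain (FdRing Px) (FdRing Py)).
Qed.

End FiniteDivision.

Lemma division_subring_gen (D : unitRingType) (X : set D) :
  division_subring (generated_division_subring X).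
Proof.
split=> [|x y /set_mem Sx /set_mem Sy|x y /set_mem Sx /set_mem Sy];
  apply/mem_set => A [subA XA]; have [A1 AB AV] := subA.
- exact/set_mem/A1.
- by apply/set_mem/AB; apply/mem_set; [apply: Sx|apply: Sy].
- by apply/set_mem/AV; apply/mem_set; [apply: Sx|apply: Sy].
Qed.

Lemma sub_gen (D : unitRingType) (X : set D) : X `<=` generated_division_subring X.
Proof. exact: sub_smallest. Qed.

Lemma gen_sub (D : unitRingType) (X S : set D) :
  division_subring S -> X `<=` S -> generated_division_subring X `<=` S.
Proof. by move=> subS XS x; apply; split. Qed.

Lemma finite_subring_comm (D : unitRingType) (S : set D) :
  division_ring D -> division_subring S -> finite_set S ->
  forall x y, S x -> S y -> x * y = y * x.
Proof.
move=> divD [S1 SB SV] /finite_seqP[e De] x y Sx Sy.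
pose P : {pred D} := fun x => `[< S x >].
have P_closed : GRing.divring_closed P.
  split=> [|u v /asboolP Su /asboolP Sv|u v /asboolP Su /asboolP Sv]; apply/asboolP.
  - exact/set_mem/S1.
  - by apply/set_mem/SB; apply/mem_set.
  - by apply/set_mem/SV; apply/mem_set.
have P_unit : {in P, forall x, x != 0 -> x \is a GRing.unit} by move=> u _; apply: divD.
have P_enum : {subset P <= e} by move=> u /asboolP; rewrite De.
by apply: (@finite_division_comm D (FiniteDivision P_closed P_unit P_enum)); apply/asboolP.
Qed.

(* If every element of the center had finite multiplicative order, the structure
   constants and the coordinates of the generators would lie in a finite ring. *)
Lemma center_infinite_order (D : unitRingType) (X : set D) (n : nat)
    (S := generated_division_subring X) :
  division_ring D -> finite_set X -> centrally_finite S ->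
  (0 < n)%N -> n%:R = 0 :> D -> infinite_set S ->
  exists th, [/\ center_of S th, th != 0 & forall i, (0 < i)%N -> th ^+ i != 1].
Proof.
move=> divD finX [b [bS b_span]] n_gt0 n0 infS; apply: contrapT => none; apply: infS.
have subS : division_subring S := division_subring_gen X.
have [S1 SB SV] := subS.
have tors x : center_of S x -> torsion x.
  move=> cx; have [->|x0] := eqVneq x 0; first by left.
  right; apply: contrapT => nt; apply: none; exists x; split=> // i i_gt0.
  by apply/negP => /eqP xi; apply: nt; exists i.
have [x|co coP] := @choice D ('I_(size b) -> D) (fun x co => S x ->
    (forall k, center_of S (co k)) /\ x = \sum_k co k * b`_k).
  have [Sx|nSx] := pselect (S x); last by exists (fun=> 0).
  by have [co ? ?] := b_span x Sx; exists co.
have [ex DX] := (iffLR (finite_seqP X)) finX.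
have bk k : (k < size b)%N -> S b`_k by move=> lt; apply/set_mem/bS/mem_nth.
have SM x y : S x -> S y -> S (x * y).
  move=> Sx Sy; have Sy' : S y^-1.
    by rewrite -[_^-1]mul1r; apply/set_mem/SV => //; apply/mem_set.
  by rewrite -[y]invrK; apply/set_mem/SV; apply/mem_set.
pose gens := 1 :: ex ++ [seq b`_i * b`_j | i <- iota 0 (size b), j <- iota 0 (size b)].
have gensS x : x \in gens -> S x.
  rewrite inE mem_cat => /or3P[/eqP ->|x_ex|/allpairsP[[i j] [/=]]].
  - exact/set_mem/S1.
  - by apply: sub_gen; rewrite DX.
  - by rewrite !mem_iota => /andP[_ i_b] /andP[_ j_b] ->; apply: SM; apply: bk.
pose xs := flatten [seq [seq co x k | k : 'I_(size b)] | x <- gens].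
have xsP x k : x \in gens -> co x k \in xs.
  by move=> xg; apply/flatten_mapP; exists x => //; apply/mapP; exists k; rewrite ?mem_enum.
have xsC z : z \in xs -> center_of S z.
  by move=> /flatten_mapP[x /gensS/coP[cox _] /mapP[k _ ->]].
have [z /xsC/tors //|x y /xsC[_ xC] /xsC[Sy _]|A [finA sA xsA commA]] :=
  finite_semisubring (xs := xs) n_gt0 n0; first exact: xC.
have [A0 A1 AD AM] := sA.
have commS a y : A a -> S y -> a * y = y * a.
  by move=> Aa Sy; apply: commA => // x /xsC[_ xC]; apply: xC.
(* The set [T] is finite and closed under sums and products, hence under inverses; it contains [X]
   and so all of [S]. *)
pose T := [set y | exists2 f : 'I_(size b) -> D, forall k, A (f k) & y = \sum_k f k * b`_k].
have finT : finite_set T by apply: finite_combinations.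
have Tgens x : x \in gens -> T x.
  move=> xg; have [_ Dx] := coP x (gensS x xg).
  by exists (co x) => // k; apply/xsA/xsP.
have TD x y : T x -> T y -> T (x + y).
  move=> [f fA ->] [g gA ->]; exists (fun i => f i + g i) => [i|]; first exact: AD.
  by rewrite -big_split; apply: eq_bigr => i _; rewrite mulrDl.
have T0 : T 0 by exists (fun=> 0) => //; rewrite big1 // => i _; rewrite mul0r.
have TZ a y : A a -> T y -> T (a * y).
  move=> Aa [g gA ->]; exists (fun i => a * g i) => [i|]; first exact: AM.
  by rewrite mulr_sumr; apply: eq_bigr => i _; rewrite mulrA.
have Tsum k (F : 'I_k -> D) : (forall i, T (F i)) -> T (\sum_i F i).
  by move=> TF; elim/big_ind: _.
have TM x y : T x -> T y -> T (x * y).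
  move=> [f fA ->] [g gA ->]; rewrite mulr_suml; apply: (Tsum) => i.
  rewrite mulr_sumr; apply: (Tsum) => j.
  have -> : f i * b`_i * (g j * b`_j) = f i * (g j * (b`_i * b`_j)).
    by rewrite -!mulrA; congr (_ * _); rewrite !mulrA (commS (g j) b`_i) //; apply: bk.
  apply/TZ/TZ/Tgens => //; rewrite inE mem_cat; apply/or3P/Or33.
  by apply/allpairsP; exists (val i, val j); rewrite /= !mem_iota !ltn_ord.
have T1 : T 1 by apply: Tgens; rewrite inE eqxx.
have sT : semisubring T by split.
apply: (sub_finite_set _ finT); apply: gen_sub => [|x Xx]; last first.
  by apply: Tgens; rewrite inE mem_cat; move: Xx; rewrite DX /= => ->; rewrite orbT.
have TN x : T x -> T (- x) by apply: (semisubring_opp sT n_gt0 n0).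
have TV x : T x -> T x^-1.
  move=> Tx; have [->|x0] := eqVneq x 0; first by rewrite invr0.
  have [|[e e_gt0 xe]] := finite_closed_torsion finT sT Tx (divD x x0).
    by move/eqP; rewrite (negbTE x0).
  have -> : x^-1 = x ^+ e.-1.
    have Ux := divD x x0.
    by apply: (mulrI Ux); rewrite divrr // -exprS prednK.
  by elim: e.-1 => [|i IHi]; rewrite ?expr0 // exprS; apply: TM.
split=> [|x y /set_mem Tx /set_mem Ty|x y /set_mem Tx /set_mem Ty]; apply/mem_set => //.
  by apply: TD => //; apply: TN.
by apply: TM => //; apply: TV.
Qed.

(** * Words in iterated commutators *)

Definition comm_step (G : groupType) (a : G) (k : nat) (y : G) : G :=
  ((y * a * y^-1 * a^-1) ^+ k)%g.

Definition group_word (G : groupType) (s : seq (G * bool)) (y : G) : G :=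
  (\prod_(l <- s) (l.1 * (if l.2 then y^-1 else y)))%g.

(* An iterated commutator ends with [a^-1] and its inverse begins with [a]; these
   outer factors are counted with the coefficient that separates two letters. *)
Definition group_junction (G : groupType) (a : G) (l1 l2 : G * bool) : G :=
  ((if l1.2 then 1 else a^-1) * l2.1 * (if l2.2 then a else 1))%g.

Definition is_central (D : nzRingType) (n : nat) (g : GL D n) : Prop :=
  range (@scalar_center D n) (unit_val g).

Lemma unit_valX (R : pzRingType) (g : unit_group R) k :
  unit_val (g ^+ k)%g = unit_val g ^+ k.
Proof. by elim: k => [//|k IHk]; rewrite expgS exprS unit_valM IHk. Qed.

Lemma unit_valV (R : pzRingType) (g : unit_group R) : unit_val (g^-1)%g = unit_inv g.
Proof. by []. Qed.

(** One element of [D] is enough: if [g] is not a scalar matrix, nothing is asked of it. Once it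
    belongs to [S], it keeps [g] from being central over [S]. *)
Lemma noncentral_witness (D : nzRingType) (n : nat) (g : GL D n) : ~ is_central g ->
  exists y, forall x, unit_val g = x%:M -> x * y <> y * x.
Proof.
move=> ncg; apply: contrapT => none; apply: ncg.
have [[x Dx]|nsc] := pselect (exists x, unit_val g = x%:M); last first.
  by exfalso; apply: none; exists 0 => x Dx; exfalso; apply: nsc; exists x.
have [n0|n_gt0] := posnP n.
  exists 0 => //; apply/matrixP => i; exfalso.
  by move: (ltn_ord i); rewrite {2}n0.
have xC : x \in @central D.
  apply/centralP => y; apply: contrapT => xy; apply: none; exists y => x'.
  rewrite Dx => /matrixP/(_ (Ordinal n_gt0) (Ordinal n_gt0)).
  by rewrite !mxE eqxx !mulr1n => <-.
by exists (Center xC).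
Qed.

Section CentralElements.
Variables (D : unitRingType) (n : nat).
Implicit Types g h : GL D n.

Lemma is_central_comm g h : is_central g -> (g * h)%g = (h * g)%g.
Proof.
move=> [z _ Dz]; apply: unit_val_inj; rewrite !unit_valM -Dz.
exact: scalar_center_comm.
Qed.

Lemma is_centralM g h : is_central g -> is_central h -> is_central (g * h)%g.
Proof.
by move=> [z _ Dz] [t _ Dt]; exists (z * t) => //; rewrite rmorphM unit_valM /= Dz Dt.
Qed.

Lemma is_centralV g : division_ring D -> (0 < n)%N -> is_central g -> is_central g^-1%g.
Proof.
move=> divD n_gt0 [z _ Dz].
have zg : (val z)%:M *m unit_inv g = 1%:M.
  by rewrite -[RHS](unit_valK g) -Dz.
have z0 : val z != 0.
  apply/negP => /eqP z0; move: zg; rewrite z0 raddf0 mul0mx.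
  move/matrixP/(_ (Ordinal n_gt0) (Ordinal n_gt0))/eqP.
  by rewrite !mxE eqxx eq_sym oner_eq0.
have Uz := divD _ z0.
have zV : (val z)^-1 \in @central D.
  by apply/centralP => y; apply/esym/commrV/esym/(centralP _ (valP z)).
exists (Center zV) => //; rewrite /scalar_center /= unit_valV.
by rewrite -[RHS]mul1mx -[1%:M]/(1%:M) -(mulVr Uz) scalar_mxM -mulmxA zg mulmx1.
Qed.

End CentralElements.

Lemma unitmxX (R : comUnitRingType) (N : nat) (M : 'M[R]_N) k :
  M \in unitmx -> M ^+ k \in unitmx.
Proof.
by move=> uM; elim: k => [|k IHk]; [apply: unitmx1|rewrite exprS unitmx_mul uM].
Qed.

Section RepresentationGroup.
Variables (D : unitRingType) (n : nat) (S : set D) (c : comm_division D).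
Hypothesis subS : division_subring S.
Variables (N : nat) (EE : 'M[D]_(N, n)).
Hypothesis EEfree : forall p (M : 'M[cd_field c]_(p, N)),
  map_mx (val : cd_field c -> D) M *m EE = 0 -> M = 0.

Lemma repD (B B' : 'M[D]_n) M M' : rep (c := c) EE B M -> rep EE B' M' -> rep EE (B + B') (M + M').
Proof. by rewrite /rep => h h'; rewrite mulmxDr h h' map_mxD mulmxDl. Qed.

Lemma repB (B B' : 'M[D]_n) M M' : rep (c := c) EE B M -> rep EE B' M' -> rep EE (B - B') (M - M').
Proof. by rewrite /rep => h h'; rewrite mulmxBr h h' map_mxB mulmxBl. Qed.

Definition repg (g : GL D n) (M M' : 'M[cd_field c]_N) : Prop :=
  [/\ mx_in S (unit_val g), mx_in S (unit_inv g),
      rep EE (unit_val g) M & rep EE (unit_inv g) M'].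

Lemma repg_unit g M M' : repg g M M' -> M * M' = 1.
Proof.
move=> [_ _ h h']; apply: (@rep_injr _ _ _ _ _ EEfree 1); last exact: rep1.
by rewrite -(unit_valK g); apply: repM.
Qed.

Lemma repgM g h M M' P P' : repg g M M' -> repg h P P' -> repg (g * h)%g (M * P) (P' * M').
Proof.
move=> [Sg Sg' rg rg'] [Sh Sh' rh rh']; split.
- exact: (mx_in_mul subS).
- exact: (mx_in_mul subS).
- exact: repM.
- exact: repM.
Qed.

Lemma repgV g M M' : repg g M M' -> repg g^-1%g M' M.
Proof. by move=> [Sg Sg' rg rg']; split. Qed.

Lemma repg1 : repg 1%g 1 1.
Proof.
by split; rewrite ?unit_val1; try exact: rep1; apply: (mx_in_scalar subS); apply: subS1.
Qed.

Lemma repgX g M M' k : repg g M M' -> repg (g ^+ k)%g (M ^+ k) (M' ^+ k).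
Proof.
move=> h; elim: k => [|k IHk]; first exact: repg1.
by rewrite expgS exprS exprSr; apply: repgM.
Qed.

Lemma repg_step a A A' y Y Y' k : repg a A A' -> repg y Y Y' ->
  repg (comm_step a k y) (mx_step A A' k (Y, Y')).1 (mx_step A A' k (Y, Y')).2.
Proof.
move=> ha hy; apply: repgX; have := repgM (repgM (repgM hy ha) (repgV hy)) (repgV ha).
by rewrite /= !mulrA.
Qed.

Lemma repg_iter a A A' y Y Y' k r : repg a A A' -> repg y Y Y' ->
  repg (iter r (comm_step a k) y) (iter r (mx_step A A' k) (Y, Y')).1
    (iter r (mx_step A A' k) (Y, Y')).2.
Proof.
move=> ha hy; elim: r => [//|r IHr]; rewrite !iterS.
by have := repg_step k ha IHr; rewrite -surjective_pairing.
Qed.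

Lemma repg_word (R R' : GL D n -> 'M[cd_field c]_N) (s : seq (GL D n * bool)) y Y Y' :
  (forall l, l \in s -> repg l.1 (R l.1) (R' l.1)) -> repg y Y Y' ->
  exists W', repg (group_word s y) (mx_word [seq (R l.1, l.2) | l <- s] (Y, Y')) W'.
Proof.
move=> hs hy; rewrite /group_word /mx_word big_map.
elim: s hs => [|l s IHs] hs; first by exists 1; rewrite !big_nil; apply: repg1.
have [|W' hW] := IHs; first by move=> l' l's; apply: hs; rewrite inE l's orbT.
have hl := hs l (mem_head _ _).
have [Z' hZ] : exists Z', repg (if l.2 then y^-1 else y)%g (if l.2 then Y' else Y) Z'.
  by case: l.2; [exists Y; apply: repgV|exists Y'].
by exists (W' * (Z' * R' l.1)); rewrite !big_cons /=; apply/repgM/hW/repgM/hZ.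
Qed.

Lemma repg_junction a A A' l1 l2 M M' : repg a A A' -> repg l2.1 M M' ->
  rep EE (unit_val (group_junction a l1 l2)) (junction A A' (M, l1.2) (M, l2.2)).
Proof.
move=> ha hl; suff [W' []//] : exists W',
    repg (group_junction a l1 l2) (junction A A' (M, l1.2) (M, l2.2)) W'.
have [Z1 h1] : exists Z, repg (if l1.2 then 1 else a^-1)%g (if l1.2 then 1 else A') Z.
  by case: l1.2; [exists 1; apply: repg1|exists A; apply: repgV].
have [Z2 h2] : exists Z, repg (if l2.2 then a else 1)%g (if l2.2 then A else 1) Z.
  by case: l2.2; [exists A'|exists 1; apply: repg1].
by exists (Z2 * (M' * Z1)); apply: repgM h2; apply: repgM hl.
Qed.

End RepresentationGroup.

(** * A value of a word in one variable that is not power central *)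

Section Core.
Variables (D : unitRingType) (n : nat).
Hypotheses (divD : division_ring D) (wlfD : weakly_locally_finite D) (n_gt0 : (0 < n)%N).
Variable X0 : set D.
Hypotheses (finX0 : finite_set X0) (infX0 : infinite_set (generated_division_subring X0)).

Lemma noncentral_word_value (a : GL D n) (k r : nat) (s : seq (GL D n * bool)) :
  (0 < k)%N -> s != [::] -> ~ is_central a ->
  path.cycle (fun l1 l2 => `[< ~ is_central (group_junction a l1 l2) >]) s ->
  exists x : GL D n, forall p, (0 < p)%N ->
    ~ is_central (group_word s (iter r.+1 (comm_step a k) x) ^+ p)%g.
Proof.
move=> k_gt0 s_nil nca s_cycle; apply: contrapT => all_central.
have {}all_central (x : GL D n) : exists2 p, (0 < p)%N &
    is_central (group_word s (iter r.+1 (comm_step a k) x) ^+ p)%g.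
  apply: contrapT => none; apply: all_central; exists x => p p_gt0 cp.
  by apply: none; exists p.
pose bs : seq (GL D n) :=
  [:: a, (a^-1)%g & [seq group_junction a l1 l2 | l1 <- s, l2 <- s]].
have [g|y yP] := @choice (GL D n) D (fun g y => ~ is_central g ->
    forall x, unit_val g = x%:M -> x * y <> y * x).
  have [cg|/noncentral_witness[y yP]] := pselect (is_central g); last by exists y.
  by exists 0.
pose entries (M : 'M[D]_n) := [seq M i j | i <- enum 'I_n, j <- enum 'I_n].
pose gentries (g : GL D n) := entries (unit_val g) ++ entries (unit_inv g).
(* [S] must contain the entries of all coefficients and the witnesses that [a], its inverse and the
   junctions are noncentral; adding [X0] makes it infinite. *)
pose pool := [seq y g | g <- bs] ++ gentries a ++ flatten [seq gentries l.1 | l <- s].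
pose X : set D := X0 `|` [set` pool].
have finX : finite_set X by rewrite finite_setU; split=> //; apply: finite_seq.
pose S := generated_division_subring X.
have cfS : centrally_finite S := wlfD finX.
have subS : division_subring S := division_subring_gen X.
have XS x : X x -> S x by apply: sub_gen.
have poolS x : x \in pool -> S x by move=> xp; apply: XS; right.
have infS : infinite_set S.
  apply: contra_not infX0; apply: sub_finite_set; apply: gen_sub => // x X0x.
  by apply: XS; left.
have [c [cS cmax]] := exists_maximal_field divD subS.
have [N [EE [EEin EEspan EEfree]]] := exists_basis n subS cS cmax cfS.
pose L : fieldType := cd_field c; pose lift_val : L -> D := val.
pose rp : GL D n -> 'M[L]_N -> 'M[L]_N -> Prop := repg S EE.
have rp_exists (g : GL D n) : mx_in S (unit_val g) -> mx_in S (unit_inv g) ->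
    exists MM : 'M[L]_N * 'M[L]_N, rp g MM.1 MM.2.
  move=> Sg Sg'; have [M h] := rep_exists subS EEin EEspan Sg.
  by have [M' h'] := rep_exists subS EEin EEspan Sg'; exists (M, M').
have entriesP (M : 'M[D]_n) : (forall x, x \in entries M -> S x) -> mx_in S M.
  move=> SM i j; apply: SM; apply/allpairsP; exists (i, j).
  by rewrite !mem_enum.
have gentriesP (g : GL D n) : (forall x, x \in gentries g -> S x) ->
    exists MM : 'M[L]_N * 'M[L]_N, rp g MM.1 MM.2.
  by move=> Sg; apply: rp_exists; apply: entriesP => x xg; apply: Sg;
    rewrite mem_cat xg ?orbT.
have [[A A'] /= hA] : exists MM : 'M[L]_N * 'M[L]_N, rp a MM.1 MM.2.
  by apply: gentriesP => x xa; apply: poolS; rewrite mem_cat [_ \in gentries a ++ _]mem_cat xa orbT.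
have [g|RR RRP] := @choice (GL D n) ('M[L]_N * 'M[L]_N) (fun g MM =>
    (exists l, l \in s /\ l.1 = g) -> rp g MM.1 MM.2).
  have [[l [ls <-]]|no] := pselect (exists l, l \in s /\ l.1 = g); last by exists (1, 1).
  have [|MM h] := gentriesP l.1; last by exists MM.
  move=> x xl; apply: poolS; rewrite mem_cat [_ \in gentries a ++ _]mem_cat; apply/or3P/Or33.
  by apply/flatten_mapP; exists l.
have {RRP}hs l : l \in s -> rp l.1 (RR l.1).1 (RR l.1).2.
  by move=> ls; apply: RRP; exists l.
pose ss := [seq ((RR l.1).1, l.2) | l <- s].
have AA' : A * A' = 1 := repg_unit EEfree hA.
have A'A : A' * A = 1 := repg_unit EEfree (repgV hA).
have nonscalar g (M : 'M[L]_N) : g \in bs -> ~ is_central g -> rep EE (unit_val g) M ->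
    ~~ is_scalar_mx M.
  move=> g_bs ncg h; apply/negP => /is_scalar_mxP[l Dl]; rewrite Dl in h.
  have [Dg lS] := rep_is_scalar subS n_gt0 EEspan h.
  apply: (yP g ncg _ Dg); apply: lS; apply: poolS.
  by rewrite mem_cat; apply/orP; left; apply/mapP; exists g.
have nsA : ~~ is_scalar_mx A.
  by have [_ _ h _] := hA; apply: nonscalar h; rewrite // inE eqxx.
have nsA' : ~~ is_scalar_mx A'.
  have [_ _ _ h] := hA; apply: (nonscalar (a^-1)%g); rewrite // ?inE ?eqxx ?orbT //.
  by move=> /(is_centralV divD n_gt0); rewrite invgK.
have ss_nil : ss != [::] by rewrite /ss; case: (s) s_nil.
have ss_unit l : l \in ss -> l.1 \in unitmx.
  by move=> /mapP[l' /hs h ->]; have [] := mulmx1_unit (repg_unit EEfree h).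
have ss_cycle : path.cycle (fun l1 l2 => ~~ is_scalar_mx (junction A A' l1 l2)) ss.
  rewrite /ss cycle_map; apply: (sub_in_cycle (P := mem s) _ _ s_cycle); last exact/allP.
  move=> l1 l2 l1s l2s /asboolP nc /=.
  apply: (nonscalar (group_junction a l1 l2) _ _ nc).
    by rewrite inE; apply/orP; right; rewrite inE; apply/orP; right;
      apply/allpairsP; exists (l1, l2).
  exact: (repg_junction subS l1 hA (hs _ l2s)).
(* The elements of [L] central in [S], for which scaling a matrix over [S] scales its
   representation. *)
pose K : set L := [set t | forall x, S x -> val t * x = x * val t].
have K_c (z : D) : S z -> (forall x, S x -> z * x = x * z) -> z \in c.
  by move=> Sz zS; apply: (cmax) => // x xc; exact: zS _ (cS _ xc).
have richK : rich_subset K.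
  have [[m m_gt0 m0]|no] := pselect (exists2 m, (0 < m)%N & m%:R = 0 :> D).
    right; split; first by exists m => //; apply: val_inj; rewrite rmorph_nat.
    have [th [[Sth thS] th0 th_inf]] := center_infinite_order divD finX cfS m_gt0 m0 infS.
    exists (CdField (K_c _ Sth thS)); split=> [|i i_gt0|i x Sx].
    - by rewrite -(inj_eq val_inj).
    - by rewrite -(inj_eq val_inj) rmorphXn rmorph1; apply: th_inf.
    - by rewrite rmorphXn; apply/esym/commrX/esym/thS.
  left; split=> [m m_gt0|m x Sx]; last by rewrite rmorph_nat mulr_natl mulr_natr.
  apply/negP => /eqP/(congr1 val); rewrite rmorph_nat => m0.
  by apply: no; exists m.
have [kappa inj_kappa Kkappa] : exists2 kappa : nat -> L, injective kappa & forall i, K (kappa i).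
  case: richK => [[char0 Kn]|[_ [th [th0 th_inf Kth]]]].
    exists (fun i => i%:R) => //.
    have lt i j : (i < j)%N -> i%:R <> j%:R :> L.
      move=> ij /eqP; rewrite eq_sym -subr_eq0 -natrB; last exact: ltnW.
      by apply/negP/char0; rewrite subn_gt0.
    by move=> i j ij; case: (ltngtP i j) => // /lt; rewrite ij.
  exists (fun i => th ^+ i) => //.
  have lt i j : (i < j)%N -> th ^+ i <> th ^+ j.
    move=> ij eij; have := th_inf (j - i)%N; rewrite subn_gt0 => /(_ ij)/eqP; apply.
    by apply: (mulfI (expf_neq0 i th0)); rewrite -exprD subnKC ?mulr1 // ltnW.
  by move=> i j ij; case: (ltngtP i j) => // /lt; rewrite ij.
have S1 : S 1 := subS1 subS.
have N_gt0 : (0 < N)%N.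
  rewrite lt0n; apply/negP => /eqP N0.
  have [M /matrixP/(_ (Ordinal n_gt0) (Ordinal n_gt0))/eqP] := EEspan _ _ (mx_in_scalar subS (q := n) S1).
  rewrite !mxE eqxx big1 ?oner_eq0 // => -[i lt_i]; exfalso.
  by move: lt_i; rewrite {1}N0.
pose numer := word_numer A A' k r ss; pose denom := word_denom A A' k r ss.
have ratio (B : 'M[D]_n) (X1 : 'M[L]_N) : mx_in S B -> rep EE B X1 -> \det X1 != 0 ->
   exists (M : 'M[L]_N) (p : nat) (l : L), [/\ (0 < p)%N, l != 0, M ^+ p = l%:M,
     denom X1 != 0 & numer X1 = \tr M ^+ N / \det M * denom X1].
  move=> SB hB dX; have uX : X1 \in unitmx by rewrite unitmxE unitfE.
  have [B' [BB' B'B SB' hB']] := rep_unit subS cS EEin EEspan EEfree SB hB uX.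
  have Bunit : ((B, B').1 * (B, B').2 == 1) && ((B, B').2 * (B, B').1 == 1).
    by rewrite /= BB' B'B eqxx.
  pose x : GL D n := UnitGroup Bunit.
  have hx : rp x X1 (invmx X1) by split.
  have hy := repg_iter subS k r.+1 hA hx.
  have [W' hW] := repg_word subS (R := fun g => (RR g).1) (R' := fun g => (RR g).2) hs hy.
  rewrite -surjective_pairing -/ss in hW.
  set M := mx_word ss _ in hW.
  have [p p_gt0 [z _ Dz]] := all_central x.
  have uM : M \in unitmx by have [] := mulmx1_unit (repg_unit EEfree hW).
  have dM : \det M != 0 by rewrite -unitfE -unitmxE.
  have [SW _ hWp _] := repgX subS p hW.
  have zC y' : val z * y' = y' * val z by apply: (centralP _ (valP z)).
  have zS : S (val z).
    have := SW (Ordinal n_gt0) (Ordinal n_gt0); rewrite -Dz /scalar_center mxE eqxx.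
    by rewrite mulr1n.
  have zc := K_c _ zS (fun y' _ => zC y').
  have hz := rep_scalar EEin zc (fun y' _ => zC y').
  have Mp : M ^+ p = (CdField zc)%:M.
    by apply: (rep_injr EEfree hWp); rewrite -Dz.
  exists M, p, (CdField zc).
  have adjE : \adj X1 = \det X1 *: invmx X1.
    by rewrite /invmx uX scalerA divff // scale1r.
  have [g g0 Dg] := mx_eval_scale A A' k r.+1 ss X1 (invmx X1) dX.
  have numE : numer X1 = (g * \tr M) ^+ N * \det X1.
    by rewrite /numer /word_numer adjE Dg mxtraceZ.
  have denE : denom X1 = g ^+ N * \det M * \det X1.
    by rewrite /denom /word_denom adjE Dg detZ.
  split=> //.
  - apply: contraTneq (unitmxX p uM) => z0.
    by rewrite Mp z0 unitmxE det_scalar expr0n eqn0Ngt N_gt0 unitr0.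
  - by rewrite denE !mulf_neq0 // expf_neq0.
  - by rewrite numE denE exprMn; field.
have denom1 : denom 1 != 0.
  have det1_neq0 : \det (1 : 'M[L]_N) != 0 by rewrite det1 oner_neq0.
  have [M [p [l []]]] := ratio 1 1 (mx_in_scalar subS (q := n) S1) (rep1 c EE) det1_neq0.
  by [].
(* The line [1 + t (B - 1)] starts at the identity, where the denominator does not vanish. So the
   constant found on each such line is the value of the ratio at the identity, the same for all
   [B]. *)
have const B X1 : mx_in S B -> rep EE B X1 ->
    numer X1 = numer 1 / denom 1 * denom X1.
  move=> SB hB; have [P [Q PQ]] := word_polys A A' k r ss 1 (X1 - 1).
  have at0 : (1 : 'M[L]_N) + 0 *: (X1 - 1) = 1 by rewrite scale0r addr0.
  have at1 : (1 : 'M[L]_N) + 1 *: (X1 - 1) = X1 by rewrite scale1r addrC subrK.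
  have Q0 : Q != 0.
    apply: contraNneq denom1 => Q0; have [_] := PQ 0; rewrite at0 Q0 horner0.
    by rewrite -/denom => <-.
  have [|tau Ptau] := power_scalar_ratio_const (P := P) N_gt0 richK Q0.
    move=> t Kt Qt.
    have SBt : mx_in S (1 + val t *: (B - 1)).
      apply: (mx_in_add subS) => [|i j]; first exact: mx_in_scalar.
      rewrite mxE; apply: (subSM subS); first exact: cS _ (valP t).
      by apply: (mx_in_sub subS) => //; apply: mx_in_scalar.
    have hBt : rep EE (1 + val t *: (B - 1)) (1 + t *: (X1 - 1)).
      apply: repD; first exact: rep1.
      have := @rep_sum D n S c N EE EEin 1 (fun=> t) (fun=> B - 1) (fun=> X1 - 1)
        (fun _ => Kt) (fun _ => repB hB (rep1 c EE)).
      by rewrite !big_ord1.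
    have [PE QE] := PQ t; rewrite PE QE.
    have [|M [p [l [? ? ? _ ?]]]] := ratio _ _ SBt hBt; last by exists M, p, l.
    by move: Qt; rewrite QE /word_denom mulf_eq0 negb_or => /andP[].
  have [P0E Q0E] := PQ 0; have [P1E Q1E] := PQ 1.
  rewrite at0 in P0E Q0E; rewrite at1 in P1E Q1E.
  have -> : numer 1 / denom 1 = tau.
    by rewrite /numer -P0E Ptau hornerZ Q0E mulfK.
  by rewrite /numer /denom -P1E Ptau hornerZ Q1E.
apply: (@word_ratio_not_const L N kappa inj_kappa A A' k r ss AA' A'A k_gt0 nsA nsA'
  ss_unit ss_nil ss_cycle (numer 1 / denom 1)) => X1.
have [q [B [R [al [hBR ->]]]]] := rep_span divD subS cS cmax n_gt0 EEin EEspan EEfree X1.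
apply/eqP; rewrite -subr_eq0; apply/eqP.
apply: (@word_density L N kappa inj_kappa K
  (fun X => word_numer A A' k r ss X - numer 1 / denom 1 * word_denom A A' k r ss X)) => //.
  move=> C0 C1; have [P [Q PQ]] := word_polys A A' k r ss C0 C1.
  exists (P - (numer 1 / denom 1) *: Q) => t; have [PE QE] := PQ t.
  by rewrite hornerD hornerN hornerZ PE QE.
move=> ct Kct; apply/eqP; rewrite subr_eq0; apply/eqP.
apply: (const (\sum_i val (ct i) *: B i)).
  move=> i j; rewrite summxE; apply: (subS_sum subS) => l _; rewrite mxE.
  by apply: (subSM subS); [exact: cS _ (valP (ct l))|apply: (hBR l).1].
by apply: (rep_sum EEin) => [i|i]; [apply: Kct|apply: (hBR i).2].
Qed.

End Core.

(** * Almost subnormal subgroups and generalized monomials *)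

Section Subgroup.
Variables (G : groupType) (H : set G).
Hypothesis subgH : is_subgroup H.

Lemma subgroup1 : H 1%g.
Proof. by case: subgH => H1 _; apply/set_mem/H1. Qed.

Lemma subgroupV x : H x -> H (x^-1)%g.
Proof. by move=> Hx; apply/set_mem/(group_closedV subgH)/mem_set. Qed.

Lemma subgroupM x y : H x -> H y -> H (x * y)%g.
Proof. by move=> Hx Hy; apply/set_mem/(group_closedM subgH); apply/mem_set. Qed.

Lemma subgroupX x k : H x -> H (x ^+ k)%g.
Proof.
move=> Hx; elim: k => [|k IHk]; first exact: subgroup1.
by rewrite expgS; apply: subgroupM.
Qed.

End Subgroup.

(** Two of the cosets of [x ^+ j], for [j] up to their number, coincide, so some positive power of
    [x] with exponent at most that number lies in [H]; the factorial is a multiple of every such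
    exponent. *)
Lemma finite_index_exponent (G : groupType) (H K : set G) :
  is_subgroup H -> is_subgroup K -> finite_index_in H K ->
  exists2 k, (0 < k)%N & forall x, K x -> H (x ^+ k)%g.
Proof.
move=> subH subK /finite_seqP[cs csE].
exists (size cs)`!; first exact: fact_gt0.
move=> x Kx; pose coset j : set G := [set (x ^+ j * h)%g | h in H].
have coset_cs j : coset j \in cs.
  suff : [set` cs] (coset j) by [].
  by rewrite -csE; exists (x ^+ j)%g => //; apply: subgroupX.
have : ~~ uniq [seq coset j | j <- iota 0 (size cs).+1].
  apply/negP => /uniq_leq_size le_cs.
  have : {subset [seq coset j | j <- iota 0 (size cs).+1] <= cs}.
    by move=> _ /mapP[j _ ->]; apply: coset_cs.
  by move=> /le_cs; rewrite size_map size_iota ltnn.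
move=> /(uniqPn (coset 0%N))[i [j [ij]]]; rewrite size_map size_iota => j_cs.
have nth_coset l : (l < (size cs).+1)%N ->
    nth (coset 0%N) [seq coset j | j <- iota 0 (size cs).+1] l = coset l.
  by move=> lcs; rewrite (nth_map 0%N) ?size_iota // nth_iota.
rewrite !nth_coset // ?(ltn_trans ij) // => eq_coset.
have : coset j (x ^+ j)%g by exists 1%g; [apply: (subgroup1 subH)|rewrite mulg1].
rewrite -eq_coset => -[h Hh xh].
have Hij : H (x ^+ (j - i))%g.
  suff <- : h = (x ^+ (j - i))%g by [].
  by apply: (mulgI (x ^+ i)%g); rewrite xh -expgnDr subnKC // ltnW.
have /dvdnP[q ->] : ((j - i) %| (size cs)`!)%N by apply: dvdn_fact; lia.
by rewrite mulnC expgM; apply: subgroupX.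
Qed.

(* A commutator with [a] passes a normal step of the series, and its [k]-th power
   passes a step of finite index. *)
Lemma iterated_step_in (G : groupType) (N : set G) : almost_subnormal N ->
  exists r k, (0 < k)%N /\ forall a x, N a -> N (iter r (comm_step a k) x).
Proof.
move=> [r [H [H0 Hr subH chain]]].
have sub_r i : (i <= r)%N -> N `<=` H i.
  move=> ir; rewrite -Hr -(subnKC ir); move: (r - i)%N (subnKC ir) => d.
  elim: d i {ir} => [|d IHd] i ir; first by rewrite addn0.
  apply: (@subset_trans _ (H i.+1)).
    by rewrite addnS -addSn; apply: IHd; rewrite addSn -addnS.
  by have [] := chain i; first by lia.
have [k k_gt0 kP] : exists2 k, (0 < k)%N & forall i, (i < r)%N ->
    finite_index_in (H i.+1) (H i) -> forall x, H i x -> H i.+1 (x ^+ k)%g.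
  have : (r <= r)%N by [].
  elim: {-2}r => [|j IHj] jr; first by exists 1%N.
  have [k k_gt0 kP] := IHj (ltnW jr).
  have [fin|nfin] := pselect (finite_index_in (H j.+1) (H j)); last first.
    exists k => // i; rewrite ltnS leq_eqVlt => /orP[/eqP-> //|]; exact: kP.
  have [k' k'_gt0 k'P] := finite_index_exponent (subH _ jr) (subH _ (ltnW jr)) fin.
  exists (k * k')%N => [|i]; first by rewrite muln_gt0 k_gt0.
  have ir : (i < j.+1)%N -> (i.+1 <= r)%N by lia.
  move=> ij; move: ij (ir ij); rewrite ltnS leq_eqVlt => /orP[/eqP->|ij] {}ir fi x Hx.
    by rewrite mulnC expgM; apply/(subgroupX (subH _ ir) _)/k'P.
  by rewrite expgM; apply/(subgroupX (subH _ ir) _)/kP.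
exists r, k; split=> // a x Na; rewrite -Hr.
have : (r <= r)%N by [].
elim: {-2}r => [|i IHi] ir; first by rewrite H0.
have Hy := IHi (ltnW ir); set y := iter i _ x in Hy; rewrite iterS -/y.
have Ha := sub_r _ ir a Na.
have [subi [norm|fin]] := chain i ir.
  have subHi := subH _ ir; rewrite /comm_step; apply: subgroupX => //.
  apply: subgroupM => //; last exact: subgroupV.
  have := norm a y^-1%g Ha (subgroupV (subH _ (ltnW ir)) Hy).
  by rewrite /conjg invgK mulgA.
apply: (kP i) => //; have subHi := subH _ (ltnW ir); have := subi a Ha => Ha'.
do ![apply: subgroupM => //]; exact: subgroupV.
Qed.

Lemma path_violation (T : eqType) (e : rel T) (x : T) (p : seq T) : ~~ path e x p ->
  exists q1 y z q2, x :: p = q1 ++ [:: y, z & q2] /\ ~~ e y z.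
Proof.
elim: p x => [//|z p IHp] x /=; rewrite negb_and.
have [xz /= /IHp[q1 [y [t [q2 [-> yt]]]]]|xz _] := boolP (e x z).
  by exists (x :: q1), y, t, q2.
by exists [::], x, z, p.
Qed.

Section Words.
Variables (G U : groupType) (f : G -> U) (I : choiceType) (t : I -> U).

Definition letter_value (l : G * I * bool) : U :=
  (f l.1.1 * (if l.2 then (t l.1.2)^-1 else t l.1.2))%g.

Definition word_value (s : seq (G * I * bool)) : U := (\prod_(l <- s) letter_value l)%g.

Lemma word_value_cat s1 s2 : word_value (s1 ++ s2) = (word_value s1 * word_value s2)%g.
Proof. exact: big_cat. Qed.

Lemma word_value_cons l s : word_value (l :: s) = (letter_value l * word_value s)%g.
Proof. exact: big_cons. Qed.

Hypothesis fM : forall g h, f (g * h)%g = (f g * f h)%g.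

Lemma word_hom1 : f 1%g = 1%g.
Proof. by apply: (mulgI (f 1%g)); rewrite -fM !mulg1. Qed.

Definition is_word (u : U) : Prop := exists s a, u = (word_value s * f a)%g.

Lemma is_word1 : is_word 1%g.
Proof. by exists [::], 1%g; rewrite /word_value big_nil word_hom1 mulg1. Qed.

Lemma is_word_hom u a : is_word u -> is_word (u * f a)%g.
Proof. by move=> [s [b ->]]; exists s, (b * a)%g; rewrite fM mulgA. Qed.

Lemma is_word_letter u x (e : bool) :
  is_word u -> is_word (u * (if e then (t x)^-1 else t x))%g.
Proof.
move=> [s [a ->]]; exists (rcons s (a, x, e)), 1%g.
by rewrite word_hom1 mulg1 -cats1 word_value_cat /word_value big_seq1 mulgA.
Qed.

Lemma is_word_var u x (k : int) : is_word u -> is_word (u * expgz (t x) k)%g.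
Proof.
have pos v p : is_word v -> is_word (v * t x ^+ p)%g.
  move=> vW; elim: p => [|p IHp]; first by rewrite mulg1.
  by rewrite expgSr mulgA; apply: (is_word_letter x false IHp).
have neg v p : is_word v -> is_word (v * t x ^- p)%g.
  move=> vW; elim: p => [|p IHp]; first by rewrite invg1 mulg1.
  by rewrite expgS invMg mulgA; apply: (is_word_letter x true IHp).
by case: k => p; [apply: pos|apply: neg].
Qed.

Lemma is_word_prod (s : seq (G * I * int)) a :
  is_word ((\prod_(u <- s) (f u.1.1 * expgz (t u.1.2) u.2)) * f a)%g.
Proof.
apply: is_word_hom; elim/last_ind: s => [|s u IHs]; first by rewrite big_nil; apply: is_word1.
by rewrite -cats1 big_cat big_seq1 /= mulgA; apply/is_word_var/is_word_hom.
Qed.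

Variable Z : set G.
Hypothesis fZ : forall z x, Z z -> (f z * t x = t x * f z)%g.

Definition unreduced_pair (l1 l2 : G * I * bool) : Prop :=
  [/\ l1.1.2 = l2.1.2, l1.2 = ~~ l2.2 & Z l2.1.1].

Definition reduced_cycle (s : seq (G * I * bool)) : Prop :=
  path.cycle (fun l1 l2 => `[< ~ unreduced_pair l1 l2 >]) s.

Definition reducible_to_cycle (u : U) : Prop :=
  (exists v a, u = (f a ^ v)%g) \/
  exists v s, [/\ s != [::], reduced_cycle s & u = (word_value s ^ v)%g].

Lemma reducible_conj u v : reducible_to_cycle u -> reducible_to_cycle (u ^ v)%g.
Proof.
case=> [[w [a ->]]|[w [s [s0 rs ->]]]]; first by left; exists (w * v)%g, a; rewrite conjgM.
by right; exists (w * v)%g, s; rewrite conjgM.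
Qed.

Lemma reducible_comm u v : reducible_to_cycle (u * v)%g -> reducible_to_cycle (v * u)%g.
Proof.
move=> /reducible_conj-/(_ u); suff -> : ((u * v) ^ u = v * u)%g by [].
by rewrite /conjg !mulgA mulVg mul1g.
Qed.

Lemma unreduced_cancel l1 l2 : unreduced_pair l1 l2 ->
  (letter_value l1 * letter_value l2 = f (l1.1.1 * l2.1.1))%g.
Proof.
case: l1 l2 => [[b1 x1] e1] [[b2 x2] e2] [/= -> -> Zb2]; rewrite /letter_value /= fM.
have fZV : (f b2 * (t x2)^-1 = (t x2)^-1 * f b2)%g.
  by apply: (mulgI (t x2)); rewrite mulgA -fZ // mulgK mulgA mulgV mul1g.
case: e2 => /=.
  by rewrite fZV mulgA mulgK.
by rewrite fZ // mulgA mulgVK.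
Qed.

(** Up to conjugation a word may be rotated, so its final coefficient is absorbed into the first
    letter and any unreduced pair, even one straddling the two ends, can be brought to the front.
    There it cancels, which removes two letters. *)
Lemma word_reducible u : is_word u -> reducible_to_cycle u.
Proof.
move=> [s [a ->]]; have [m] := ubnP (size s); elim: m s a => [//|m IHm] s a.
rewrite ltnS => s_m; case: s s_m => [_|[[b x] e] p].
  by left; exists 1%g, a; rewrite /word_value big_nil mul1g conjg1.
move=> p_m; apply: reducible_comm; rewrite word_value_cons mulgA.
set l := ((a * b)%g, x, e).
have -> : (f a * letter_value (b, x, e) = letter_value l)%g by rewrite /letter_value /= fM mulgA.
rewrite -word_value_cons.
have cancel l1 l2 q : unreduced_pair l1 l2 -> (size q < m)%N ->
    reducible_to_cycle (word_value [:: l1, l2 & q]).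
  move=> bad q_m; rewrite !word_value_cons mulgA unreduced_cancel //.
  by apply/reducible_comm/IHm.
have [rs|] := pselect (reduced_cycle (l :: p)).
  by right; exists 1%g, (l :: p); rewrite conjg1.
rewrite /reduced_cycle /= rcons_path => /negP; rewrite negb_and => /orP[].
  move=> /path_violation[q1 [y [z [q2 [def_lp]]]]] /asboolP/contrapT bad.
  rewrite def_lp word_value_cat; apply: reducible_comm; rewrite -word_value_cat.
  apply: cancel => //; move/(congr1 size): def_lp p_m; rewrite /= !size_cat /=; lia.
move=> /asboolP/contrapT; case/lastP: p p_m => [|p l'] p_m.
  (* A single letter is its own successor, and its sign is not the opposite of itself. *)
  by move=> [_ /=]; case: (e).
rewrite last_rcons => bad.
rewrite -cats1 -cat_cons word_value_cat; apply: reducible_comm.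
rewrite -word_value_cat /=; apply: cancel => //.
by move: p_m; rewrite /= size_rcons; lia.
Qed.

End Words.

(** * Substituting conjugates of one element for the indeterminates *)

Section Substitution.
Variables (G : groupType) (Z : set G).
Hypothesis ZM : forall x y, Z x -> Z y -> Z (x * y)%g.
Hypothesis ZV : forall x, Z x -> Z x^-1%g.
Hypothesis ZC : forall x y, Z x -> (x * y = y * x)%g.

Lemma central_conj x y : Z (x ^ y)%g <-> Z x.
Proof.
have conjZ u v : Z u -> (u ^ v = u)%g by move=> Zu; rewrite /conjg (@ZC u v Zu) mulKg.
split=> [Zxy|Zx]; last by rewrite conjZ.
by rewrite -[x](conjgK y) conjZ.
Qed.

(** If [c ^- i * b * c ^+ j] and [c ^- i0 * b * c ^+ j0] are both central, eliminating [b] makes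
    [c ^+ (i + j0) * c ^- (i0 + j)] central, so [i + j0 = i0 + j]. Thus each [b] excludes at most
    one difference of exponents, and [M] is taken beyond all of them. *)
Lemma far_powers_noncentral (c : G) (bs : seq G) :
  (forall p, (0 < p)%N -> ~ Z (c ^+ p)%g) -> exists2 M, (0 < M)%N &
  forall b, b \in bs -> forall i j, (M + i <= j)%N || (M + j <= i)%N ->
    ~ Z (c ^- i * b * c ^+ j)%g.
Proof.
move=> cZ; elim: bs => [|b bs [M M_gt0 hM]]; first by exists 1%N.
have [[i0 [j0 Z0]]|no] := pselect (exists i j, Z (c ^- i * b * c ^+ j)%g); last first.
  exists M => // b'; rewrite inE => /orP[/eqP-> i j _ Zij|]; last exact: hM.
  by apply: no; exists i, j.
exists (M + i0 + j0)%N => [|b']; first by lia.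
rewrite inE => /orP[/eqP-> i j far Zij|b'_bs i j far]; last by apply: hM => //; lia.
set z := (c ^- i * b * c ^+ j)%g in Zij; set z0 := (c ^- i0 * b * c ^+ j0)%g in Z0.
have ratio : Z (c ^+ (i + j0) * c ^- (i0 + j))%g.
  have eq_b : (c ^+ i * z * c ^+ j0 = c ^+ i0 * z0 * c ^+ j)%g.
    by rewrite /z /z0 !mulgA !mulgV !mul1g -!mulgA -!expgnDr addnC.
  suff -> : (c ^+ (i + j0) * c ^- (i0 + j) = z^-1 * z0)%g by apply: ZM => //; apply: ZV.
  apply: (mulgI z); rewrite mulKVg; apply: (mulIg (c ^+ (i0 + j))%g).
  rewrite mulgA mulgVK !expgnDr !mulgA (@ZC z) // eq_b.
  by rewrite (@ZC z0).
have contra p q : (q < p)%N -> ~ Z (c ^+ p * c ^- q)%g.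
  move=> qp Zpq; apply: (cZ (p - q)%N); first by rewrite subn_gt0.
  by move: Zpq; rewrite -{1}(subnK (ltnW qp)) expgnDr mulgK.
have [lt|lt|eq] := ltngtP (i + j0) (i0 + j).
- apply: (contra _ _ lt); have := ZV ratio; by rewrite invMg invgK.
- exact: (contra _ _ lt).
- by move: far eq; lia.
Qed.

Variables (I : choiceType) (g : I -> G) (y : G).

Definition conj_letter (l1 l2 : G * I * bool) : G * bool :=
  (((g l1.1.2)^-1 * l2.1.1 * g l2.1.2)%g, l2.2).

(** The conjugators of adjacent letters merge into the coefficient between them. [l] plays the
    letter preceding [s]; when it is also the last letter of [s], the value is a conjugate of a word
    in [y] alone. *)
Lemma word_value_conj_subst l s :
  word_value id (fun x => g x * y * (g x)^-1)%g s =
  (g l.1.2 * group_word (pairmap conj_letter l s) y * (g (last l s).1.2)^-1)%g.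
Proof.
elim: s l => [|l' s IHs] l.
  by rewrite /word_value /group_word !big_nil mulg1 mulgV.
rewrite word_value_cons (IHs l') /= /group_word big_cons /letter_value /=.
set W := (\prod_(l0 <- _) _)%g; rewrite !mulgA mulgV mul1g.
by case: l'.2; rewrite ?invMg ?invgK !mulgA mulgVK.
Qed.

Lemma cycle_conj_letter (R : rel (G * I * bool)) (J : rel (G * bool)) l s :
  (forall l0 l1 l2, R l1 l2 -> J (conj_letter l0 l1) (conj_letter l1 l2)) ->
  path.cycle R (rcons s l) -> path.cycle J (pairmap conj_letter l (rcons s l)).
Proof.
move=> RJ.
have RJpath l0 x p : path R x p -> path J (conj_letter l0 x) (pairmap conj_letter x p).
  by elim: p l0 x => [//|z p IHp] l0 x /= /andP[xz /IHp->]; rewrite RJ.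
have rotE l0 p (z : G * I * bool) : pairmap conj_letter l0 (rcons p z) =
    rcons (pairmap conj_letter l0 p) (conj_letter (last l0 p) z).
  by elim: p l0 => [|x p IHp] l0 //=; rewrite IHp.
case: s => [|x p]; first by rewrite /= !andbT => /RJ->.
by rewrite /= => /(RJpath l); rewrite rotE last_rcons.
Qed.

End Substitution.

Lemma reduced_word_not_identity (D : unitRingType) (n m : nat) (N : set (GL D n))
    (X0 : set D) (g0 : GL D n) (s : seq (GL D n * 'I_m * bool)) :
  division_ring D -> weakly_locally_finite D -> (0 < n)%N ->
  finite_set X0 -> infinite_set (generated_division_subring X0) ->
  almost_subnormal N -> N g0 -> ~ is_central g0 ->
  s != [::] -> reduced_cycle (@is_central D n) s ->
  ~ (forall c : 'I_m -> GL D n, (forall x, N (c x)) ->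
       exists2 p, (0 < p)%N & is_central (word_value id c s ^+ p)%g).
Proof.
move=> divD wlfD n_gt0 finX0 infX0 asN Ng0 ncg0 s_nil s_red all_central.
pose CM := @is_centralM D n.
pose CV := fun g => @is_centralV D n g divD n_gt0; pose CC := @is_central_comm D n.
have subN : is_subgroup N by have [r [H [_ <- subH _]]] := asN; apply: subH.
have [r [k [k_gt0 stepN]]] := iterated_step_in asN.
(* One step more than membership in [N] requires, because the leading coefficients have their stable
   shape only after at least one step. *)
have step_in a x : N a -> N (iter r.+1 (comm_step a k) x).
  move=> Na; rewrite iterS; have Ny := stepN a x Na.
  by apply: subgroupX => //; do ![apply: subgroupM => //]; apply: subgroupV.
have value := noncentral_word_value divD wlfD n_gt0 finX0 infX0.
(* The word [y] alone: its only junction is the inverse of [g0], which is not central. *)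
have [|x0 c0P] := value g0 k r [:: (1%g, false)] k_gt0 isT ncg0.
  by rewrite /= andbT; apply/asboolP; rewrite /group_junction /= !mulg1 => /CV; rewrite invgK.
set c0 := iter r.+1 _ _ in c0P; have Nc0 : N c0 := step_in _ _ Ng0.
have {}c0P p : (0 < p)%N -> ~ is_central (c0 ^+ p)%g.
  by move=> /c0P; rewrite /group_word big_seq1 mul1g.
(* No positive power of [c0] is central, so that conjugating the indeterminates by
   sparse powers of [c0] makes all the junctions noncentral. *)
have [M M_gt0 far] := far_powers_noncentral CM CV CC [seq l.1.1 | l <- s] c0P.
pose K := (M + M * m)%N; pose a := (c0 ^+ K)%g.
pose g (x : 'I_m) := (c0 ^+ (M * x))%g.
have Na : N a by apply: subgroupX.
have nca : ~ is_central a by apply: c0P; rewrite /K; lia.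
case/lastP: s => [//|s l0] in s_nil s_red all_central far *.
pose S := pairmap (conj_letter g) l0 (rcons s l0).
have S_cycle : path.cycle (fun l1 l2 => `[< ~ is_central (group_junction a l1 l2) >]) S.
  pose R (l1 l2 : GL D n * 'I_m * bool) :=
    `[< ~ unreduced_pair (@is_central D n) l1 l2 /\ l2 \in rcons s l0 >].
  apply: (cycle_conj_letter (R := R)); last first.
    apply: (sub_in_cycle (P := mem (rcons s l0)) _ _ s_red); last exact/allP.
    by move=> l1 l2 _ l2s /asboolP red; apply/asboolP.
  move=> l' [[b1 x1] e1] [[b2 x2] e2] /asboolP[red l2s]; apply/asboolP.
  have {}far := far b2 (map_f (fun l => l.1.1) l2s).
  have lex (x y : 'I_m) : (M * x <= M * y + M * m)%N.
    by have := ltn_ord x; nia.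
  have BE i j : (c0 ^- i * (g x1)^-1 * b2 * g x2 * c0 ^+ j =
      c0 ^- (M * x1 + i) * b2 * c0 ^+ (M * x2 + j))%g.
    by rewrite /g !expgnDr !invMg !mulgA.
  have Bnc : e1 = ~~ e2 -> ~ is_central ((g x1)^-1 * b2 * g x2)%g.
    move=> e12; have [x12|x12] := eqVneq x1 x2.
      move: red; rewrite /unreduced_pair /= => red.
      rewrite -x12 -[(_ * _ * _)%g]mulgA => /(central_conj CC) cb2; exact: red.
    apply: far; move: x12; rewrite -(inj_eq val_inj) /=; move: (nat_of_ord x1) (nat_of_ord x2) => i j.
    by rewrite neq_ltn => /orP[] ij; have := leq_mul (leqnn M) ij; rewrite mulnS => ->; rewrite ?orbT.
  (* For equal signs [a] stands on exactly one side, and [K] exceeds each exponent [M * x] by at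
     least [M], so the two powers of [c0] are far apart. For opposite signs the junction is the
     element of [Bnc] or its conjugate by [a]. *)
  rewrite /group_junction /conj_letter /=; case: e1 e2 Bnc {red l2s} => [] [] /= Bnc.
  - rewrite mul1g; have := BE 0%N K; rewrite invg1 mul1g addn0 => ->.
    by apply: far; have := lex x1 x2; rewrite /K; lia.
  - by rewrite mul1g mulg1; apply: Bnc.
  - by rewrite -[(_ * _ * _)%g]mulgA => /(central_conj CC); apply: Bnc.
  - rewrite mulg1; have := BE K 0%N; rewrite mulg1 addn0 !mulgA => ->.
    by apply: far; have := lex x2 x1; rewrite /K; lia.
have S_nil : S != [::] by rewrite /S; case: (s).
have [x xP] := value a k r S k_gt0 S_nil nca S_cycle.
set y := iter _ _ _ in xP; have Ny : N y := step_in _ _ Na.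
have [x'|p p_gt0] := all_central (fun x => g x * y * (g x)^-1)%g.
  have Ng : N (g x') by apply: subgroupX.
  by do ![apply: subgroupM => //]; apply: subgroupV.
rewrite (word_value_conj_subst g y l0) last_rcons => cW; apply: (xP p p_gt0).
apply/(central_conj CC _ (g l0.1.2)^-1%g); rewrite conjXg /conjg invgK.
by rewrite mulgA.
Qed.

Lemma word_value_morph (G U V : groupType) (h : U -> V) (I : choiceType)
    (f : G -> U) (t : I -> U) (s : seq (G * I * bool)) :
  (forall u v, h (u * v)%g = (h u * h v)%g) ->
  h (word_value f t s) = word_value (h \o f) (h \o t) s.
Proof.
move=> hM; have h1 := word_hom1 hM.
have hV u : h u^-1%g = (h u)^-1%g by apply: (mulgI (h u)); rewrite -hM !mulgV.
elim: s => [|l s IHs]; first by rewrite /word_value !big_nil.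
rewrite !word_value_cons hM IHs; congr (_ * _)%g; rewrite /letter_value hM /=.
by case: l.2; rewrite ?hV.
Qed.

(** * Generalized monomials as units of the coproduct *)

Section LaurentUnits.
Variables (D : nzRingType) (n m : nat).

Local Notation laurent := (gen_laurent D n m).
Local Notation elt g := (coprod_inr (@scalar_center D n) (@ga_const (center D) _) (ga_elt (center D) g)).

Lemma ga_const_comm (z : center D) (b : grpalg (center D) (free_group 'I_m)) :
  ga_const _ z * b = b * ga_const _ z.
Proof.
elim/ga_ind: b => [|x y IHx IHy|a g]; first by rewrite mulr0 mul0r.
  by rewrite mulrDl mulrDr IHx IHy.
by rewrite [LHS]ga_mulUU [RHS]ga_mulUU mulg1 mul1g mulrC.
Qed.

(** The images of [F] are central in both factors, hence commute with every term built from them; on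
    the second factor the gluing relation rewrites a scalar as a constant of the group algebra. *)
Lemma coef_scalar_comm (z : center D) (w : laurent) :
  coef m (scalar_center n z) * w = w * coef m (scalar_center n z).
Proof.
elim/coprodW: w => s.
have mulE (s1 s2 : coprod_term _ _) : coprod_class (@scalar_center D n)
    (@ga_const (center D) (free_group 'I_m)) (CMul s1 s2) =
    coprod_class _ _ s1 * coprod_class _ _ s2 by rewrite [RHS]coprod_mulE.
elim: s => [a|b|s IHs t IHt|s IHs|s IHs t IHt].
- by rewrite -[coprod_class _ _ _]/(coef m a) /coef -!rmorphM scalar_center_comm.
- rewrite /coef coprod_glue -[coprod_class _ _ _]/(coprod_inr _ _ b) -!rmorphM.
  by rewrite ga_const_comm.
- have -> : coprod_class (@scalar_center D n) (@ga_const _ (free_group 'I_m)) (CAdd s t) =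
    coprod_class _ _ s + coprod_class _ _ t by rewrite [RHS]coprod_addE.
  by rewrite mulrDl mulrDr IHs IHt.
- have -> : coprod_class (@scalar_center D n) (@ga_const _ (free_group 'I_m)) (COpp s) =
    - coprod_class _ _ s by rewrite [RHS]coprod_oppE.
  by rewrite mulrN mulNr IHs.
- by rewrite mulE mulrA IHs -mulrA IHt mulrA.
Qed.

Fact laurent_coef_subproof (a : GL D n)
    (p := (coef m (unit_val a), coef m (unit_inv a)) : laurent * laurent) :
  (p.1 * p.2 == 1) && (p.2 * p.1 == 1).
Proof. by rewrite /= /coef -!rmorphM unit_valK unit_invK rmorph1 eqxx. Qed.

Definition laurent_coef (a : GL D n) : unit_group laurent :=
  UnitGroup (laurent_coef_subproof a).

Lemma laurent_coefM a b : laurent_coef (a * b)%g = (laurent_coef a * laurent_coef b)%g.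
Proof. by apply: unit_val_inj; rewrite unit_valM /= /unit_val /= /coef rmorphM. Qed.

Lemma elt_mul (g h : free_group 'I_m) : elt (g * h)%g = elt g * elt h.
Proof. by rewrite -rmorphM; congr (coprod_inr _ _ _); rewrite [RHS]ga_mulUU mulr1. Qed.

Lemma elt_one : elt (1%g : free_group 'I_m) = 1.
Proof. exact: (rmorph1 (coprod_inr (@scalar_center D n) (@ga_const (center D) (free_group 'I_m)))). Qed.

Fact laurent_group_subproof (g : free_group 'I_m)
    (p := (elt g, elt g^-1%g) : laurent * laurent) :
  (p.1 * p.2 == 1) && (p.2 * p.1 == 1).
Proof. by rewrite /= -!elt_mul mulgV mulVg elt_one eqxx. Qed.

Definition laurent_group (g : free_group 'I_m) : unit_group laurent :=
  UnitGroup (laurent_group_subproof g).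

Lemma laurent_groupM g h : laurent_group (g * h)%g = (laurent_group g * laurent_group h)%g.
Proof. by apply: unit_val_inj; rewrite unit_valM; apply: elt_mul. Qed.

Definition laurent_var (x : 'I_m) : unit_group laurent := laurent_group (fg_gen x).

Lemma unit_val_laurent_var x k : unit_val (expgz (laurent_var x) k) = var_pow D n x k.
Proof.
suff -> : expgz (laurent_var x) k = laurent_group (expgz (fg_gen x) k) by [].
have h1 := word_hom1 laurent_groupM.
have hX p : laurent_group (fg_gen x ^+ p)%g = (laurent_var x ^+ p)%g.
  by elim: p => [//|p IHp]; rewrite !expgS laurent_groupM IHp.
case: k => p /=; rewrite -hX //; apply: (mulgI (laurent_group (fg_gen x ^+ p.+1)%g)).
by rewrite -laurent_groupM !mulgV.
Qed.

Fact eval_unit_subproof (c : 'I_m -> GL D n) (u : unit_group laurent)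
    (p := (eval c (unit_val u), eval c (unit_inv u)) : 'M[D]_n * 'M[D]_n) :
  (p.1 * p.2 == 1) && (p.2 * p.1 == 1).
Proof. by rewrite /= -!evalM unit_valK unit_invK eval1 eqxx. Qed.

Definition eval_unit c u : GL D n := UnitGroup (eval_unit_subproof c u).

Lemma eval_unitM c u v : eval_unit c (u * v)%g = (eval_unit c u * eval_unit c v)%g.
Proof. by apply: unit_val_inj; apply: evalM. Qed.

Lemma eval_unitJ c u v : eval_unit c (u ^ v)%g = (eval_unit c u ^ eval_unit c v)%g.
Proof.
rewrite /conjg !eval_unitM; congr (_ * _)%g; apply: (mulgI (eval_unit c v)).
by rewrite -eval_unitM !mulgV (word_hom1 (eval_unitM c)).
Qed.

Lemma eval_unit_coef c a : eval_unit c (laurent_coef a) = a.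
Proof. by apply: unit_val_inj; apply: eval_coef. Qed.

Lemma eval_unit_var c x : eval_unit c (laurent_var x) = c x.
Proof. by apply: unit_val_inj; apply: (eval_var_pow c x 1). Qed.

Lemma eval_unit_word c s :
  eval_unit c (word_value laurent_coef laurent_var s) = word_value id c s.
Proof.
rewrite (word_value_morph _ _ _ (eval_unitM c)) /word_value; apply: eq_bigr => l _.
by rewrite /letter_value /= eval_unit_coef eval_unit_var.
Qed.

End LaurentUnits.

Theorem theorem2p6 (D : unitRingType) (n : nat) (N : set (GL D n)) :
  division_ring D ->
  weakly_locally_finite D ->
  infinite_set [set: center D] ->
  (1 <= n)%N ->
  almost_subnormal N ->
  ((2 <= n)%N -> ~ locally_finite_field D) ->
  (exists (m : nat) (w : gen_laurent D n m), nontrivial_GPCGI N w) ->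
  [set unit_val g | g in N] `<=` range (@scalar_center D n).
Proof.
move=> divD wlfD _ n_gt0 asN not_lff [m [w [[[_ [s0 [a0 Dw]]] identity] nontrivial]]].
move=> _ [g Ng <-]; apply: contrapT => ncg.
have [X0 finX0 infX0] : exists2 X0 : set D, finite_set X0 &
    infinite_set (generated_division_subring X0).
  (* By Wedderburn's theorem, two noncommuting elements generate an infinite division subring. If
     [D] is commutative, [not_lff] provides [X0] when [n] is at least 2, and for [n = 1] every [g]
     is central. *)
  have [comm|/existsNP[x /existsNP[y xy]]] := pselect (forall x y : D, x * y = y * x).
    have [n_le1|n_gt1] := leqP n 1; last first.
      apply: contrapT => none; apply: (not_lff n_gt1); split=> // X finX.
      by apply: contrapT => infX; apply: none; exists X.
    exfalso; apply: ncg; have n1 : n = 1%N by lia.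
    move: g {Ng}; rewrite n1 => g; rewrite [unit_val g]mx11_scalar.
    have gC : unit_val g 0 0 \in @central D by apply/centralP => y; apply: comm.
    by exists (Center gC).
  exists [set x; y]; first by rewrite finite_setU; split; apply: finite_set1.
  move=> fin; apply: xy; apply: (finite_subring_comm divD (division_subring_gen _) fin).
    by apply: sub_gen; left.
  by apply: sub_gen; right.
have subN : is_subgroup N by have [r [H [_ <- subH _]]] := asN; apply: subH.
have [u Du wu] : exists2 u : unit_group (gen_laurent D n m), w = unit_val u &
    is_word (@laurent_coef D n m) (@laurent_var D n m) u.
  exists ((\prod_(u <- s0) (laurent_coef m u.1.1 * expgz (laurent_var D n u.1.2) u.2))
      * laurent_coef m a0)%g; last by apply: is_word_prod; apply: laurent_coefM.
  rewrite Dw unit_valM; congr (_ * _); elim: (s0) => [|v s IHs]; first by rewrite !big_nil.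
  by rewrite !big_cons IHs !unit_valM unit_val_laurent_var.
have value_central (c : 'I_m -> GL D n) : (forall x, N (c x)) ->
    exists2 p, (0 < p)%N & is_central (eval_unit c u ^+ p)%g.
  move=> /identity[p p_gt0 cp]; exists p => //.
  by rewrite /is_central unit_valX -[unit_val _]/(eval c (unit_val u)) -Du.
have conj_central := central_conj (@is_central_comm D n).
have [|[v [a Duv]]|[v [s [s_nil s_red Duv]]]] :=
    word_reducible (@laurent_coefM D n m) (Z := @is_central D n) _ wu.
- move=> z x [t _ Dt]; apply: unit_val_inj; rewrite !unit_valM /=.
  by rewrite [unit_val (laurent_coef m z)]/(coef m (unit_val z)) -Dt coef_scalar_comm.
(* A word conjugate to a constant [a] takes conjugates of [a] as values, so evaluating at the
   identity makes some [a ^+ p] scalar. Then [w ^+ p] is itself that scalar, against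
   nontriviality. *)
- have [x|p p_gt0] := value_central (fun=> 1%g); first exact: subgroup1.
  rewrite Duv eval_unitJ eval_unit_coef -conjXg => /conj_central[z _ Dz].
  apply: (nontrivial p p_gt0); exists (unit_val (a ^+ p)%g) => //.
  have apE : (laurent_coef m a ^+ p)%g = laurent_coef m (a ^+ p)%g.
    elim: p {p_gt0 Dz} => [|p IHp]; first by rewrite (word_hom1 (@laurent_coefM D n m)).
    by rewrite !expgS IHp laurent_coefM.
  rewrite Du -unit_valX Duv -conjXg apE /conjg !unit_valM.
  rewrite -[unit_val (laurent_coef m _)]/(coef m (unit_val (a ^+ p)%g)) -Dz coef_scalar_comm.
  by rewrite mulrA unit_invK mul1r.
- apply: (reduced_word_not_identity divD wlfD n_gt0 finX0 infX0 asN Ng ncg s_nil s_red).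
  move=> c /value_central[p p_gt0 cp]; exists p => //.
  by move: cp; rewrite Duv eval_unitJ eval_unit_word -conjXg => /conj_central.
Qed.
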